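(* Consider the deconvolution model of the context and the functional $\Phi=\int\varphi(x)f(x)\,dx$; let $s\ge0$, $B>0$. Suppose that $g$ is bounded above and that there are constants $C_{g2}>0$, $C_{\varphi1}>0$ and non-negative $\alpha,\beta,\gamma,a,b,d$ (with $\alpha>0$ and $\beta=0$ whenever $\gamma=0$, and $b=0$ whenever $d=0$) such that for all $\omega\in\mathbb R$ $$|g^*(\omega)|\le C_{g2}(\omega^2+1)^{-\alpha/2}e^{-\gamma|\omega|^\beta},\qquad|\varphi^*(\omega)|\ge C_{\varphi1}(\omega^2+1)^{-a/2}e^{-d|\omega|^b}.$$ Suppose $g^*$ is differentiable and, for some $C_g>0$ and $\tau\ge0$ with $\tau=0$ if $\gamma=0$, $$\frac{|(g^* )'(\omega)|}{|g^*(\omega)|}\le C_g(1+|\omega|)^\tau .$$ Suppose there exists $\omega_0\in(0,\infty)$ such that for $|\omega|>\omega_0$ the function $\rho(\omega)=\arg(\varphi^*(\omega))$ is twice continuously differentiable with $|\rho^{(j)}(\omega)|\le\rho<\infty$, $j=0,1,2$. Let $$R_n(\Omega_s(B))=\inf_{\widetilde\Phi}\sup_{f\in\Omega_s(B)}\mathbb E(\widetilde\Phi-\Phi)^2,$$ where the infimum is over all estimators $\widetilde\Phi$ of $\Phi$ based on $Y_1,\dots,Y_n$. Then, with a constant $C>0$ independent of $n$, $$R_n(\Omega_s(B))\ge\begin{cases} C n^{-1}&\text{if } b>\beta\ \text{ or }\ b=\beta,\ d>\gamma>0,\\ C n^{-1}&\text{if } b=\beta,\ d=\gamma,\ a\ge\alpha+1/2,\\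 C n^{-1}&\text{if } b=\beta>0,\ d=\gamma>0,\ a<\alpha+1/2,\\ C n^{-\frac{2s+2a-1}{2s+2\alpha}}&\text{if } d=\gamma=0,\ a<\alpha+1/2,\\ C(\log n)^{-U_3/\beta}\,n^{-d/\gamma}&\text{if } b=\beta,\ \gamma\ge d>0,\\ C(\log n)^{-U_4/\beta}\exp\!\Big(-2d\big[\tfrac{\log n}{2\gamma}\big]^{b/\beta}\Big)&\text{if } b<\beta,\ d>0,\ \gamma>0,\\ C(\log n)^{-\frac{2s+2a-1}{\beta}}&\text{if } b=d=0,\ \beta>0,\ \gamma>0, \end{cases}$$ where $U_3=2a+2s(1-d/\gamma)-2d\alpha/\gamma+8\beta-(U_\tau+1)d/\gamma-1$, $U_4=2a+2s+8b-1$ and $U_\tau=\min(7\beta-2\tau-1,\ 5\beta+1)$.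
   Context: Model: $Y_i=\theta_i+\xi_i$, $i=1,\dots,n$, where $\theta_i$ are i.i.d. with unknown pdf $f$, $\xi_i$ are i.i.d. with known pdf $g$, and the $\theta$'s and $\xi$'s are independent. For a function $t$, $t^*(\omega)=\int_{-\infty}^\infty e^{i\omega x}t(x)\,dx$. $\varphi$ is a known real function with Fourier transform $\varphi^*$, and it is assumed that $\Phi=\int\varphi f=\frac1{2\pi}\int_{-\infty}^\infty f^*(\omega)\varphi^*(-\omega)\,d\omega$ with an absolutely convergent integral. $\Omega_s(B)$ is the set of pdfs $f$ with $\int|f^*(\omega)|^2(\omega^2+1)^s\,d\omega\le B^2$. The bounds are asymptotic, i.e. hold for all sufficiently large $n$; in cases where $\beta$ appears in a denominator, $\beta>0$ is understood. *)

(* Defs.v *)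
From HB Require Import structures.
From mathcomp Require Export all_boot all_order all_algebra.
From mathcomp Require Export all_classical all_reals all_analysis.
From mathcomp Require Export complex.

Set Implicit Arguments.
Unset Strict Implicit.
Unset Printing Implicit Defensive.

Export Order.TTheory GRing.Theory Num.Theory.
Export numFieldNormedType.Exports.

Local Open Scope classical_set_scope.
Local Open Scope ring_scope.

Notation "\mu" := (@lebesgue_measure _) (at level 0).
Notation normc := ComplexField.Normc.normc.

(* Complex-valued functions of a real variable are treated coordinatewise:
   MathComp-Analysis has no integral of R[i]-valued functions and R[i] is not
   a normed module over R. *)

Definition cintegrable (R : realType) (h : R -> R[i]) : Prop :=
  \mu.-integrable setT (EFin \o (fun x => complex.Re (h x))) /\
  \mu.-integrable setT (EFin \o (fun x => complex.Im (h x))).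

Definition cintegral (R : realType) (h : R -> R[i]) : R[i] :=
  Complex (\int[\mu]_x complex.Re (h x)) (\int[\mu]_x complex.Im (h x)).

Definition cderivable (R : realType) (F : R -> R[i]) (w : R) : Prop :=
  derivable (fun x => complex.Re (F x)) w 1 /\
  derivable (fun x => complex.Im (F x)) w 1.

Definition cderive (R : realType) (F : R -> R[i]) (w : R) : R[i] :=
  Complex (derive1 (fun x => complex.Re (F x)) w)
          (derive1 (fun x => complex.Im (F x)) w).

Definition expi (R : realType) (x : R) : R[i] := Complex (cos x) (sin x).

(* t^*(w) = \int e^{iwx} t(x) dx, meaningful for integrable t. *)
Definition fourier (R : realType) (t : R -> R) (w : R) : R[i] :=
  cintegral (fun x => expi (w * x) * (t x)%:C%C).

(* phis is the Fourier transform of phi, for a phi that need not be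
   integrable: \int e^{iwx} phi(x) dx is the limit of the integrals over
   [-A, A] as A --> +oo.  As usual for a Fourier transform, phis is a
   representative of a class modulo almost everywhere equality. *)
Definition is_fourier (R : realType) (phi : R -> R) (phis : R -> R[i]) : Prop :=
  (forall A : R, \mu.-integrable `[- A, A] (EFin \o phi)) /\
  {ae \mu, forall w : R,
    complex.Re (fourier (phi \_ `[- A, A]) w) @[A --> +oo]
      --> complex.Re (phis w) /\
    complex.Im (fourier (phi \_ `[- A, A]) w) @[A --> +oo]
      --> complex.Im (phis w)}.

Definition is_pdf (R : realType) (f : R -> R) : Prop :=
  [/\ measurable_fun setT f, (forall x, 0 <= f x) &
      (\int[\mu]_x (f x)%:E = 1)%E].

Definition Omega (R : realType) (s B : R) : set (R -> R) :=
  [set f | is_pdf f /\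
    (\int[\mu]_w (normc (fourier f w) ^+ 2 * (w ^+ 2 + 1) `^ s)%:E
       <= (B ^+ 2)%:E)%E].

Definition Phi (R : realType) (phi f : R -> R) : R :=
  \int[\mu]_x (phi x * f x).

(* Phi(f) = \int phi f = (2 pi)^-1 \int f^*(w) phi^*(-w) dw, both integrals
   being absolutely convergent. *)
Definition parseval (R : realType) (phi : R -> R) (phis : R -> R[i])
    (f : R -> R) : Prop :=
  [/\ \mu.-integrable setT (EFin \o (fun x => phi x * f x)),
      cintegrable (fun w => fourier f w * phis (- w)) &
      (Phi phi f)%:C%C =
        ((2 * pi)^-1)%:C%C * cintegral (fun w => fourier f w * phis (- w))].

Definition has_pdf (d : measure_display) (T : measurableType d)
    (R : realType) (P : probability T R) (X : {RV P >-> R}) (f : R -> R) : Prop :=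
  forall A : set R, measurable A -> (P (X @^-1` A) = \int[\mu]_(x in A) (f x)%:E)%E.

(* The product rule over full rectangles gives the one over every subfamily,
   by taking the remaining A i and B j equal to setT. *)
Definition deconvolution_model (d : measure_display) (T : measurableType d)
    (R : realType) (P : probability T R) (n : nat)
    (theta xi : 'I_n -> {RV P >-> R}) (f g : R -> R) : Prop :=
  [/\ forall i, has_pdf (theta i) f,
      forall i, has_pdf (xi i) g &
      forall A B : 'I_n -> set R,
        (forall i, measurable (A i)) -> (forall i, measurable (B i)) ->
        (P ((\bigcap_i (theta i @^-1` A i)) `&` (\bigcap_i (xi i @^-1` B i)))
         = \prod_(i < n) P (theta i @^-1` A i) *
           \prod_(i < n) P (xi i @^-1` B i))%E].

(* The set of values E (Phit(Y_1, ..., Y_n) - Phi(f))^2 for f in S.  The value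
   for a given f depends only on the law of (Y_1, ..., Y_n), hence not on the
   probability space carrying the model. *)
Definition risks (R : realType) (phi g : R -> R) (S : set (R -> R)) (n : nat)
    (Phit : n.-tuple R -> R) : set (\bar R) :=
  [set r | exists f : R -> R, S f /\
    exists (d : measure_display) (T : measurableType d)
      (P : probability T R) (theta xi : 'I_n -> {RV P >-> R}),
      deconvolution_model theta xi f g /\
      (r = 'E_P[fun w : T => ((Phit [tuple (theta i w + xi i w)%R | i < n]
                               - Phi phi f) ^+ 2)%R])%E].

Definition minimax_risk (R : realType) (phi g : R -> R) (S : set (R -> R))
    (n : nat) : \bar R :=
  ereal_inf [set ereal_sup (risks phi g S Phit) | Phit in
    [set Phit : n.-tuple R -> R | measurable_fun setT Phit]].

(* Main.v *)
(* Two-point method.  A bump of height delta on [m, m+w] in the frequency domain,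
   modulated by the phase exp(-i rho(-t)), is the transform of a
   real function K.  Adding K to a suitable density f0 changes Phi by at least
   delta w m^(-a) exp(-d (m+w)^b), up to a constant, since the phases cancel in
   Parseval's formula, whereas the density of Y changes by K * g, whose transform
   is of order delta m^(-alpha) exp(-gamma m^beta) and has a controlled derivative.
   As f0 * g >= c / (1 + x^2), the chi-square distance of the two laws of Y is at
   most a constant times the integral of (1 + x^2) (K * g)^2, which Bessel's
   inequality bounds by the L2 norms of that transform and its derivative.  Positivity
   of f0 and f0 + K is obtained by adding to a Cauchy density a smooth majorant of |K|.
   The rates follow by choosing m, w and delta: fixed m and w for 1/n, m a power of
   n if d = gamma = 0, and m^beta close to log n / (2 gamma), w = m^(1-b) otherwise. *)

From HB Require Import structures.
Require Import Defs.
From mathcomp Require Import measurable_realfun.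
From mathcomp Require Import ring lra.
Set Implicit Arguments.
Unset Strict Implicit.
Unset Printing Implicit Defensive.
Local Open Scope classical_set_scope.
Local Open Scope ring_scope.

(** Neither a Plancherel identity nor an inversion theorem is presupposed: what is needed of both
    comes from Abel summation with exp(-e|x|), whose transform is the unnormalised Poisson kernel
    [q e]. The same kernel is also the approximate identity of the inversion formula, the base
    density, whose tails of order 1/x^2 survive convolution with g, and the smoother of the
    majorant. The majorant is the delicate point. |K| need not be smooth, so adding it directly
    gives no control of the Sobolev norm. Instead K is written as the Poisson average, at scale 1/m,
    of a function K' whose transform is that of K multiplied by exp(|t|/m). As that transform lives
    in m <= |t| <= 2m, the multiplication costs only a constant. The average of |K'| then dominates
    |K|, while its own transform carries the factor exp(-|t|/m), which absorbs the Sobolev weight up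
    to a factor m^(2s). The other obstacle is that B may be small: the base density is then taken so
    flat that it uses only part of the budget B^2. *)

Definition L1 (R : realType) (f : R -> R) : Prop :=
  \mu.-integrable setT (EFin \o f).

(** * Integrable real functions on the line and their integrals *)

Section L1_toolkit.
Variable R : realType.
Implicit Types f g k : R -> R.
Local Notation I f := (Rintegral \mu setT f).

Lemma L1_measurable f : L1 f -> measurable_fun setT f.
Proof. by move=> /integrableP[/measurable_EFinP]. Qed.

Lemma L1_dominated f g : measurable_fun setT f -> L1 g ->
  (forall x, `|f x| <= g x) -> L1 f.
Proof.
move=> mf ig fg; apply: (le_integrable measurableT _ _ ig).
  exact/measurable_EFinP.
by move=> x _ /=; rewrite lee_fin (le_trans (fg x))// ler_norm.
Qed.

Lemma L1D f g : L1 f -> L1 g -> L1 (fun x => f x + g x).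
Proof.
move=> If Ig; have := integrableD measurableT If Ig.
by apply: eq_integrable => // x _.
Qed.

Lemma L1Z c f : L1 f -> L1 (fun x => c * f x).
Proof.
move=> If; have := integrableZl measurableT c If.
by apply: eq_integrable => // x _.
Qed.

Lemma L1N f : L1 f -> L1 (fun x => - f x).
Proof. by move=> /(L1Z (-1)); apply: eq_integrable => // x _ /=; rewrite mulN1r. Qed.

Lemma L1B f g : L1 f -> L1 g -> L1 (fun x => f x - g x).
Proof. by move=> If Ig; apply: (L1D If (L1N Ig)). Qed.

Lemma L1_norm f : L1 f -> L1 (fun x => `|f x|).
Proof.
move=> If; have mf := L1_measurable If.
have := integrable_norm If.
by apply: eq_integrable => // x _.
Qed.

Lemma L1_mul_bounded k f M : measurable_fun setT k -> (forall x, `|k x| <= M) ->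
  L1 f -> L1 (fun x => k x * f x).
Proof.
move=> mk kM If; apply: (@L1_dominated _ (fun x => M * `|f x|)).
- by apply: measurable_funM => //; exact: L1_measurable.
- by apply: L1Z; exact: L1_norm.
- by move=> x; rewrite normrM ler_wpM2r.
Qed.

Lemma L1_ge0 f : measurable_fun setT f -> (forall x, 0 <= f x) ->
  (\int[\mu]_x (f x)%:E < +oo)%E -> L1 f.
Proof.
move=> mf f0 fo; apply/integrableP; split; first exact/measurable_EFinP.
by under eq_integral do rewrite /= ger0_norm//.
Qed.

Lemma L1_EFin f : L1 f -> (\int[\mu]_x (f x)%:E)%E = (I f)%:E.
Proof. by move=> If; rewrite /Rintegral fineK//; exact: integrable_fin_num. Qed.

Lemma ID f g : L1 f -> L1 g -> I (fun x => f x + g x) = I f + I g.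
Proof. exact: RintegralD. Qed.

Lemma IB f g : L1 f -> L1 g -> I (fun x => f x - g x) = I f - I g.
Proof. exact: RintegralB. Qed.

Lemma IZ c f : L1 f -> I (fun x => c * f x) = c * I f.
Proof. exact: RintegralZl. Qed.

Lemma I_le f g : L1 f -> L1 g -> (forall x, f x <= g x) -> I f <= I g.
Proof. by move=> If Ig fg; exact: le_Rintegral. Qed.

Lemma I_ge0 f : (forall x, 0 <= f x) -> 0 <= I f.
Proof. by move=> f0; apply: Rintegral_ge0. Qed.

Lemma I_norm f : L1 f -> `|I f| <= I (fun x => `|f x|).
Proof. exact: le_normr_Rintegral. Qed.

Lemma eqI f g : f =1 g -> I f = I g.
Proof. by move=> fg; apply: eq_Rintegral => x _. Qed.

Lemma eqL1 f g : f =1 g -> L1 f -> L1 g.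
Proof. by move=> /funext ->. Qed.


End L1_toolkit.

(** * Translations, reflection and Fubini's theorem *)

Definition shiftR (R : realType) (a x : R) : measurableTypeR R := x + a.

Lemma measurable_shiftR (R : realType) (a : R) :
  measurable_fun setT (@shiftR R a).
Proof. exact: measurable_funD. Qed.

HB.instance Definition _ (R : realType) (a : R) :=
  isMeasurableFun.Build _ _ _ _ (@shiftR R a) (@measurable_shiftR R a).

Section change_of_variables.
Variable R : realType.
Implicit Types f g k : R -> R.
Local Notation I f := (Rintegral \mu setT f).

Lemma lebesgue_measure_shift (a : R) (A : set R) : measurable A ->
  pushforward \mu (@shiftR R a) A = \mu A.
Proof.
move=> mA; apply/esym/lebesgue_measure_unique => //=.
  exact: measurable_shiftR.
move=> mS _ [[u v]] _ <-.
rewrite /pushforward.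
have -> : @shiftR R a @^-1` `]u, v]%classic = `]u - a, v - a]%classic.
  by apply/seteqP; split => x /=; rewrite /shiftR !in_itv/= ltrBlDr lerBrDr.
rewrite !lebesgue_measure_itv/= !lte_fin ltrD2r.
by case: ifP => // _; rewrite -!EFinD; congr EFin; ring.
Qed.

Lemma ge0_integral_shift (a : R) (f : R -> \bar R) : measurable_fun setT f ->
  (forall x, (0 <= f x)%E) -> (\int[\mu]_x f (x + a)%R = \int[\mu]_x f x)%E.
Proof.
move=> mf f0.
have := @ge0_integral_pushforward _ _ (measurableTypeR R) (measurableTypeR R) R _
  (@measurable_shiftR R a) \mu setT f measurableT mf (fun x _ => f0 x).
rewrite preimage_setT => <-.
apply: eq_measure_integral => //=; first exact: measurable_shiftR.
by move=> mS A mA _; exact: lebesgue_measure_shift.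
Qed.

Lemma ge0_integral_opp (f : R -> \bar R) : measurable_fun setT f ->
  (forall x, (0 <= f x)%E) -> (\int[\mu]_x f (- x)%R = \int[\mu]_x f x)%E.
Proof.
move=> mf f0.
have mN : measurable_fun setT (-%R : R -> measurableTypeR R) by exact: oppr_measurable.
have := @ge0_integral_pushforward _ _ (measurableTypeR R) (measurableTypeR R) R _ mN \mu
  setT f measurableT mf (fun x _ => f0 x).
rewrite preimage_setT => <-.
apply: eq_measure_integral => //= A mA _.
exact: (lebesgue_measureN mA).
Qed.

(** Invariance under [phi] is known for nonnegative extended functions only; it passes to integrable
    ones through positive and negative parts. *)
Lemma L1_comp (phi : R -> R) f : measurable_fun setT phi ->
  (forall h : R -> \bar R, measurable_fun setT h -> (forall x, (0 <= h x)%E) ->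
     (\int[\mu]_x h (phi x) = \int[\mu]_x h x)%E) ->
  L1 f -> L1 (f \o phi) /\ I (f \o phi) = I f.
Proof.
move=> mphi hphi If; have mf := L1_measurable If.
split.
  apply/integrableP; split.
    by apply/measurable_EFinP; exact: measurableT_comp.
  move/integrableP : If => [mEf]; rewrite -(hphi (fun x => `|(f x)%:E|%E))//.
  exact: measurableT_comp.
rewrite /Rintegral; congr fine.
rewrite [LHS]integralE [RHS]integralE; congr (_ - _)%E.
  rewrite -(hphi ((EFin \o f)^\+)%E).
  - by apply: eq_integral => x _; rewrite !funeposE.
  - by apply: measurable_funepos; exact/measurable_EFinP.
  - by move=> x; exact: funepos_ge0.
rewrite -(hphi ((EFin \o f)^\-)%E).
- by apply: eq_integral => x _; rewrite !funenegE.
- by apply: measurable_funeneg; exact/measurable_EFinP.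
- by move=> x; exact: funeneg_ge0.
Qed.

Lemma L1_shift a f : L1 f -> L1 (fun x => f (x + a)).
Proof.
move=> If; have [|//|//] := @L1_comp (fun x => x + a) f _ _ If.
- exact: measurable_funD.
- by move=> h mh h0; exact: ge0_integral_shift.
Qed.

Lemma I_shift a f : L1 f -> I (fun x => f (x + a)) = I f.
Proof.
move=> If; have [|//|//] := @L1_comp (fun x => x + a) f _ _ If.
- exact: measurable_funD.
- by move=> h mh h0; exact: ge0_integral_shift.
Qed.

Lemma L1_opp f : L1 f -> L1 (fun x => f (- x)).
Proof.
move=> If; have [|//|//] := @L1_comp (fun x => - x) f _ _ If.
- exact: oppr_measurable.
- by move=> h mh h0; exact: ge0_integral_opp.
Qed.

Lemma I_opp f : L1 f -> I (fun x => f (- x)) = I f.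
Proof.
move=> If; have [|//|//] := @L1_comp (fun x => - x) f _ _ If.
- exact: oppr_measurable.
- by move=> h mh h0; exact: ge0_integral_opp.
Qed.

Lemma I_odd f : L1 f -> (forall x, f (- x) = - f x) -> I f = 0.
Proof.
move=> If oddf.
have : I f = - I f.
  rewrite -[LHS]I_opp// (eqI (g := fun x => (-1) * f x)); last first.
    by move=> x; rewrite oddf mulN1r.
  by rewrite IZ// mulN1r.
lra.
Qed.

(** Tonelli and the integrable majorant [c] give integrability on the product. Sections are required
    to be integrable for every x and every y, so that both iterated integrals are real functions
    defined everywhere and no null sets have to be carried along. *)
Lemma fubini_real (F : R * R -> R) (c : R -> R) : measurable_fun setT F ->
  (forall x, L1 (fun y => F (x, y))) -> (forall y, L1 (fun x => F (x, y))) ->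
  L1 c -> (forall x, I (fun y => `|F (x, y)|) <= c x) ->
  [/\ L1 (fun x => I (fun y => F (x, y))), L1 (fun y => I (fun x => F (x, y))) &
    I (fun x => I (fun y => F (x, y))) = I (fun y => I (fun x => F (x, y)))].
Proof.
move=> mF F1 F2 Ic Fc.
have mEF : measurable_fun setT (EFin \o F) by exact/measurable_EFinP.
have mF' : measurable_fun setT (fun z : measurableTypeR R * measurableTypeR R => `|(F z)%:E|%E).
  by apply: measurableT_comp.
have F0 (z : measurableTypeR R * measurableTypeR R) : (0 <= `|(F z)%:E|)%E by [].
have iF : (\mu \x \mu)%E.-integrable setT (EFin \o F).
  apply/integrable12ltyP => //.
  apply: (@le_lt_trans _ _ (\int[\mu]_x (c x)%:E)%E); last first.
    by rewrite L1_EFin// ltry.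
  apply: ge0_le_integral => //=.
  - by move=> x _; exact: integral_ge0.
  - exact: (measurable_fun_fubini_tonelli_F (m2 := \mu) _ mF' F0).
  - by apply/measurable_EFinP; exact: L1_measurable.
  - move=> x _; have -> : (\int[\mu]_y `|(F (x, y))%:E| = (I (fun y => `|F (x, y)|))%:E)%E.
      by rewrite -L1_EFin//; exact: L1_norm (F1 x).
    by rewrite lee_fin.
have e1 x : (\int[\mu]_y (EFin \o F) (x, y) = (I (fun y => F (x, y)))%:E)%E.
  by rewrite -L1_EFin//; exact: F1.
have e2 y : (\int[\mu]_x (EFin \o F) (x, y) = (I (fun x => F (x, y)))%:E)%E.
  by rewrite -L1_EFin//; exact: F2.
split.
- have := integrable_fubini_F iF; apply: eq_integrable => // x _.
  by rewrite /fubini_F e1.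
- have mG := measurable_fubini_G iF.
  have eG y : fubini_G \mu (EFin \o F) y = (I (fun x => F (x, y)))%:E by exact: e2.
  have mJ : measurable_fun setT (fun y => I (fun x => F (x, y))).
    by apply/measurable_EFinP; move: mG; apply: eq_measurable_fun => y _; exact: eG.
  apply/integrableP; split; first exact/measurable_EFinP.
  apply: le_lt_trans ((integrable21ltyP \mu \mu mEF).1 iF).
  apply: ge0_le_integral => //=.
  - by apply/measurable_EFinP; exact: measurableT_comp.
  - exact: (measurable_fun_fubini_tonelli_G (m1 := \mu) _ mF' F0).
  - move=> y _; have -> : (\int[\mu]_x `|(F (x, y))%:E| = (I (fun x => `|F (x, y)|))%:E)%E.
      by rewrite -L1_EFin//; exact: L1_norm (F2 y).
    by rewrite lee_fin I_norm.
- have := Fubini iF.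
  under eq_integral do rewrite e1.
  under [in RHS]eq_integral do rewrite e2.
  by rewrite /Rintegral => ->.
Qed.

(** The shape in which transforms meet Fubini: two integrable functions coupled by a bounded kernel,
    here cos or sin of a bilinear expression. The majorant is M ||b||_1 |a x|. *)
Lemma fubini_bounded (a b : R -> R) (k : R * R -> R) M : L1 a -> L1 b ->
  measurable_fun setT k -> (forall z, `|k z| <= M) ->
  [/\ L1 (fun x => a x * I (fun y => b y * k (x, y))),
      L1 (fun y => b y * I (fun x => a x * k (x, y))) &
    I (fun x => a x * I (fun y => b y * k (x, y))) =
    I (fun y => b y * I (fun x => a x * k (x, y)))].
Proof.
move=> Ia Ib mk kM.
have mkx x : measurable_fun setT (fun y => k (x, y)).
  by apply: measurableT_comp => //; exact: pair1_measurable.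
have mky y : measurable_fun setT (fun x => k (x, y)).
  by apply: measurableT_comp => //; exact: pair2_measurable.
have Ibk x : L1 (fun y => b y * k (x, y)).
  by have := L1_mul_bounded (mkx x) (fun y => kM (x, y)) Ib; apply: eqL1 => y; rewrite mulrC.
have Iak y : L1 (fun x => a x * k (x, y)).
  by have := L1_mul_bounded (mky y) (fun x => kM (x, y)) Ia; apply: eqL1 => x; rewrite mulrC.
pose F := fun z : R * R => a z.1 * (b z.2 * k z).
have mF : measurable_fun setT F.
  apply: measurable_funM.
    by apply: measurableT_comp => //; exact: L1_measurable.
  apply: measurable_funM => //.
  by apply: measurableT_comp => //; exact: L1_measurable.
have F1 x : L1 (fun y => F (x, y)) by exact: (L1Z (a x) (Ibk x)).
have F2 y : L1 (fun x => F (x, y)).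
  by have := L1Z (b y) (Iak y); apply: eqL1 => x; rewrite /F/= mulrCA.
have [|x|J1 J2 J3] := @fubini_real F (fun x => (M * I (fun y => `|b y|)) * `|a x|) mF F1 F2.
  by apply: L1Z; exact: L1_norm.
- rewrite mulrC mulrCA -IZ; last exact: L1_norm.
  rewrite -IZ; last by apply: L1Z; exact: L1_norm.
  apply: I_le.
  + exact: L1_norm (F1 x).
  + by apply: L1Z; apply: L1Z; exact: L1_norm.
  + by move=> y; rewrite /F/= !normrM mulrA [leRHS]mulrC ler_wpM2l// mulr_ge0.
have e1 x : I (fun y => F (x, y)) = a x * I (fun y => b y * k (x, y)) by rewrite -IZ.
have e2 y : I (fun x => F (x, y)) = b y * I (fun x => a x * k (x, y)).
  by rewrite -IZ//; apply: eqI => x; rewrite /F/= mulrCA.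
split.
- exact: eqL1 e1 J1.
- exact: eqL1 e2 J2.
- by rewrite -(eqI e1) J3 (eqI e2).
Qed.

End change_of_variables.

(** * Poisson kernel and limits of integrals *)

Section poisson_kernel.
Variable R : realType.
Implicit Types e t x : R.
Local Notation I f := (Rintegral \mu setT f).

(** By evenness only the half line matters, where the fundamental theorem applies. The derivative is
    asked for x > 0 only, so f may involve |x|, with F the antiderivative of its smooth branch. *)
Lemma integral_even_FTC (f F : R -> R) (l : R) :
  (forall x, 0 <= f x) -> continuous f -> (forall x, f (- x) = f x) ->
  (forall x, 0 < x -> is_derive x (1:R) F (f x)) -> {for 0, continuous F} ->
  F x @[x --> +oo] --> l ->
  L1 f /\ I f = 2 * (l - F 0).
Proof.
move=> f0 cf evf dF cF Fl.
have mf : measurable_fun setT f by exact: continuous_measurable_fun.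
have E : (\int[\mu]_x (f x)%:E = (2 * (l - F 0))%:E)%E.
  rewrite ge0_symfun_integralT//; last by move=> x /=; rewrite evf.
  rewrite -set_itvcy (@ge0_continuous_FTC2y _ f F 0 l)//.
  - exact: continuous_subspaceT.
  - by move=> x x0; have [] := dF x x0.
  - exact: cvg_at_right_filter.
  - move=> x; rewrite in_itv/= andbT => x0; rewrite derive1E.
    by have := dF x x0 => dFx; rewrite derive_val.
split; first by apply: L1_ge0 => //; rewrite E ltry.
by rewrite /Rintegral E.
Qed.

(** The Poisson kernel of scale e up to the factor 2 pi, chosen so that it is exactly the transform
    of exp(-e|x|). *)
Definition q e t : R := 2 * e / (e ^+ 2 + t ^+ 2).

Lemma q_den_gt0 e t : 0 < e -> 0 < e ^+ 2 + t ^+ 2.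
Proof. by move=> e0; rewrite ltr_wpDr// ?sqr_ge0// exprn_gt0. Qed.

Lemma q_gt0 e t : 0 < e -> 0 < q e t.
Proof. by move=> e0; rewrite divr_gt0 ?q_den_gt0// mulr_gt0. Qed.

Lemma q_ge0 e t : 0 < e -> 0 <= q e t. Proof. by move=> /(q_gt0 t)/ltW. Qed.

Lemma q_le e t : 0 < e -> q e t <= 2 / e.
Proof.
move=> e0; rewrite /q ler_pdivrMr ?q_den_gt0// mulrAC ler_pdivlMr//.
by rewrite -mulrA ler_wpM2l// -expr2 lerDl sqr_ge0.
Qed.

Lemma q_opp e t : q e (- t) = q e t. Proof. by rewrite /q sqrrN. Qed.

Lemma continuous_q e : 0 < e -> continuous (q e).
Proof.
move=> e0 x; apply: cvgM; first exact: cvg_cst.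
apply: cvgV; first by rewrite gt_eqF// q_den_gt0.
by apply: cvgD; [exact: cvg_cst|exact: exprn_continuous].
Qed.

Lemma measurable_q e : 0 < e -> measurable_fun setT (q e).
Proof. by move=> e0; apply: continuous_measurable_fun; exact: continuous_q. Qed.

Lemma continuous_expabs e : continuous (fun x => expR (- e * `|x|)).
Proof.
move=> x; apply: continuous_comp; last exact: continuous_expR.
by apply: cvgM; [exact: cvg_cst|exact: norm_continuous].
Qed.

Lemma expabs_le1 e x : 0 < e -> expR (- e * `|x|) <= 1.
Proof. by move=> e0; rewrite -expR0 ler_expR mulNr oppr_le0 mulr_ge0// ltW. Qed.

Lemma cvg_expRM e : 0 < e -> expR (- e * x) @[x --> +oo] --> 0.
Proof.
move=> e0.
rewrite (_ : (fun x => expR (- e * x)) =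
               (fun z => expR (- z)) \o (fun z => e * z)); last first.
  by apply/funext => x /=; rewrite mulNr.
apply: (@cvg_comp _ _ _ _ _ _ (pinfty_nbhs R)); last exact: cvgr_expR.
exact: gt0_cvgMry.
Qed.

Lemma cvg_expRM_bounded e (h : R -> R) M : 0 < e -> (forall x, `|h x| <= M) ->
  expR (- e * x) * h x @[x --> +oo] --> 0.
Proof.
move=> e0 hM.
apply: (@squeeze_cvgr _ _ _ _ (fun x => - (M * expR (- e * x)))
  (fun x => M * expR (- e * x))).
- near=> x; rewrite -ler_norml normrM ger0_norm ?expR_ge0// mulrC.
  by rewrite ler_wpM2r// expR_ge0.
- by rewrite -oppr0 -(mulr0 M); apply: cvgN; apply: cvgM; [exact: cvg_cst|exact: cvg_expRM].
- by rewrite -(mulr0 M); apply: cvgM; [exact: cvg_cst|exact: cvg_expRM].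
Unshelve. all: by end_near. Qed.

(** The summand 1 makes the integrand nonnegative, as the fundamental theorem on an unbounded
    interval requires; the case t = 0 is later subtracted to isolate the cosine. *)
Lemma one_plus_cos_expabs e t : 0 < e ->
  L1 (fun x => (1 + cos (t * x)) * expR (- e * `|x|)) /\
  I (fun x => (1 + cos (t * x)) * expR (- e * `|x|)) = 2 / e + q e t.
Proof.
move=> e0; have e2 := lt0r_neq0 (q_den_gt0 t e0).
(* exp(-e x) h(x) is the antiderivative of (1 + cos(t x)) exp(-e x) that vanishes at infinity. *)
pose h x := - e^-1 + (t * sin (t * x) - e * cos (t * x)) / (e ^+ 2 + t ^+ 2).
pose F x := expR (- e * x) * h x.
have dF x : is_derive x (1:R) F ((1 + cos (t * x)) * expR (- e * x)).
  apply: is_derive_eq.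
  by rewrite /GRing.scale/= /h; field; rewrite e2/= gt_eqF.
have [||||||If ->] := @integral_even_FTC
    (fun x => (1 + cos (t * x)) * expR (- e * `|x|)) F 0.
- by move=> x; rewrite mulr_ge0 ?expR_ge0//; have := cos_geN1 (t * x); lra.
- move=> x; apply: cvgM; last exact: continuous_expabs.
  apply: cvgD; first exact: cvg_cst.
  apply: continuous_comp; last exact: continuous_cos.
  by apply: cvgM; [exact: cvg_cst|exact: cvg_id].
- by move=> x; rewrite mulrN cosN normrN.
- by move=> x x0; rewrite gtr0_norm.
- have := dF 0 => dF0; apply: differentiable_continuous.
  by apply/derivable1_diffP; case: dF0.
- apply: (@cvg_expRM_bounded _ _ (e^-1 + (`|t| + e) / (e ^+ 2 + t ^+ 2))) => //.
  move=> x; rewrite /h (le_trans (ler_normD _ _))// normrN gtr0_norm ?invr_gt0//.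
  rewrite lerD2l normrM normfV (gtr0_norm (q_den_gt0 t e0)).
  rewrite ler_wpM2r ?invr_ge0 ?(ltW (q_den_gt0 t e0))//.
  rewrite (le_trans (ler_normB _ _))// !normrM (gtr0_norm e0) lerD//.
    by apply: ler_piMr => //; rewrite ler_norml sin_geN1 sin_le1.
  by apply: ler_piMr; rewrite ?(ltW e0)// ler_norml cos_geN1 cos_le1.
- split=> //; rewrite /F /h !mulr0 expR0 sin0 cos0 /q; field.
  by rewrite e2/= gt_eqF.
Qed.

Lemma L1_expabs e : 0 < e -> L1 (fun x => expR (- e * `|x|)).
Proof.
move=> e0; have [+ _] := one_plus_cos_expabs 0 e0.
move=> /(L1Z (1/2)); apply: eqL1 => x.
by rewrite mul0r cos0; field.
Qed.

Lemma I_expabs e : 0 < e -> I (fun x => expR (- e * `|x|)) = 2 / e.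
Proof.
move=> e0; have [Ic Ec] := one_plus_cos_expabs 0 e0.
rewrite (eqI (g := fun x => (1/2) * ((1 + cos (0 * x)) * expR (- e * `|x|)))); last first.
  by move=> x; rewrite mul0r cos0; field.
by rewrite IZ// Ec /q; field; rewrite gt_eqF.
Qed.

Lemma L1_cos_mul t f : L1 f -> L1 (fun x => cos (t * x) * f x).
Proof.
apply: (@L1_mul_bounded _ _ _ 1); last first.
  by move=> x; rewrite ler_norml cos_geN1 cos_le1.
apply: continuous_measurable_fun => x.
apply: continuous_comp; last exact: continuous_cos.
by apply: cvgM; [exact: cvg_cst|exact: cvg_id].
Qed.

Lemma L1_sin_mul t f : L1 f -> L1 (fun x => sin (t * x) * f x).
Proof.
apply: (@L1_mul_bounded _ _ _ 1); last first.
  by move=> x; rewrite ler_norml sin_geN1 sin_le1.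
apply: continuous_measurable_fun => x.
apply: continuous_comp; last exact: continuous_sin.
by apply: cvgM; [exact: cvg_cst|exact: cvg_id].
Qed.

Lemma I_cos_expabs e t : 0 < e ->
  I (fun x => cos (t * x) * expR (- e * `|x|)) = q e t.
Proof.
move=> e0; have [Ic Ec] := one_plus_cos_expabs t e0.
rewrite (eqI (g := fun x => (1 + cos (t * x)) * expR (- e * `|x|) - expR (- e * `|x|))).
  by rewrite IB ?I_expabs ?Ec//; [ring|exact: L1_expabs].
by move=> x; ring.
Qed.

Lemma q_integral e : 0 < e -> L1 (q e) /\ I (q e) = 2 * pi.
Proof.
move=> e0.
pose F x := 2 * atan (x / e).
have dF x : is_derive x (1:R) F (q e x).
  apply: is_derive_eq.
  rewrite /GRing.scale/= /q; field; rewrite (lt0r_neq0 (q_den_gt0 x e0))/= gt_eqF//.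
have [|||||If ->] := @integral_even_FTC (q e) F pi.
- by move=> x; exact: q_ge0.
- exact: continuous_q.
- by move=> x; rewrite q_opp.
- have := dF 0 => dF0; apply: differentiable_continuous.
  by apply/derivable1_diffP; case: dF0.
- rewrite (_ : (pi : R) = 2 * (pi / 2)); last by field.
  apply: cvgM; first exact: cvg_cst.
  apply: cvg_comp; last exact: cvgy_atan.
  by apply: gt0_cvgMly; rewrite ?invr_gt0.
- by split=> //; rewrite /F mul0r atan0; ring.
Qed.

Lemma L1_q e : 0 < e -> L1 (q e). Proof. by case/q_integral. Qed.

Lemma I_q e : 0 < e -> I (q e) = 2 * pi. Proof. by case/q_integral. Qed.

End poisson_kernel.

(** * Dominated convergence and Fatou for real integrals *)

Section limit_lemmas.
Variable R : realType.
Implicit Types f g : R -> R.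
Local Notation I f := (Rintegral \mu setT f).

Lemma dominated_cvg_real (f_ : nat -> R -> R) f g :
  (forall n, measurable_fun setT (f_ n)) ->
  (forall x, f_ ^~ x @ \oo --> f x) -> L1 g -> (forall n x, `|f_ n x| <= g x) ->
  L1 f /\ (fun n => I (f_ n)) @ \oo --> I f.
Proof.
move=> mf_ ff Ig fg.
have mf : measurable_fun setT f.
  by apply: (measurable_fun_cvg mf_) => x _; exact: ff.
have If_ n : L1 (f_ n) by apply: (L1_dominated (mf_ n) Ig) => x; exact: fg.
have [] := @dominated_convergence _ _ R \mu setT measurableT
    (fun n x => (f_ n x)%:E) (EFin \o f) (EFin \o g).
- by move=> n; apply/measurable_EFinP; exact: mf_.
- exact/measurable_EFinP.
- by apply: aeW => x _; apply/fine_cvgP; split; [exact: nearW|exact: ff].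
- exact: Ig.
- by apply: aeW => x n _; rewrite lee_fin.
move=> If _ cvgI; split => //.
have cvgE : (fun n => (I (f_ n))%:E) @ \oo --> (I f)%:E.
  rewrite -L1_EFin//; move: cvgI; apply: cvg_trans; apply: near_eq_cvg.
  by apply: nearW => n /=; rewrite L1_EFin.
exact: fine_cvg cvgE.
Qed.

(** Fatou in the form that also yields integrability of the limit, which is not known beforehand
    where this is applied. *)
Lemma fatou_bound (f_ : nat -> R -> R) f (M : R) :
  (forall n, L1 (f_ n)) -> (forall n x, 0 <= f_ n x) ->
  (forall x, f_ ^~ x @ \oo --> f x) -> (forall n, I (f_ n) <= M) ->
  L1 f /\ I f <= M.
Proof.
move=> If_ f_0 ff fM.
have mf_ n := L1_measurable (If_ n).
have f0 x : 0 <= f x.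
  by rewrite -(cvg_lim _ (ff x))//; apply: limr_ge; [exact: cvgP (ff x)|exact: nearW].
have mf : measurable_fun setT f.
  by apply: (measurable_fun_cvg mf_) => x _; exact: ff.
have : (\int[\mu]_x (f x)%:E <= M%:E)%E.
  have := @fatou _ _ R \mu setT measurableT (fun n x => (f_ n x)%:E).
  move=> /(_ (fun n => (measurable_EFinP _ _).2 (mf_ n))).
  move=> /(_ (fun n x _ => f_0 n x)).
  have -> : (fun x => limn_einf (fun n => (f_ n x)%:E)) = (fun x => (f x)%:E).
    apply/funext => x;     have cvgE : (fun n => (f_ n x)%:E) @ \oo --> (f x)%:E.
      by apply/fine_cvgP; split; [exact: nearW|exact: ff].
    by rewrite (cvg_limn_einf_sup cvgE).1.
  move=> /le_trans; apply.
  rewrite limn_einf_lim; apply: lime_le; first exact: is_cvg_einfs.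
  apply: nearW => n; apply: (@le_trans _ _ (\int[\mu]_x (f_ n x)%:E)%E).
    by apply: ereal_inf_lbound; exists n => /=.
  by rewrite L1_EFin// lee_fin.
move=> fle; have If : L1 f by apply: L1_ge0 => //; rewrite (le_lt_trans fle)// ltry.
by split => //; rewrite -lee_fin -L1_EFin.
Qed.

End limit_lemmas.

(** * Cosine and sine transforms *)

Section cos_sin_transforms.
Variable R : realType.
Implicit Types f g v : R -> R.
Local Notation I f := (Rintegral \mu setT f).

(** [Cf] and [Sf] are the real and imaginary parts of the Fourier transform; the analysis is carried
    out on these two real functions. *)
Definition Cf v t : R := I (fun x => cos (t * x) * v x).
Definition Sf v t : R := I (fun x => sin (t * x) * v x).

Lemma norm_cos_le1 (x : R) : `|cos x| <= 1.
Proof. by rewrite ler_norml cos_geN1 cos_le1. Qed.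

Lemma norm_sin_le1 (x : R) : `|sin x| <= 1.
Proof. by rewrite ler_norml sin_geN1 sin_le1. Qed.

Lemma measurable_cos_comp d (T : measurableType d) (h : T -> R) :
  measurable_fun setT h -> measurable_fun setT (fun z => cos (h z)).
Proof.
move=> mh; apply: (measurableT_comp _ mh).
by apply: continuous_measurable_fun; exact: continuous_cos.
Qed.

Lemma measurable_sin_comp d (T : measurableType d) (h : T -> R) :
  measurable_fun setT h -> measurable_fun setT (fun z => sin (h z)).
Proof.
move=> mh; apply: (measurableT_comp _ mh).
by apply: continuous_measurable_fun; exact: continuous_sin.
Qed.

Lemma L1_mulC f g : L1 (fun x => f x * g x) -> L1 (fun x => g x * f x).
Proof. by apply: eqL1 => x; rewrite mulrC. Qed.

Lemma norm_I_le f g : L1 f -> L1 g -> (forall x, `|f x| <= g x) -> `|I f| <= I g.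
Proof.
move=> If Ig fg; apply: (le_trans (I_norm If)).
by apply: I_le => //; exact: L1_norm.
Qed.

Lemma norm_Cf_le v t : L1 v -> `|Cf v t| <= I (fun x => `|v x|).
Proof.
move=> Iv; apply: norm_I_le; [exact: L1_cos_mul|exact: L1_norm|].
by move=> x; rewrite normrM ler_piMl// norm_cos_le1.
Qed.

Lemma norm_Sf_le v t : L1 v -> `|Sf v t| <= I (fun x => `|v x|).
Proof.
move=> Iv; apply: norm_I_le; [exact: L1_sin_mul|exact: L1_norm|].
by move=> x; rewrite normrM ler_piMl// norm_sin_le1.
Qed.

Let mprod : measurable_fun setT (fun z : R * R => z.1 * z.2).
Proof. exact: measurable_funM. Qed.

(** Fubini delivers the measurability of a transform only after multiplication by an integrable
    weight; a positive continuous weight can be divided out again. *)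
Lemma measurable_of_L1_expabs v : L1 (fun x => expR (- 1 * `|x|) * v x) ->
  measurable_fun setT v.
Proof.
move=> /L1_measurable m1.
have -> : v = (fun x => expR `|x| * (expR (- 1 * `|x|) * v x)).
  by apply/funext => x; rewrite mulrA -expRD mulN1r addrN expR0 mul1r.
apply: measurable_funM => //; apply: continuous_measurable_fun => x.
by apply: continuous_comp; [exact: norm_continuous|exact: continuous_expR].
Qed.

Lemma measurable_Cf v : L1 v -> measurable_fun setT (Cf v).
Proof.
move=> Iv; apply: measurable_of_L1_expabs.
have [|z|+ _ _] := @fubini_bounded _ _ _ (fun z => cos (z.1 * z.2)) 1
    (@L1_expabs R 1 ltr01) Iv.
- exact: measurable_cos_comp.
- exact: norm_cos_le1.
apply: eqL1 => x; congr (_ * _); apply: eqI => y; exact: mulrC.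
Qed.

Lemma measurable_Sf v : L1 v -> measurable_fun setT (Sf v).
Proof.
move=> Iv; apply: measurable_of_L1_expabs.
have [|z|+ _ _] := @fubini_bounded _ _ _ (fun z => sin (z.1 * z.2)) 1
    (@L1_expabs R 1 ltr01) Iv.
- exact: measurable_sin_comp.
- exact: norm_sin_le1.
apply: eqL1 => x; congr (_ * _); apply: eqI => y; exact: mulrC.
Qed.

Lemma L1_mul_Cf a v : L1 a -> L1 v -> L1 (fun x => a x * Cf v x).
Proof.
move=> Ia Iv; apply: L1_mulC; apply: L1_mul_bounded Ia; first exact: measurable_Cf.
by move=> x; exact: norm_Cf_le.
Qed.

Lemma L1_mul_Sf a v : L1 a -> L1 v -> L1 (fun x => a x * Sf v x).
Proof.
move=> Ia Iv; apply: L1_mulC; apply: L1_mul_bounded Ia; first exact: measurable_Sf.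
by move=> x; exact: norm_Sf_le.
Qed.

Lemma L1_shiftB a f : L1 f -> L1 (fun x => f (x - a)).
Proof. exact: L1_shift. Qed.

Lemma I_shiftB a f : L1 f -> I (fun x => f (x - a)) = I f.
Proof. exact: I_shift. Qed.

Lemma L1_subr a f : L1 f -> L1 (fun x => f (a - x)).
Proof. by move=> /(L1_shift a)/L1_opp; apply: eqL1 => x; rewrite addrC. Qed.

(** Boundedness of [a] makes the convolution exist at every point. The test function [k] is 1 when
    the mass of a convolution is computed, and a cosine or sine when its transform is. *)
Lemma convolution_fubini (a b k : R -> R) (A M : R) : L1 a -> L1 b ->
  (forall x, `|a x| <= A) -> measurable_fun setT k -> (forall x, `|k x| <= M) ->
  [/\ L1 (fun x => k x * I (fun y => b y * a (x - y))),
      L1 (fun y => b y * I (fun x => k x * a (x - y))) &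
   I (fun x => k x * I (fun y => b y * a (x - y))) =
   I (fun y => b y * I (fun x => k x * a (x - y)))].
Proof.
move=> Ia Ib aA mk kM.
have ma := L1_measurable Ia; have mb := L1_measurable Ib.
pose F := fun z : R * R => b z.1 * (k z.2 * a (z.2 - z.1)).
have mF : measurable_fun setT F.
  apply: measurable_funM; first exact: measurableT_comp.
  apply: measurable_funM; first exact: measurableT_comp.
  by apply: measurableT_comp => //; exact: measurable_funB.
have Iba x : L1 (fun y => b y * a (x - y)).
  apply: L1_mulC; apply: (@L1_mul_bounded _ _ _ A) => //.
  by apply: measurableT_comp => //; exact: measurable_funB.
have Ika y : L1 (fun x => k x * a (x - y)).
  by apply: L1_mul_bounded kM _ => //; exact: L1_shiftB.
have F1 y : L1 (fun x => F (y, x)) by exact: (L1Z (b y) (Ika y)).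
have F2 x : L1 (fun y => F (y, x)).
  by have := L1Z (k x) (Iba x); apply: eqL1 => y; rewrite /F/= mulrCA.
have [|y|J1 J2 J3] := @fubini_real _ F
    (fun y => (M * I (fun x => `|a x|)) * `|b y|) mF F1 F2.
- by apply: L1Z; exact: L1_norm.
- rewrite -(I_shiftB y (L1_norm Ia)) mulrC mulrCA -IZ; last first.
    by apply: L1_shiftB (L1_norm Ia).
  rewrite -IZ; last by apply: L1Z; apply: L1_shiftB (L1_norm Ia).
  apply: I_le.
  + exact: L1_norm (F1 y).
  + by apply: L1Z; apply: L1Z; apply: L1_shiftB (L1_norm Ia).
  + by move=> x; rewrite /F/= !normrM mulrCA ler_wpM2r// mulr_ge0.
have e1 y : I (fun x => F (y, x)) = b y * I (fun x => k x * a (x - y)) by rewrite -IZ.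
have e2 x : I (fun y => F (y, x)) = k x * I (fun y => b y * a (x - y)).
  by rewrite -IZ//; apply: eqI => y; rewrite /F/= mulrCA.
split.
- exact: eqL1 e2 J2.
- exact: eqL1 e1 J1.
- by rewrite -(eqI e1) J3 (eqI e2).
Qed.

Lemma convolution_L1 (a b : R -> R) (A : R) : L1 a -> L1 b ->
  (forall x, `|a x| <= A) ->
  L1 (fun x => I (fun y => b y * a (x - y))) /\
  I (fun x => I (fun y => b y * a (x - y))) = I b * I a.
Proof.
move=> Ia Ib aA.
have m1 : measurable_fun [set: R] (fun _ : R => 1 : R) by exact: measurable_cst.
have n1 (x : R) : `|1 : R| <= 1 by rewrite normr1.
have [J1 J2 J3] := convolution_fubini Ia Ib aA m1 n1.
have e1 x : 1 * I (fun y => b y * a (x - y)) = I (fun y => b y * a (x - y)).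
  by rewrite mul1r.
have e2 y : b y * I (fun x => 1 * a (x - y)) = I a * b y.
  rewrite mulrC; congr (_ * _).
  by rewrite -(I_shiftB y Ia); apply: eqI => x; rewrite mul1r.
split; first exact: eqL1 e1 J1.
by rewrite -(eqI e1) J3 (eqI e2) (IZ _ Ib) mulrC.
Qed.

Lemma L1_convolution_pointwise (a b : R -> R) (A x : R) : L1 a -> L1 b ->
  (forall x, `|a x| <= A) -> L1 (fun y => b y * a (x - y)).
Proof.
move=> Ia Ib aA; apply: L1_mulC; apply: (@L1_mul_bounded _ _ _ A) => //.
by apply: measurableT_comp; [exact: L1_measurable|exact: measurable_funB].
Qed.

(** Pointwise v(x) v(y) <= (v(x)^2 + v(y)^2) / 2, integrated against a kernel whose mass in either
    variable is 2 pi; the bound does not depend on e. *)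
Lemma convolution_squares v (e : R) : 0 < e -> L1 v -> L1 (fun x => v x ^+ 2) ->
  L1 (fun x => v x * I (fun y => v y * q e (x - y))) ->
  I (fun x => v x * I (fun y => v y * q e (x - y))) <=
  2 * pi * I (fun x => v x ^+ 2).
Proof.
move=> e0 Iv Iv2 Ivz.
have qB x : `|q e x| <= 2 / e by rewrite ger0_norm ?q_ge0 ?q_le.
have [Jc Ec] := convolution_L1 (L1_q e0) Iv2 qB.
apply: (@le_trans _ _ (I (fun x => pi * v x ^+ 2 +
    (1/2) * I (fun y => v y ^+ 2 * q e (x - y))))); last first.
  rewrite (ID (L1Z pi Iv2) (L1Z (1/2) Jc)).
  rewrite IZ// IZ// Ec.
  by rewrite I_q// le_eqVlt; apply/orP; left; apply/eqP; field.
apply: I_le => //; first exact: (L1D (L1Z pi Iv2) (L1Z (1/2) Jc)).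
move=> x.
have C1 := L1_convolution_pointwise x (L1_q e0) Iv qB.
have C2 := L1_convolution_pointwise x (L1_q e0) Iv2 qB.
have C3 : L1 (fun y => q e (x - y)) by apply: L1_subr; exact: L1_q.
rewrite -IZ//.
have -> : pi * v x ^+ 2 = I (fun y => (1/2 * v x ^+ 2) * q e (x - y)).
  rewrite IZ// (eqI (g := fun y => q e (y - x))); last first.
    by move=> y; rewrite -q_opp opprB.
  by rewrite I_shiftB ?I_q//; [field|exact: L1_q].
rewrite -IZ// -ID; [|exact: (L1Z _ C3)|exact: (L1Z _ C2)].
apply: I_le; first exact: (L1Z _ C1).
  exact: (L1D (L1Z _ C3) (L1Z _ C2)).
move=> y; have := q_ge0 (x - y) e0; have := sqr_ge0 (v x - v y); nra.
Qed.

(** This and the next three lemmas are the orthogonality relations of cosines and sines in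
    Abel-summed form: [q e] stands for the point masses at y = t and y = -t, and the mixed integrals
    vanish by parity. *)
Lemma cos_cos_expabs (e t y : R) : 0 < e ->
  I (fun x => (expR (- e * `|x|) * cos (t * x)) * cos (x * y)) =
  1/2 * (q e (y - t) + q e (y + t)).
Proof.
move=> e0; rewrite -!I_cos_expabs//.
have C1 := L1_cos_mul (y - t) (L1_expabs e0).
have C2 := L1_cos_mul (y + t) (L1_expabs e0).
rewrite -(ID C1 C2) -IZ; last exact: (L1D C1 C2).
apply: eqI => x; rewrite mulrBl mulrDl cosB cosD (mulrC y); by field.
Qed.

Lemma sin_sin_expabs (e t y : R) : 0 < e ->
  I (fun x => (expR (- e * `|x|) * sin (t * x)) * sin (x * y)) =
  1/2 * (q e (y - t) - q e (y + t)).
Proof.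
move=> e0; rewrite -!I_cos_expabs//.
have C1 := L1_cos_mul (y - t) (L1_expabs e0).
have C2 := L1_cos_mul (y + t) (L1_expabs e0).
rewrite -(IB C1 C2) -IZ; last exact: (L1B C1 C2).
apply: eqI => x; rewrite mulrBl mulrDl cosB cosD (mulrC y); by field.
Qed.

Lemma cos_sin_expabs (e t y : R) : 0 < e ->
  I (fun x => (expR (- e * `|x|) * cos (t * x)) * sin (x * y)) = 0.
Proof.
move=> e0; apply: I_odd.
  apply: (@eqL1 _ (fun x => sin (y * x) * (cos (t * x) * expR (- e * `|x|)))).
    by move=> x; rewrite (mulrC x y); ring.
  by apply: L1_sin_mul; apply: L1_cos_mul; exact: L1_expabs.
by move=> x; rewrite normrN mulrN cosN [- x * _]mulNr sinN mulrN.
Qed.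

Lemma sin_cos_expabs (e t y : R) : 0 < e ->
  I (fun x => (expR (- e * `|x|) * sin (t * x)) * cos (x * y)) = 0.
Proof.
move=> e0; apply: I_odd.
  apply: (@eqL1 _ (fun x => cos (y * x) * (sin (t * x) * expR (- e * `|x|)))).
    by move=> x; rewrite (mulrC x y); ring.
  by apply: L1_cos_mul; apply: L1_sin_mul; exact: L1_expabs.
by move=> x; rewrite normrN mulrN sinN [- x * _]mulNr cosN mulrN mulNr.
Qed.

End cos_sin_transforms.

(** * Abel-summed Plancherel identity and Bessel's inequality *)

Section bessel.
Variable R : realType.
Implicit Types f g v : R -> R.
Local Notation I f := (Rintegral \mu setT f).

Definition power_spectrum v (t : R) := Cf v t ^+ 2 + Sf v t ^+ 2.

Lemma power_spectrum_ge0 v t : 0 <= power_spectrum v t.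
Proof. by rewrite addr_ge0 ?sqr_ge0. Qed.

Lemma measurable_power_spectrum v : L1 v -> measurable_fun setT (power_spectrum v).
Proof.
move=> Iv; apply: measurable_funD; apply: measurable_funX.
  exact: measurable_Cf.
exact: measurable_Sf.
Qed.

Lemma L1_cosr_mul t f : L1 f -> L1 (fun x => f x * cos (t * x)).
Proof. by move=> If; apply: L1_mulC; exact: L1_cos_mul. Qed.

Lemma L1_sinr_mul t f : L1 f -> L1 (fun x => f x * sin (t * x)).
Proof. by move=> If; apply: L1_mulC; exact: L1_sin_mul. Qed.

(** Writing the squared modulus as a double integral and integrating over w first, the products of
    cosines and of sines add up to cos(w(x - y)), whose weighted integral is q_e(x - y). *)
Lemma abel_power_spectrum v (e : R) : 0 < e -> L1 v ->
  L1 (fun x => v x * I (fun y => v y * q e (x - y))) /\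
  I (fun w => expR (- e * `|w|) * power_spectrum v w) =
  I (fun x => v x * I (fun y => v y * q e (x - y))).
Proof.
move=> e0 Iv.
pose E (w : R) : R := expR (- e * `|w|).
have IE : L1 E by exact: L1_expabs.
have IC : L1 (fun w => E w * Cf v w) by exact: L1_mul_Cf.
have IS : L1 (fun w => E w * Sf v w) by exact: L1_mul_Sf.
have mxy : measurable_fun setT (fun z : R * R => z.1 * z.2) by exact: measurable_funM.
have mc := measurable_cos_comp mxy; have ms := measurable_sin_comp mxy.
have [C1 C2 C3] := fubini_bounded IC Iv mc (fun z => norm_cos_le1 (z.1 * z.2)).
have [S1 S2 S3] := fubini_bounded IS Iv ms (fun z => norm_sin_le1 (z.1 * z.2)).
have inner x : I (fun w => (E w * Cf v w) * cos (w * x)) +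
    I (fun w => (E w * Sf v w) * sin (w * x)) = I (fun y => v y * q e (x - y)).
  have ICx : L1 (fun w => E w * cos (x * w)) by exact: L1_cosr_mul.
  have ISx : L1 (fun w => E w * sin (x * w)) by exact: L1_sinr_mul.
  have [D1 D2 D3] := fubini_bounded ICx Iv mc (fun z => norm_cos_le1 (z.1 * z.2)).
  have [T1 T2 T3] := fubini_bounded ISx Iv ms (fun z => norm_sin_le1 (z.1 * z.2)).
  rewrite (eqI (g := fun w => E w * cos (x * w) * I (fun y => v y * cos (w * y)))); last first.
    move=> w; rewrite (mulrC w x) mulrAC; congr (_ * _).
    by apply: eqI => y; rewrite mulrC.
  rewrite (eqI (f := fun w => (E w * Sf v w) * _)
    (g := fun w => E w * sin (x * w) * I (fun y => v y * sin (w * y)))); last first.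
    move=> w; rewrite (mulrC w x) mulrAC; congr (_ * _).
    by apply: eqI => y; rewrite mulrC.
  rewrite D3 T3 -(ID D2 T2); apply: eqI => y; rewrite -mulrDr; congr (_ * _).
  rewrite [X in X + _](cos_cos_expabs x y e0) [X in _ + X](sin_sin_expabs x y e0).
  by rewrite -(q_opp e (x - y)) opprB; field.
have eC w : E w * Cf v w * I (fun y => v y * cos (w * y)) = E w * Cf v w ^+ 2.
  rewrite -mulrA expr2; congr (_ * (_ * _)).
  by apply: eqI => y; rewrite mulrC.
have eS w : E w * Sf v w * I (fun y => v y * sin (w * y)) = E w * Sf v w ^+ 2.
  rewrite -mulrA expr2; congr (_ * (_ * _)).
  by apply: eqI => y; rewrite mulrC.
have e1 x : v x * I (fun w => (E w * Cf v w) * cos (w * x)) +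
    v x * I (fun w => (E w * Sf v w) * sin (w * x)) =
    v x * I (fun y => v y * q e (x - y)).
  by rewrite -mulrDr inner.
split; first exact: eqL1 e1 (L1D C2 S2).
rewrite -(eqI e1) (ID C2 S2) -C3 -S3 -(ID C1 S1).
by apply: eqI => w; rewrite eC eS -mulrDr.
Qed.

Lemma cvg_inv_nat : (fun n : nat => (n.+1%:R^-1 : R)) @ \oo --> (0 : R).
Proof. exact: cvg_harmonic. Qed.

(** The Abel means of the spectrum are bounded uniformly in e by [convolution_squares]; Fatou along
    e = 1/(n+1) gives integrability and the bound together. *)
Lemma bessel_inequality v : L1 v -> L1 (fun x => v x ^+ 2) ->
  L1 (power_spectrum v) /\ I (power_spectrum v) <= 2 * pi * I (fun x => v x ^+ 2).
Proof.
move=> Iv Iv2.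
pose e (n : nat) : R := n.+1%:R^-1.
have e0 n : 0 < e n by rewrite invr_gt0.
apply: (@fatou_bound _ (fun n w => expR (- e n * `|w|) * power_spectrum v w)).
- move=> n; apply: (@eqL1 _ (fun w => expR (- e n * `|w|) * Cf v w * Cf v w +
     expR (- e n * `|w|) * Sf v w * Sf v w)).
    by move=> w; rewrite -!mulrA -mulrDr -!expr2.
  apply: L1D.
    by apply: L1_mul_Cf => //; apply: L1_mul_Cf => //; exact: L1_expabs.
  by apply: L1_mul_Sf => //; apply: L1_mul_Sf => //; exact: L1_expabs.
- by move=> n x; rewrite mulr_ge0 ?expR_ge0 ?power_spectrum_ge0.
- move=> x; rewrite -[X in _ --> X]mul1r; apply: cvgM; last exact: cvg_cst.
  rewrite -expR0; apply: continuous_cvg; first exact: continuous_expR.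
  rewrite -(mul0r `|x|); apply: cvgM; last exact: cvg_cst.
  by rewrite -oppr0; apply: cvgN; exact: cvg_inv_nat.
- move=> n; have [J1 ->] := abel_power_spectrum (e0 n) Iv.
  exact: convolution_squares.
Qed.

End bessel.

(** * The Poisson kernel as approximate identity *)

Section approximate_identity.
Variable R : realType.
Implicit Types f g v : R -> R.
Local Notation I f := (Rintegral \mu setT f).

Let e (n : nat) : R := n.+1%:R^-1.

Let e0 n : 0 < e n. Proof. by rewrite invr_gt0. Qed.

Let e1 n : e n <= 1. Proof. by rewrite invf_le1 ?ler1n. Qed.

(** A majorant of the localised kernel that is uniform in the scale E. For Y <= 1 the Lipschitz
    bound compensates the peak of the kernel, by 2 E Y <= E^2 + Y^2; for Y > 1 the crude bound 2A
    suffices, since there 1 + Y^2 <= 2 (E^2 + Y^2). *)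
Let min_mul_q_le (d L A E Y : R) : 0 <= d -> 0 <= L -> 0 <= A -> 0 < E <= 1 ->
  0 <= Y -> d <= L * Y -> d <= 2 * A ->
  d * (2 * E / (E ^+ 2 + Y ^+ 2)) <= (L + 4 * A) * (2 * 1 / (1 ^+ 2 + Y ^+ 2)).
Proof.
move=> d0 L0 A0 /andP[E0 E1] Y0 d1 d2.
have p1 : 0 < E ^+ 2 + Y ^+ 2 by have := sqr_ge0 Y; nra.
have p2 : 0 < 1 ^+ 2 + Y ^+ 2 by have := sqr_ge0 Y; nra.
have dE0 : 0 <= d * (2 * E) by nra.
have LP : 0 <= L * (E ^+ 2 + Y ^+ 2) by nra.
have AP : 0 <= A * (E ^+ 2 + Y ^+ 2) by nra.
rewrite !mulrA ler_pdivrMr// [leRHS]mulrAC ler_pdivlMr// -(mulrA d).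
have [Y1|Y1] := leP Y 1.
  have h1 : d * (2 * E) <= L * (E ^+ 2 + Y ^+ 2).
    apply: (@le_trans _ _ (L * Y * (2 * E))); first by rewrite ler_wpM2r//; lra.
    by rewrite -mulrA ler_wpM2l//; have := sqr_ge0 (E - Y); nra.
  have h2 : 1 ^+ 2 + Y ^+ 2 <= 2 by nra.
  have : d * (2 * E) * (1 ^+ 2 + Y ^+ 2) <= L * (E ^+ 2 + Y ^+ 2) * 2.
    by apply: ler_pM => //; lra.
  lra.
have h1 : d * (2 * E) <= 4 * A by nra.
have h2 : 1 ^+ 2 + Y ^+ 2 <= 2 * (E ^+ 2 + Y ^+ 2) by nra.
have : d * (2 * E) * (1 ^+ 2 + Y ^+ 2) <= 4 * A * (2 * (E ^+ 2 + Y ^+ 2)).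
  by apply: ler_pM => //; lra.
lra.
Qed.

Lemma q_approximate_identity v (L A t : R) : measurable_fun setT v -> L1 v ->
  (forall x, `|v x| <= A) -> (forall x y, `|v x - v y| <= L * `|x - y|) ->
  (fun n => I (fun y => v y * q (e n) (y - t))) @ \oo --> 2 * pi * v t.
Proof.
move=> mv Iv vA vL.
have Iq n := L1_q (e0 n).
have mvt : measurable_fun setT (fun y : R => v (y + t)).
  by apply: measurableT_comp => //; exact: measurable_funD.
have L0 : 0 <= L.
  by have := vL 1 0; rewrite subr0 normr1 mulr1; apply: le_trans.
have A0 : 0 <= A by exact: le_trans (normr_ge0 _) (vA 0).
have Ivq n : L1 (fun y => v (y + t) * q (e n) y) by exact: L1_mul_bounded (Iq n).
have E n : I (fun y => v y * q (e n) (y - t)) =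
    I (fun y => (v (y + t) - v t) * q (e n) y) + 2 * pi * v t.
  rewrite -(@I_shift _ t (fun y => v y * q (e n) (y - t))); last first.
    apply: L1_mul_bounded vA _ => //; exact: L1_shiftB.
  rewrite (eqI (g := fun y => (v (y + t) - v t) * q (e n) y + v t * q (e n) y)).
    rewrite ID.
    - by rewrite IZ// I_q// mulrC.
    - by apply: (@eqL1 _ _ _ _ (L1B (Ivq n) (L1Z (v t) (Iq n)))) => y; rewrite mulrBl.
    - exact: (L1Z _ (Iq n)).
  by move=> y; rewrite addrK; ring.
rewrite (_ : (fun n => _) = (fun n =>
   I (fun y => (v (y + t) - v t) * q (e n) y) + 2 * pi * v t)); last exact/funext.
rewrite -[X in _ --> X]add0r; apply: cvgD; last exact: cvg_cst.
have -> : (0 : R) = I (fun=> 0) by rewrite /Rintegral integral0.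
have [] // := @dominated_cvg_real R (fun n y => (v (y + t) - v t) * q (e n) y)
   (fun=> 0) (fun y => (L + 4 * A) * q 1 y).
- move=> n; apply: measurable_funM; last exact: measurable_q.
  exact: measurable_funB.
(* At y = 0 the kernel blows up, but the difference of values of [v] is exactly 0; elsewhere the
   kernel itself tends to 0. *)
- move=> y; have [->|y0] := eqVneq y 0.
    by under eq_fun do rewrite add0r subrr mul0r; exact: cvg_cst.
  rewrite -[X in _ --> X](mulr0 (v (y + t) - v t)); apply: cvgM; first exact: cvg_cst.
  have -> : (0 : R) = 2 * 0 / (0 ^+ 2 + y ^+ 2) by rewrite mulr0 mul0r.
  apply: cvgM; first by apply: cvgM; [exact: cvg_cst|exact: cvg_inv_nat].
  apply: cvgV; first by rewrite expr0n/= add0r expf_neq0.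
  apply: cvgD; last exact: cvg_cst.
  rewrite !expr2; apply: cvgM; exact: cvg_inv_nat.
- by apply: L1Z; exact: L1_q.
- move=> n y; rewrite normrM (ger0_norm (q_ge0 y (e0 n))).
  have d1 : `|v (y + t) - v t| <= L * `|y| by rewrite -{2}(addrK t y).
  have d2 : `|v (y + t) - v t| <= 2 * A.
    rewrite (le_trans (ler_normB _ _))// mulr_natl mulr2n lerD//.
  rewrite /q -(real_normK (num_real y)).
  by apply: min_mul_q_le => //; rewrite e0 e1.
Qed.

End approximate_identity.

(** * Fourier inversion and Poisson averages *)

Section fourier_inversion.
Variable R : realType.
Implicit Types f g v : R -> R.
Local Notation I f := (Rintegral \mu setT f).

Let e (n : nat) : R := n.+1%:R^-1.

Let e0 n : 0 < e n. Proof. by rewrite invr_gt0. Qed.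

(* The inverse transform of the [w] with [w(-t) = conj (w t)] that is [v1 + i v2]
   for [t > 0], for [v1], [v2] supported in the half line [t > 0]. *)
Definition inv_fourier (v1 v2 : R -> R) (x : R) : R :=
  pi^-1 * (Cf v1 x + Sf v2 x).

Definition bounded_lipschitz (v : R -> R) : Prop :=
  exists A L : R, (forall x, `|v x| <= A) /\
    (forall x y, `|v x - v y| <= L * `|x - y|).

Lemma measurable_inv_fourier v1 v2 : L1 v1 -> L1 v2 ->
  measurable_fun setT (inv_fourier v1 v2).
Proof.
move=> I1 I2; apply: measurable_funM => //.
by apply: measurable_funD; [exact: measurable_Cf|exact: measurable_Sf].
Qed.

Lemma norm_inv_fourier_le v1 v2 x : L1 v1 -> L1 v2 ->
  `|inv_fourier v1 v2 x| <= pi^-1 * (I (fun x => `|v1 x|) + I (fun x => `|v2 x|)).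
Proof.
move=> I1 I2; rewrite /inv_fourier normrM ger0_norm ?invr_ge0 ?pi_ge0//.
rewrite ler_wpM2l ?invr_ge0 ?pi_ge0// (le_trans (ler_normD _ _))//.
by rewrite lerD ?norm_Cf_le ?norm_Sf_le.
Qed.

Let cvg_expabs (x : R) : (fun n => expR (- e n * `|x|)) @ \oo --> (1 : R).
Proof.
rewrite -[X in _ --> X]expR0; apply: continuous_cvg; first exact: continuous_expR.
rewrite -(mul0r `|x|); apply: cvgM; last exact: cvg_cst.
by rewrite -oppr0; apply: cvgN; exact: cvg_inv_nat.
Qed.

Let abel_limit (h : R -> R) : L1 h ->
  (fun n => I (fun x => expR (- e n * `|x|) * h x)) @ \oo --> I h.
Proof.
move=> Ih; have mh := L1_measurable Ih.
have [//|x||n x|//] := @dominated_cvg_real R (fun n x => expR (- e n * `|x|) * h x)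
   h (fun x => `|h x|).
- move=> n; apply: measurable_funM => //; apply: continuous_measurable_fun.
  exact: continuous_expabs.
- rewrite -[X in _ --> X]mul1r; apply: cvgM; last exact: cvg_cst.
  exact: cvg_expabs.
- exact: L1_norm.
- by rewrite normrM ger0_norm ?expR_ge0// ler_piMl// expabs_le1.
Qed.

(** Two limits of the same Abel means are compared. Dominated convergence gives the transform of
    [inv_fourier v1 v2], assumed integrable; Fubini and the orthogonality relations turn the means
    into Poisson averages of v1 or v2 at t and -t, which converge to the values there. *)
Lemma fourier_inversion v1 v2 (t : R) : L1 v1 -> L1 v2 ->
  bounded_lipschitz v1 -> bounded_lipschitz v2 ->
  L1 (inv_fourier v1 v2) ->
  Cf (inv_fourier v1 v2) t = v1 t + v1 (- t) /\
  Sf (inv_fourier v1 v2) t = v2 t - v2 (- t).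
Proof.
move=> I1 I2 [A1 [L1' [b1 l1]]] [A2 [L2 [b2 l2]]] IK.
have m1 := L1_measurable I1; have m2 := L1_measurable I2.
have mxy : measurable_fun setT (fun z : R * R => z.1 * z.2) by exact: measurable_funM.
have mc := measurable_cos_comp mxy; have ms := measurable_sin_comp mxy.
have pi0 : (pi : R) != 0 by rewrite gt_eqF// pi_gt0.
have B n v : L1 v -> (forall x, `|v x| <= A1) \/ (forall x, `|v x| <= A2) ->
    forall s, L1 (fun y => v y * q (e n) (y - s)).
  move=> Iv bv s; case: bv => bv; apply: (L1_mul_bounded _ bv).
  - exact: L1_measurable.
  - by apply: L1_shiftB; exact: L1_q.
  - exact: L1_measurable.
  - by apply: L1_shiftB; exact: L1_q.
have kc n (k : R -> R) : L1 (fun x => expR (- e n * `|x|) * k x) ->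
   I (fun x => expR (- e n * `|x|) * (k x * inv_fourier v1 v2 x)) =
   pi^-1 * (I (fun y => v1 y * I (fun x => (expR (- e n * `|x|) * k x) * cos (x * y))) +
   I (fun y => v2 y * I (fun x => (expR (- e n * `|x|) * k x) * sin (x * y)))).
  move=> Ik.
  have [C1 _ C3] := fubini_bounded Ik I1 mc (fun z => norm_cos_le1 (z.1 * z.2)).
  have [S1 _ S3] := fubini_bounded Ik I2 ms (fun z => norm_sin_le1 (z.1 * z.2)).
  rewrite -C3 -S3 -(ID C1 S1) -(IZ _ (L1D C1 S1)).
  apply: eqI => x; rewrite /inv_fourier.
  have -> : I (fun y => v1 y * cos (x * y)) = Cf v1 x.
    by apply: eqI => y; rewrite mulrC.
  have -> : I (fun y => v2 y * sin (x * y)) = Sf v2 x.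
    by apply: eqI => y; rewrite mulrC.
  by ring.
have J v s n : L1 (fun y => v y * q (e n) (y - s)) ->
     L1 (fun y => v y * q (e n) (y - - s)) ->
   I (fun y => v y * (1 / 2 * (q (e n) (y - s) + q (e n) (y + s)))) =
   1/2 * (I (fun y => v y * q (e n) (y - s)) + I (fun y => v y * q (e n) (y - - s))) /\
   I (fun y => v y * (1 / 2 * (q (e n) (y - s) - q (e n) (y + s)))) =
   1/2 * (I (fun y => v y * q (e n) (y - s)) - I (fun y => v y * q (e n) (y - - s))).
  move=> Ja Jb; split.
    rewrite -(ID Ja Jb) -(IZ _ (L1D Ja Jb)); apply: eqI => y; rewrite opprK; ring.
  rewrite -(IB Ja Jb) -(IZ _ (L1B Ja Jb)); apply: eqI => y; rewrite opprK; ring.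
split.
- apply: (@cvg_unique _ _ _ _ _ _ (abel_limit (L1_cos_mul t IK))) => //.
  rewrite (_ : (fun n => _) = (fun n => pi^-1 * (1/2 *
      (I (fun y => v1 y * q (e n) (y - t)) + I (fun y => v1 y * q (e n) (y - - t)))))); last first.
    apply/funext => n.
    rewrite kc; last by apply: L1_cosr_mul; exact: L1_expabs.
    rewrite [X in _ * (_ + X)](eqI (g := fun=> 0)); last first.
      by move=> y; rewrite cos_sin_expabs// mulr0.
    rewrite [X in _ * (_ + X)]/Rintegral integral0 addr0; congr (_ * _).
    rewrite -(J v1 t n (B n v1 I1 (or_introl b1) t) (B n v1 I1 (or_introl b1) (- t))).1.
    by apply: eqI => y; rewrite cos_cos_expabs.
  rewrite (_ : v1 t + v1 (- t) = pi^-1 * (1/2 * (2 * pi * v1 t + 2 * pi * v1 (- t)))).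
    apply: cvgM; first exact: cvg_cst.
    apply: cvgM; first exact: cvg_cst.
    by apply: cvgD; exact: q_approximate_identity b1 l1.
  by move: pi0; move: (pi : R) => p p0; field.
- apply: (@cvg_unique _ _ _ _ _ _ (abel_limit (L1_sin_mul t IK))) => //.
  rewrite (_ : (fun n => _) = (fun n => pi^-1 * (1/2 *
      (I (fun y => v2 y * q (e n) (y - t)) - I (fun y => v2 y * q (e n) (y - - t)))))); last first.
    apply/funext => n.
    rewrite kc; last by apply: L1_sinr_mul; exact: L1_expabs.
    rewrite [X in _ * (X + _)](eqI (g := fun=> 0)); last first.
      by move=> y; rewrite sin_cos_expabs// mulr0.
    rewrite [X in _ * (X + _)]/Rintegral integral0 add0r; congr (_ * _).
    rewrite -(J v2 t n (B n v2 I2 (or_intror b2) t) (B n v2 I2 (or_intror b2) (- t))).2.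
    by apply: eqI => y; rewrite sin_sin_expabs.
  rewrite (_ : v2 t - v2 (- t) = pi^-1 * (1/2 * (2 * pi * v2 t - 2 * pi * v2 (- t)))).
    apply: cvgM; first exact: cvg_cst.
    apply: cvgM; first exact: cvg_cst.
    by apply: cvgB; exact: q_approximate_identity b2 l2.
  by move: pi0; move: (pi : R) => p p0; field.
Qed.

Lemma expR_lipschitz (a b : R) : 0 <= a -> 0 <= b ->
  `|expR (- a) - expR (- b)| <= `|a - b|.
Proof.
wlog ab : a b / a <= b => [H a0 b0|a0 b0].
  by have [/H->//|/ltW/H] := leP a b; rewrite distrC (distrC a b); apply.
rewrite ger0_norm; last by rewrite subr_ge0 ler_expR lerN2.
rewrite distrC ger0_norm ?subr_ge0//.
have -> : expR (- b) = expR (- a) * expR (a - b) by rewrite -expRD addKr.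
have := expR_ge1Dx (a - b); have : expR (- a) <= 1 by rewrite -expR0 ler_expR oppr_le0.
have := expR_gt0 (- a); nra.
Qed.

Lemma bounded_lipschitz_expabs (h : R) : 0 < h ->
  bounded_lipschitz (fun x : R => expR (- h * `|x|)).
Proof.
move=> h0; exists 1, h; split=> [x|x y].
  by rewrite ger0_norm ?expR_ge0// expabs_le1.
rewrite !mulNr (le_trans (expR_lipschitz _ _))// ?mulr_ge0 ?(ltW h0)//.
by rewrite -mulrBr normrM (gtr0_norm h0) ler_wpM2l ?(ltW h0)// ler_dist_dist.
Qed.

Lemma Sf_q (h t : R) : 0 < h -> Sf (q h) t = 0.
Proof.
move=> h0; apply: I_odd; first by apply: L1_sin_mul; exact: L1_q.
by move=> x; rewrite q_opp mulrN sinN mulNr.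
Qed.

(** Inversion applied to exp(-h|x|), whose inverse transform is a multiple of [q h]. *)
Lemma Cf_q (h t : R) : 0 < h -> Cf (q h) t = 2 * pi * expR (- h * `|t|).
Proof.
move=> h0; have pi0 : (pi : R) != 0 by rewrite gt_eqF// pi_gt0.
have L10 : L1 (fun _ : R => 0 : R).
  by apply: eqL1 (L1Z 0 (L1_q h0)) => x; rewrite mul0r.
have E x : inv_fourier (fun x => expR (- h * `|x|)) (fun=> 0) x = pi^-1 * q h x.
  rewrite /inv_fourier /Cf I_cos_expabs// (_ : Sf _ _ = 0) ?addr0//.
  by rewrite /Sf (eqI (g := fun=> 0)) => [|y]; [rewrite /Rintegral integral0|rewrite mulr0].
have [||||//|+ _] := @fourier_inversion (fun x => expR (- h * `|x|)) (fun=> 0) t.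
- exact: L1_expabs.
- exact: L10.
- exact: bounded_lipschitz_expabs.
- by exists 0, 0; split=> [x|x y]; rewrite ?subrr normr0// mul0r.
- by apply: (@eqL1 _ (fun x => pi^-1 * q h x)) => //; apply: L1Z; exact: L1_q.
rewrite normrN.
have -> : Cf (inv_fourier (fun x => expR (- h * `|x|)) (fun=> 0)) t = pi^-1 * Cf (q h) t.
  rewrite /Cf -IZ; last by apply: L1_cos_mul; exact: L1_q.
  by apply: eqI => x; rewrite E; ring.
by move=> H; rewrite -(mulVKf pi0 (Cf _ _)) H; ring.
Qed.

Lemma I_cos_q_shift (h t y : R) : 0 < h ->
  I (fun x => cos (t * x) * q h (x - y)) = 2 * pi * expR (- h * `|t|) * cos (t * y).
Proof.
move=> h0; rewrite -(@I_shift _ y); last first.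
  by apply: L1_cos_mul; apply: L1_shiftB; exact: L1_q.
rewrite -Cf_q// mulrC -[RHS]subr0 -(mulr0 (sin (t * y))) -(Sf_q t h0).
rewrite -!IZ; [|exact: L1_sin_mul (L1_q h0)|exact: L1_cos_mul (L1_q h0)].
rewrite -IB; [|exact: L1Z (L1_cos_mul t (L1_q h0))|exact: L1Z (L1_sin_mul t (L1_q h0))].
by apply: eqI => x; rewrite addrK mulrDr cosD; ring.
Qed.

Lemma I_sin_q_shift (h t y : R) : 0 < h ->
  I (fun x => sin (t * x) * q h (x - y)) = 2 * pi * expR (- h * `|t|) * sin (t * y).
Proof.
move=> h0; rewrite -(@I_shift _ y); last first.
  by apply: L1_sin_mul; apply: L1_shiftB; exact: L1_q.
rewrite -Cf_q// mulrC -[RHS]addr0 -(mulr0 (cos (t * y))) -(Sf_q t h0).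
rewrite -!IZ; [|exact: L1_sin_mul (L1_q h0)|exact: L1_cos_mul (L1_q h0)].
rewrite -ID; [|exact: L1Z (L1_cos_mul t (L1_q h0))|exact: L1Z (L1_sin_mul t (L1_q h0))].
by apply: eqI => x; rewrite addrK mulrDr sinD; ring.
Qed.

(** The Poisson integral of b at height h: the kernel is normalised to mass 1, so total mass is
    preserved. *)
Definition poisson (h : R) (b : R -> R) (x : R) : R :=
  (2 * pi)^-1 * I (fun y => b y * q h (x - y)).

Lemma norm_q_le (h : R) : 0 < h -> forall x, `|q h x| <= 2 / h.
Proof. by move=> h0 x; rewrite ger0_norm ?q_ge0 ?q_le. Qed.

Lemma poisson_L1 (h : R) (b : R -> R) : 0 < h -> L1 b ->
  L1 (poisson h b) /\ I (poisson h b) = I b.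
Proof.
move=> h0 Ib; have [J E] := convolution_L1 (L1_q h0) Ib (norm_q_le h0).
split; first exact: (L1Z _ J).
rewrite (IZ _ J) E I_q//.
have : (pi : R) != 0 by rewrite gt_eqF// pi_gt0.
by move: (pi : R) => p p0; field.
Qed.

(** The damping factor is the reason for this choice of smoother: with h = 1/m it absorbs any
    Sobolev weight up to a multiple of m^(2s). *)
Lemma poisson_transform (h : R) (b : R -> R) (t : R) : 0 < h -> L1 b ->
  Cf (poisson h b) t = expR (- h * `|t|) * Cf b t /\
  Sf (poisson h b) t = expR (- h * `|t|) * Sf b t.
Proof.
move=> h0 Ib; have pi0 : (pi : R) != 0 by rewrite gt_eqF// pi_gt0.
have mt : measurable_fun setT (fun x : R => t * x) by exact: measurable_funM.
have [C1 C2 C3] := convolution_fubini (L1_q h0) Ib (norm_q_le h0)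
  (measurable_cos_comp mt) (fun x => norm_cos_le1 (t * x)).
have [S1 S2 S3] := convolution_fubini (L1_q h0) Ib (norm_q_le h0)
  (measurable_sin_comp mt) (fun x => norm_sin_le1 (t * x)).
split.
- rewrite /Cf (eqI (g := fun x => (2 * pi)^-1 *
     (cos (t * x) * I (fun y => b y * q h (x - y))))); last first.
    by move=> x; rewrite /poisson; ring.
  rewrite (IZ _ C1) C3 -(IZ _ C2) -(IZ _ (L1_cos_mul t Ib)).
  by apply: eqI => y; rewrite (I_cos_q_shift t y h0); move: pi0; move: (pi : R) => p p0; field.
- rewrite /Sf (eqI (g := fun x => (2 * pi)^-1 *
     (sin (t * x) * I (fun y => b y * q h (x - y))))); last first.
    by move=> x; rewrite /poisson; ring.
  rewrite (IZ _ S1) S3 -(IZ _ S2) -(IZ _ (L1_sin_mul t Ib)).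
  by apply: eqI => y; rewrite (I_sin_q_shift t y h0); move: pi0; move: (pi : R) => p p0; field.
Qed.

End fourier_inversion.

(** * Weighted Bessel inequality *)

Section weighted_bessel.
Variable R : realType.
Implicit Types f g v : R -> R.
Local Notation I f := (Rintegral \mu setT f).

Lemma poisson_inv_fourier (h x : R) (u1 u2 : R -> R) : 0 < h -> L1 u1 -> L1 u2 ->
  poisson h (inv_fourier u1 u2) x =
  inv_fourier (fun w => expR (- h * `|w|) * u1 w) (fun w => expR (- h * `|w|) * u2 w) x.
Proof.
move=> h0 I1 I2; have pi0 : (pi : R) != 0 by rewrite gt_eqF// pi_gt0.
have mxy : measurable_fun setT (fun z : R * R => z.1 * z.2) by exact: measurable_funM.
have mc := measurable_cos_comp mxy; have ms := measurable_sin_comp mxy.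
have Iq : L1 (fun y => q h (x - y)) by apply: L1_subr; exact: L1_q.
have [C1 C2 C3] := fubini_bounded Iq I1 mc (fun z => norm_cos_le1 (z.1 * z.2)).
have [S1 S2 S3] := fubini_bounded Iq I2 ms (fun z => norm_sin_le1 (z.1 * z.2)).
rewrite /poisson (eqI (g := fun y => pi^-1 *
   (q h (x - y) * I (fun w => u1 w * cos (y * w)) +
    q h (x - y) * I (fun w => u2 w * sin (y * w))))); last first.
  move=> y; rewrite /inv_fourier.
  have -> : I (fun w => u1 w * cos (y * w)) = Cf u1 y by apply: eqI => w; rewrite mulrC.
  have -> : I (fun w => u2 w * sin (y * w)) = Sf u2 y by apply: eqI => w; rewrite mulrC.
  by ring.
rewrite (IZ _ (L1D C1 S1)) (ID C1 S1) C3 S3 /inv_fourier.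
have eb w : expR (- h * `|w|) = `|expR (- h * `|w|)| by rewrite ger0_norm// expR_ge0.
have IE (u : R -> R) : L1 u -> L1 (fun w => expR (- h * `|w|) * u w).
  move=> Iu; apply: (@L1_mul_bounded _ _ _ 1); last exact: Iu.
    by apply: continuous_measurable_fun; exact: continuous_expabs.
  by move=> w; rewrite -eb expabs_le1.
have split_sum (p k X Y P Q : R) : k * X = P -> k * Y = Q ->
    k * (p * (X + Y)) = p * (P + Q) by move=> <- <-; ring.
rewrite /Cf /Sf; apply: split_sum.
- rewrite -(IZ _ C2); apply: eqI => w.
  have -> : I (fun y => q h (x - y) * cos (y * w)) = 2 * pi * expR (- h * `|w|) * cos (w * x).
    rewrite -(I_cos_q_shift w x h0); apply: eqI => y.
    by rewrite mulrC (mulrC y) -(q_opp h (x - y)) opprB.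
  by rewrite (mulrC w x); move: pi0; move: (pi : R) => p p0; field.
- rewrite -(IZ _ S2); apply: eqI => w.
  have -> : I (fun y => q h (x - y) * sin (y * w)) = 2 * pi * expR (- h * `|w|) * sin (w * x).
    rewrite -(I_sin_q_shift w x h0); apply: eqI => y.
    by rewrite mulrC (mulrC y) -(q_opp h (x - y)) opprB.
  by rewrite (mulrC w x); move: pi0; move: (pi : R) => p p0; field.
Qed.

(** The two arguments on the right are the real and imaginary parts of (v1 + i v2)(Cf g + i Sf g):
    convolution multiplies transforms. *)
Lemma convolution_inv_fourier (g v1 v2 : R -> R) (x : R) : L1 g -> L1 v1 -> L1 v2 ->
  I (fun y => g y * inv_fourier v1 v2 (x - y)) =
  inv_fourier (fun w => v1 w * Cf g w - v2 w * Sf g w)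
              (fun w => v1 w * Sf g w + v2 w * Cf g w) x.
Proof.
move=> Ig I1 I2.
have mxy : measurable_fun setT (fun z : R * R => (x - z.1) * z.2).
  by apply: measurable_funM => //; exact: measurable_funB.
have mc := measurable_cos_comp mxy; have ms := measurable_sin_comp mxy.
have [C1 C2 C3] := fubini_bounded Ig I1 mc (fun z => norm_cos_le1 ((x - z.1) * z.2)).
have [S1 S2 S3] := fubini_bounded Ig I2 ms (fun z => norm_sin_le1 ((x - z.1) * z.2)).
rewrite (eqI (g := fun y => pi^-1 *
   (g y * I (fun w => v1 w * cos ((x - y) * w)) +
    g y * I (fun w => v2 w * sin ((x - y) * w))))); last first.
  move=> y; rewrite /inv_fourier.
  have -> : I (fun w => v1 w * cos ((x - y) * w)) = Cf v1 (x - y) by apply: eqI => w; rewrite mulrC.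
  have -> : I (fun w => v2 w * sin ((x - y) * w)) = Sf v2 (x - y) by apply: eqI => w; rewrite mulrC.
  by ring.
rewrite (IZ _ (L1D C1 S1)) (ID C1 S1) C3 S3 /inv_fourier; congr (_ * _).
have L1c : L1 (fun w => v1 w * Cf g w - v2 w * Sf g w).
  exact: L1B (L1_mul_Cf I1 Ig) (L1_mul_Sf I2 Ig).
have L1s : L1 (fun w => v1 w * Sf g w + v2 w * Cf g w).
  exact: L1D (L1_mul_Sf I1 Ig) (L1_mul_Cf I2 Ig).
rewrite -(ID C2 S2) /Cf -/(Cf _) /Sf -/(Sf _).
rewrite -(ID (L1_cos_mul x L1c) (L1_sin_mul x L1s)).
apply: eqI => w.
have Ic : L1 (fun y => cos (w * y) * g y) by exact: L1_cos_mul.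
have Is : L1 (fun y => sin (w * y) * g y) by exact: L1_sin_mul.
have -> : I (fun y => g y * cos ((x - y) * w)) =
    cos (x * w) * Cf g w + sin (x * w) * Sf g w.
  rewrite -(IZ _ Ic) -(IZ _ Is) -(ID (L1Z _ Ic) (L1Z _ Is)).
  by apply: eqI => y; rewrite mulrBl cosB (mulrC y w); ring.
have -> : I (fun y => g y * sin ((x - y) * w)) =
    sin (x * w) * Cf g w - cos (x * w) * Sf g w.
  rewrite -(IZ _ Ic) -(IZ _ Is) -(IB (L1Z _ Ic) (L1Z _ Is)).
  by apply: eqI => y; rewrite mulrBl sinB (mulrC y w); ring.
by ring.
Qed.

Lemma L1_supported f (M l r : R) : measurable_fun setT f -> l <= r -> 0 <= M ->
  (forall x, `|f x| <= M) -> (forall x, ~~ (l <= x <= r) -> f x = 0) ->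
  L1 f /\ I (fun x => `|f x|) <= M * (r - l).
Proof.
move=> mf lr M0 fM f0.
pose J : R -> R := \1_`[l, r].
have EJ : (\int[\mu]_x (J x)%:E = (r - l)%:E)%E.
  rewrite /J integral_indic// setIT [LHS]lebesgue_measure_itv/= lte_fin.
  case: ifPn => [_|]; first by rewrite EFinB.
  by rewrite -leNgt => rl; rewrite (@le_anti _ _ l r) ?lr// subrr.
have IJ : L1 J.
  by apply: L1_ge0; [exact: measurable_indic|move=> x; rewrite /J indicE ler0n|rewrite EJ ltry].
have fJ x : `|f x| <= M * J x.
  rewrite /J indicE; have [xin|xout] := boolP (l <= x <= r).
    by rewrite mem_set ?mulr1//= in_itv.
  by rewrite f0// normr0 mulr_ge0.
have If : L1 f by apply: (L1_dominated mf (L1Z M IJ)).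
split=> //; apply: (le_trans (I_le (L1_norm If) (L1Z M IJ) fJ)).
by rewrite IZ// /Rintegral EJ.
Qed.

(** These constants are the only data of a frequency-side function that enter the estimates: its
    weighted energy on the space side will be of order w (A^2 + L^2). *)
Record supported_lipschitz (v : R -> R) (l w A L : R) : Prop := SupportedLipschitz {
  sl_width : 0 < w;
  sl_support : forall x, ~~ (l <= x <= l + w) -> v x = 0;
  sl_bound : forall x, `|v x| <= A;
  sl_lipschitz : forall x y, `|v x - v y| <= L * `|x - y| }.

Lemma lipschitz_continuous v (L : R) :
  (forall x y, `|v x - v y| <= L * `|x - y|) -> continuous v.
Proof.
move=> vL x; apply/cvgrPdist_le => /= eps eps0.
have L0 : 0 < `|L| + 1 by rewrite ltr_wpDl.
near=> y; apply: (le_trans (vL x y)).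
apply: (@le_trans _ _ ((`|L| + 1) * `|x - y|)).
  by rewrite ler_wpM2r// (le_trans (ler_norm L))// lerDl.
rewrite mulrC -ler_pdivlMr//.
near: y; apply: cvgr_dist_le => //.
by rewrite divr_gt0.
Unshelve. all: by end_near. Qed.

Lemma sl_measurable v l w A L : supported_lipschitz v l w A L -> measurable_fun setT v.
Proof.
by move=> H; apply: continuous_measurable_fun; exact: lipschitz_continuous (sl_lipschitz H).
Qed.

Lemma sl_A_ge0 v l w A L : supported_lipschitz v l w A L -> 0 <= A.
Proof. by move=> H; exact: le_trans (normr_ge0 _) (sl_bound H 0). Qed.

Lemma sl_L1 v l w A L : supported_lipschitz v l w A L -> L1 v.
Proof.
move=> H; have mv := sl_measurable H.
have lw : l <= l + w by rewrite lerDl ltW// (sl_width H).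
by have [] := L1_supported mv lw (sl_A_ge0 H) (sl_bound H) (sl_support H).
Qed.

Lemma sl_L2 v l w A L : supported_lipschitz v l w A L ->
  L1 (fun x => v x ^+ 2) /\ I (fun x => v x ^+ 2) <= w * A ^+ 2.
Proof.
move=> H; have mv := sl_measurable H; have A0 := sl_A_ge0 H.
have [|||||J1 J2] := @L1_supported (fun x => v x ^+ 2) (A ^+ 2) l (l + w).
- exact: measurable_funX.
- by rewrite lerDl ltW// (sl_width H).
- exact: sqr_ge0.
- by move=> x; rewrite normrX ler_sqr ?nnegrE// (sl_bound H).
- by move=> x /(sl_support H) ->; rewrite expr0n.
split=> //.
rewrite (eqI (g := fun x => `|v x ^+ 2|)); last first.
  by move=> x; rewrite ger0_norm ?sqr_ge0.
by rewrite (le_trans J2)// addrC addKr mulrC.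
Qed.

(** Up to a factor of modulus 1, the symmetric difference multiplies the transform by 2 sin(x h).
    This replaces the rule that differentiation multiplies it by x, and demands no differentiability
    of [v]. *)
Lemma power_spectrum_difference v (h x : R) : L1 v ->
  power_spectrum (fun w => v (w + h) - v (w - h)) x =
  4 * sin (x * h) ^+ 2 * power_spectrum v x.
Proof.
move=> Iv.
have Ic := L1_cos_mul x Iv; have Is := L1_sin_mul x Iv.
have Jc s : I (fun w => cos (x * w) * v (w + s)) =
    cos (x * s) * Cf v x + sin (x * s) * Sf v x.
  rewrite -(@I_shift _ (- s)); last by apply: L1_cos_mul; exact: L1_shift.
  rewrite -(IZ _ Ic) -(IZ _ Is) -(ID (L1Z _ Ic) (L1Z _ Is)).
  by apply: eqI => w; rewrite subrK mulrBr cosB; ring.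
have Js s : I (fun w => sin (x * w) * v (w + s)) =
    cos (x * s) * Sf v x - sin (x * s) * Cf v x.
  rewrite -(@I_shift _ (- s)); last by apply: L1_sin_mul; exact: L1_shift.
  rewrite -(IZ _ Ic) -(IZ _ Is) -(IB (L1Z _ Is) (L1Z _ Ic)).
  by apply: eqI => w; rewrite subrK mulrBr sinB; ring.
rewrite /power_spectrum.
have -> : Cf (fun w => v (w + h) - v (w - h)) x = 2 * sin (x * h) * Sf v x.
  rewrite /Cf (eqI (g := fun w => cos (x * w) * v (w + h) - cos (x * w) * v (w + - h))).
    rewrite IB ?Jc ?mulrN ?cosN ?sinN; [ring|..]; apply: L1_cos_mul; exact: L1_shift.
  by move=> w; rewrite mulrBr.
have -> : Sf (fun w => v (w + h) - v (w - h)) x = - 2 * sin (x * h) * Cf v x.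
  rewrite /Sf (eqI (g := fun w => sin (x * w) * v (w + h) - sin (x * w) * v (w + - h))).
    rewrite IB ?Js ?mulrN ?cosN ?sinN; [ring|..]; apply: L1_sin_mul; exact: L1_shift.
  by move=> w; rewrite mulrBr.
by ring.
Qed.

(** By the mean value theorem, cos being at least cos 1 between 0 and 1. *)
Lemma sin_ge_cos1 (y : R) : 0 <= y <= 1 -> cos 1 * y <= sin y.
Proof.
move=> /andP[y0 y1].
have [->|yn0] := eqVneq y 0; first by rewrite mulr0 sin0.
have yp : 0 < y by rewrite lt0r yn0.
have [|c cy] := @MVT R sin cos 0 y yp.
  by apply: continuous_subspaceT; exact: continuous_sin.
rewrite sin0 !subr0 => ->; rewrite ler_wpM2r//.
move: cy; rewrite in_itv/= => /andP[c0 cy].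
have c1 : c <= 1 by rewrite (le_trans (ltW cy)).
have pi2 : (1 : R) <= pi by rewrite (le_trans _ (@pi_ge2 R))// ler1n.
have [->//|c1'] := eqVneq c 1.
rewrite ltW// ltr_cos ?in_itv/= ?ler01 ?(ltW c0) ?pi2 ?(le_trans c1)//.
by rewrite lt_neqAle c1' c1.
Qed.

Lemma sin_sqr_ge (y : R) : `|y| <= 1 -> cos 1 ^+ 2 * y ^+ 2 <= sin y ^+ 2.
Proof.
move=> y1.
have -> : sin y ^+ 2 = sin `|y| ^+ 2.
  have [y0|y0] := leP 0 y; first by rewrite ger0_norm.
  by rewrite ltr0_norm// sinN sqrrN.
rewrite -(real_normK (num_real y)) -exprMn ler_sqr ?nnegrE.
- by apply: sin_ge_cos1; rewrite y1 normr_ge0.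
- by rewrite mulr_ge0// ltW// cos1_gt0.
- have := sin_ge_cos1 (y := `|y|); rewrite y1 normr_ge0 => /(_ isT).
  by apply: le_trans; rewrite mulr_ge0// ltW// cos1_gt0.
Qed.

(** The symmetric difference is at most 2 h L and lives on an interval of length w + 2h, which is at
    most 2w by the restriction on h. Bessel's inequality then gives the order w L^2 h^2, the right
    one for division by h^2. *)
Lemma sl_difference_bessel v l w A L (h : R) : supported_lipschitz v l w A L ->
  0 < h -> h <= w / 2 ->
  L1 (fun x => sin (x * h) ^+ 2 * power_spectrum v x) /\
  I (fun x => sin (x * h) ^+ 2 * power_spectrum v x) <= 4 * pi * w * L ^+ 2 * h ^+ 2.
Proof.
move=> H h0 hw.
have mv := sl_measurable H; have Iv := sl_L1 H; have w0 := sl_width H.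
pose D (x : R) := v (x + h) - v (x - h).
have mD : measurable_fun setT D.
  apply: measurable_funB; apply: measurableT_comp => //.
    exact: measurable_funD.
  exact: measurable_funB.
have DL x : `|D x| <= L * (2 * h).
  rewrite (le_trans (sl_lipschitz H _ _))//.
  have -> : x + h - (x - h) = 2 * h by ring.
  by rewrite (gtr0_norm (_ : 0 < 2 * h))// mulr_gt0.
have L0 : 0 <= L * (2 * h) by exact: le_trans (normr_ge0 _) (DL 0).
have D0 x : ~~ (l - h <= x <= l + w + h) -> D x = 0.
  move=> xo; rewrite /D (sl_support H) ?(sl_support H) ?subrr//.
    by apply: contra xo => /andP[]; lra.
  by apply: contra xo => /andP[]; lra.
have ID1 : L1 D by apply: L1B; exact: L1_shift.
have [|||||ID2 ED2] := @L1_supported (fun x => D x ^+ 2) ((L * (2 * h)) ^+ 2) (l - h) (l + w + h).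
- exact: measurable_funX.
- lra.
- exact: sqr_ge0.
- by move=> x; rewrite normrX ler_sqr ?nnegrE// DL.
- by move=> x /D0 ->; rewrite expr0n.
have [J1 J2] := bessel_inequality ID1 ID2.
have e1 x : sin (x * h) ^+ 2 * power_spectrum v x = 1/4 * power_spectrum D x.
  by rewrite power_spectrum_difference//; field.
split.
  by apply: (@eqL1 _ (fun x => 1/4 * power_spectrum D x)); [move=> x; rewrite e1|exact: L1Z].
rewrite (eqI e1) (IZ _ J1).
apply: (@le_trans _ _ (1/4 * (2 * pi * ((L * (2 * h)) ^+ 2 * (w + 2 * h))))).
  rewrite ler_wpM2l// (le_trans J2)// ler_wpM2l ?mulr_ge0 ?pi_ge0//.
  rewrite (eqI (g := fun x => `|D x ^+ 2|)); last first.
    by move=> x; rewrite ger0_norm ?sqr_ge0.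
  by rewrite (le_trans ED2)// le_eqVlt; apply/orP; left; apply/eqP; ring.
have -> : 1/4 * (2 * pi * ((L * (2 * h)) ^+ 2 * (w + 2 * h))) =
   2 * pi * (L ^+ 2 * h ^+ 2) * (w + 2 * h) by field.
have -> : 4 * pi * w * L ^+ 2 * h ^+ 2 = 2 * pi * (L ^+ 2 * h ^+ 2) * (2 * w) by ring.
apply: ler_wpM2l; last by lra.
apply: mulr_ge0; last by apply: mulr_ge0; exact: sqr_ge0.
by apply: mulr_ge0 => //; exact: pi_ge0.
Qed.

(** 4 pi comes from [sl_difference_bessel], and cos 1 squared is the loss in bounding y^2 by a
    multiple of sin(y)^2. *)
Definition bessel_const : R := 4 * pi / cos 1 ^+ 2.

(* The factor [x^2] is bounded by [sin(h x)^2 / h^2] as [h] tends to 0, that is,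
   by the Bessel inequality for symmetric difference quotients of [v], and Fatou. *)
Lemma weighted_bessel v l w A L : supported_lipschitz v l w A L ->
  L1 (fun x => (1 + x ^+ 2) * power_spectrum v x) /\
  I (fun x => (1 + x ^+ 2) * power_spectrum v x) <= 
    bessel_const * (w * (A ^+ 2 + L ^+ 2)).
Proof.
move=> H; have Iv := sl_L1 H; have w0 := sl_width H.
have [I2 E2] := sl_L2 H.
have [P1 P2] := bessel_inequality Iv I2.
have mP := measurable_power_spectrum Iv.
have k0 : 0 < cos 1 ^+ 2 :> R by rewrite exprn_gt0// cos1_gt0.
have k1 : cos 1 ^+ 2 <= 1 :> R.
  by rewrite expr_le1// ?cos_le1// ltW// cos1_gt0.
(* The truncation at |x| <= n keeps |x h| <= 1 for h <= 1/(n+1), the range in which the square of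
   the sine is comparable to that of its argument. *)
pose F (n : nat) (x : R) := if `|x| <= n%:R then x ^+ 2 * power_spectrum v x else 0.
have mF n : measurable_fun setT (F n).
  apply: measurable_fun_ifT => //.
    apply: measurable_fun_ler => //; exact: normr_measurable.
  by apply: measurable_funM => //; exact: measurable_funX.
have F0 n x : 0 <= F n x.
  by rewrite /F; case: ifP => // _; rewrite mulr_ge0 ?sqr_ge0 ?power_spectrum_ge0.
have FB n : L1 (F n) /\ I (F n) <= bessel_const * (w * L ^+ 2).
  pose h : R := Num.min (w / 2) n.+1%:R^-1.
  have h0 : 0 < h by rewrite lt_min divr_gt0//= invr_gt0.
  have [|J1 J2] := sl_difference_bessel H h0; first by rewrite ge_min lexx.
  have Fle x : `|F n x| <= (cos 1 ^+ 2 * h ^+ 2)^-1 * (sin (x * h) ^+ 2 * power_spectrum v x).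
    rewrite ger0_norm// /F; case: ifPn => [xn|_]; last first.
      apply: mulr_ge0; first by rewrite invr_ge0 mulr_ge0 ?sqr_ge0.
      by rewrite mulr_ge0 ?sqr_ge0 ?power_spectrum_ge0.
    rewrite mulrA ler_wpM2r ?power_spectrum_ge0// ler_pdivlMl ?mulr_gt0 ?exprn_gt0 ?cos1_gt0//.
    rewrite -mulrA -exprMn mulrC (mulrC h) mulrC sin_sqr_ge//.
    rewrite normrM (gtr0_norm h0) (@le_trans _ _ (n%:R * n.+1%:R^-1))//.
      by apply: ler_pM => //; [exact: ltW|rewrite /h ge_min lexx orbT].
    by rewrite ler_pdivrMr// mul1r ler_nat.
  have IFn : L1 (F n) by exact: L1_dominated (mF n) (L1Z _ J1) Fle.
  split=> //; apply: (@le_trans _ _ (I (fun x => (cos 1 ^+ 2 * h ^+ 2)^-1 *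
      (sin (x * h) ^+ 2 * power_spectrum v x)))).
    by apply: I_le => //; [exact: L1Z|move=> x; rewrite (le_trans _ (Fle x))// ler_norm].
  rewrite (IZ _ J1) ler_pdivrMl ?mulr_gt0 ?exprn_gt0 ?cos1_gt0//.
  apply: (le_trans J2); rewrite /bessel_const le_eqVlt; apply/orP; left; apply/eqP.
  have k0' := lt0r_neq0 k0.
  by move: (pi : R) (cos 1 ^+ 2 : R) k0' => p k kk; field.
have [G1 G2] : L1 (fun x => x ^+ 2 * power_spectrum v x) /\
    I (fun x => x ^+ 2 * power_spectrum v x) <= bessel_const * (w * L ^+ 2).
  apply: (@fatou_bound _ F) => //.
  - by move=> n; exact: (FB n).1.
  - move=> x; apply: (@cvg_near_cst _ _ _ _ _).
    near=> n; rewrite /F ifT//; near: n; exact: nbhs_infty_ger.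
  - by move=> n; exact: (FB n).2.
have e1 x : (1 + x ^+ 2) * power_spectrum v x =
  power_spectrum v x + x ^+ 2 * power_spectrum v x by rewrite mulrDl mul1r.
split; first by apply: (@eqL1 _ _ _ _ (L1D P1 G1)) => x; rewrite e1.
rewrite (eqI e1) (ID P1 G1) mulrDr mulrDr; apply: lerD => //.
apply: (le_trans P2); rewrite /bessel_const.
apply: (@le_trans _ _ (2 * pi * (w * A ^+ 2))).
  by rewrite ler_wpM2l// mulr_ge0 ?pi_ge0.
apply: ler_wpM2r; first by rewrite mulr_ge0 ?sqr_ge0// ltW.
rewrite ler_pdivlMr//; have := pi_ge0 R; move: (pi : R) (cos 1 ^+ 2 : R) k0 k1 => p k; nra.
Unshelve. all: by end_near. Qed.

(** From (Cf v1 + Sf v2)^2 <= 2 (Cf v1^2 + Sf v2^2) and pi >= 2, so that the prefactor 1/pi^2 <= 1/4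
    leaves the constant of [weighted_bessel] unchanged. *)
Lemma inv_fourier_weighted_L2 v1 v2 l w A L :
  supported_lipschitz v1 l w A L -> supported_lipschitz v2 l w A L ->
  L1 (fun x => (1 + x ^+ 2) * inv_fourier v1 v2 x ^+ 2) /\
  I (fun x => (1 + x ^+ 2) * inv_fourier v1 v2 x ^+ 2) <=
    bessel_const * (w * (A ^+ 2 + L ^+ 2)).
Proof.
move=> H1 H2.
have [J1 E1] := weighted_bessel H1; have [J2 E2] := weighted_bessel H2.
have I1 := sl_L1 H1; have I2 := sl_L1 H2.
have pi2 : (pi : R)^-1 ^+ 2 <= 1/4.
  have h : (pi : R)^-1 <= 1/2 by rewrite div1r lef_pV2 ?posrE ?pi_gt0 ?pi_ge2.
  have h0 : 0 <= (pi : R)^-1 by rewrite invr_ge0 pi_ge0.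
  by move: h h0; move: (pi^-1 : R) => p; nra.
have le x : `|(1 + x ^+ 2) * inv_fourier v1 v2 x ^+ 2| <=
    1/2 * ((1 + x ^+ 2) * power_spectrum v1 x + (1 + x ^+ 2) * power_spectrum v2 x).
  have x2 : 0 <= 1 + x ^+ 2 by rewrite addr_ge0 ?sqr_ge0.
  rewrite ger0_norm; last by rewrite mulr_ge0// sqr_ge0.
  have -> : 1/2 * ((1 + x ^+ 2) * power_spectrum v1 x + (1 + x ^+ 2) * power_spectrum v2 x)
    = (1 + x ^+ 2) * (1/2 * (power_spectrum v1 x + power_spectrum v2 x)) by ring.
  apply: ler_wpM2l => //.
  rewrite /inv_fourier exprMn /power_spectrum.
  apply: (@le_trans _ _ (1/4 * (Cf v1 x + Sf v2 x) ^+ 2)).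
    by rewrite ler_wpM2r ?sqr_ge0.
  have := sqr_ge0 (Cf v1 x - Sf v2 x); have := sqr_ge0 (Sf v1 x); have := sqr_ge0 (Cf v2 x).
  nra.
have mK : measurable_fun setT (fun x : R => (1 + x ^+ 2) * inv_fourier v1 v2 x ^+ 2).
  apply: measurable_funM; first by apply: measurable_funD => //; exact: measurable_funX.
  by apply: measurable_funX; exact: measurable_inv_fourier.
have IK := L1_dominated mK (L1Z _ (L1D J1 J2)) le.
split=> //; apply: (@le_trans _ _ (I (fun x => 1/2 *
  ((1 + x ^+ 2) * power_spectrum v1 x + (1 + x ^+ 2) * power_spectrum v2 x)))).
  apply: I_le => //; first exact: (L1Z _ (L1D J1 J2)).
  by move=> x; rewrite (le_trans _ (le x))// ler_norm.
rewrite (IZ _ (L1D J1 J2)) (ID J1 J2); lra.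
Qed.

(** Cauchy-Schwarz in pointwise form: |f| <= sigma / (2 (1 + x^2)) + (1 + x^2) f^2 / (2 sigma). The
    integral of 1/(1 + x^2) is pi, hence the factor (pi + 1) / 2. *)
Lemma L1_weighted_L2 f (sigma : R) : measurable_fun setT f -> 0 < sigma ->
  L1 (fun x => (1 + x ^+ 2) * f x ^+ 2) ->
  I (fun x => (1 + x ^+ 2) * f x ^+ 2) <= sigma ^+ 2 ->
  [/\ L1 f, L1 (fun x => f x ^+ 2), I (fun x => f x ^+ 2) <= sigma ^+ 2 &
    I (fun x => `|f x|) <= sigma * ((pi + 1) / 2)].
Proof.
move=> mf s0 If2 fs.
have Iq := @L1_q R 1 ltr01.
pose G x := 1/4 * sigma * q 1 x + (2 * sigma)^-1 * ((1 + x ^+ 2) * f x ^+ 2).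
have IG : L1 G by exact: L1D (L1Z _ Iq) (L1Z _ If2).
have fG x : `|f x| <= G x.
  have p0 : 0 < 1 + x ^+ 2 by rewrite ltr_wpDr ?sqr_ge0.
  rewrite /G /q expr1n -(real_normK (num_real (f x))).
  have -> : 1/4 * sigma * (2 * 1 / (1 + x ^+ 2)) + (2 * sigma)^-1 * ((1 + x ^+ 2) * `|f x| ^+ 2)
   = (sigma ^+ 2 + ((1 + x ^+ 2) * `|f x|) ^+ 2) / (2 * sigma * (1 + x ^+ 2)).
    by field; rewrite !gt_eqF.
  rewrite ler_pdivlMr ?mulr_gt0//.
  by have := sqr_ge0 (sigma - (1 + x ^+ 2) * `|f x|); nra.
have If : L1 f by exact: L1_dominated mf IG fG.
have If' : L1 (fun x => f x ^+ 2).
  apply: (L1_dominated _ If2); first exact: measurable_funX.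
  by move=> x; rewrite ger0_norm ?sqr_ge0// ler_peMl ?sqr_ge0// lerDl sqr_ge0.
split=> //.
- apply: le_trans fs; apply: I_le => // x.
  by rewrite ler_peMl ?sqr_ge0// lerDl sqr_ge0.
- apply: (le_trans (I_le (L1_norm If) IG fG)).
  rewrite (ID (L1Z _ Iq) (L1Z _ If2)) (IZ _ Iq) (IZ _ If2) I_q//.
  have h : (2 * sigma)^-1 * I (fun x => (1 + x ^+ 2) * f x ^+ 2) <= sigma / 2.
    by rewrite ler_pdivrMl ?mulr_gt0// (le_trans fs)//; nra.
  by have := pi_ge0 R; move: (pi : R) => p p0; nra.
Qed.

End weighted_bessel.

(** * Le Cam's two-point method in the deconvolution model *)

(** Carrying the proof [hf] in the definition lets the measure and probability structures be
    declared for this very function. *)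
Definition density_prob (R : realType) (f : R -> R) (hf : is_pdf f)
    (A : set (measurableTypeR R)) : \bar R :=
  (\int[\mu]_(x in A) (f x)%:E)%E.

Section density_prob.
Variables (R : realType) (f : R -> R) (hf : is_pdf f).
Local Notation P := (density_prob hf).

Let mf : measurable_fun setT f. Proof. by case: hf. Qed.
Let f0 x : 0 <= f x. Proof. by case: hf. Qed.

Let P0 : P set0 = 0%E.
Proof. by rewrite /density_prob integral_set0. Qed.

Let P_ge0 A : (0 <= P A)%E.
Proof. by apply: integral_ge0 => x _; rewrite lee_fin. Qed.

Let P_sigma_additive : semi_sigma_additive P.
Proof.
move=> /= F mF tF mUF; rewrite /density_prob; apply: cvg_toP.
  apply: ereal_nondecreasing_is_cvgn => m n mn.
  apply: lee_sum_nneg_natr => // k _ _; apply: integral_ge0 => /= x Fkx.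
  by rewrite lee_fin.
rewrite ge0_integral_bigcup//=.
- by apply/measurable_funTS/measurable_EFinP.
- by move=> x _; rewrite lee_fin.
Qed.

HB.instance Definition _ := isMeasure.Build _ _ _ P P0 P_ge0 P_sigma_additive.

Let P_setT : P setT = 1%E. Proof. by case: hf. Qed.

HB.instance Definition _ := Measure_isProbability.Build _ _ R P P_setT.

Definition pdf_prob : probability (measurableTypeR R) R := P.

Lemma pdf_probE A : pdf_prob A = (\int[\mu]_(x in A) (f x)%:E)%E.
Proof. by []. Qed.

(** Change of variables is available for the Radon-Nikodym derivative, which agrees with [f] almost
    everywhere because both have the same integrals over measurable sets. *)
Lemma pdf_prob_integral (h : R -> \bar R) : measurable_fun setT h ->
  (forall x, (0 <= h x)%E) ->
  (\int[pdf_prob]_x h x = \int[\mu]_x (h x * (f x)%:E))%E.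
Proof.
move=> mh h0.
have dom : pdf_prob `<< (\mu : set (measurableTypeR R) -> \bar R).
  apply/null_content_dominatesP => A mA A0; rewrite pdf_probE.
  apply: null_set_integral => //.
  by apply/measurable_funTS/measurable_EFinP.
rewrite -(@Radon_Nikodym_SigmaFinite.change_of_variables _ _ _ pdf_prob \mu dom h)//.
have IRN := Radon_Nikodym_SigmaFinite.f_integrable dom.
have mRN := measurable_int _ IRN.
apply: ge0_ae_eq_integral => //.
- exact: emeasurable_funM.
- by apply: emeasurable_funM => //; exact/measurable_EFinP.
- by move=> x _; rewrite mule_ge0//; exact: Radon_Nikodym_SigmaFinite.f_ge0.
- by move=> x _; rewrite mule_ge0// lee_fin.
have : ae_eq \mu setT (Radon_Nikodym_SigmaFinite.f pdf_prob \mu) (EFin \o f).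
  apply: integral_ae_eq => //; first exact/measurable_EFinP.
  move=> E _ mE; rewrite -Radon_Nikodym_SigmaFinite.f_integral//.
apply: filterS => x /= H _; by rewrite H.
Qed.

End density_prob.

Definition mkRV (R : realType) d (T : measurableType d) (P : probability T R)
    (h : T -> R) (mh : measurable_fun setT h) : {RV P >-> R} :=
  HB.pack_for {mfun T >-> R} h (isMeasurableFun.Build _ _ _ _ h mh).

(** * Adding one observation to a deconvolution model *)

Section model_extension.
Variables (R : realType) (f g : R -> R) (hf : is_pdf f) (hg : is_pdf g).
Variables (n : nat) (d : measure_display) (T : measurableType d)
  (P : probability T R).

Let U : Type := (measurableTypeR R * measurableTypeR R * T)%type.

Definition extended_prob :
    probability (measurableTypeR R * measurableTypeR R * T)%type R :=
  ((pdf_prob hf \x pdf_prob hg) \x P)%E.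

(** The new variable gets index [ord0] and reads a coordinate of the added pair; the old variable j
    moves to [lift ord0 j] and ignores that pair. This matches prepending the new observation to the
    sample tuple. *)
Definition extend_fun (pr : measurableTypeR R * measurableTypeR R -> R)
    (h : 'I_n -> T -> R) (i : 'I_n.+1)
    (z : measurableTypeR R * measurableTypeR R * T) : R :=
  if unlift ord0 i is Some j then h j z.2 else pr z.1.

Lemma measurable_extend_fun pr (h : 'I_n -> {RV P >-> R}) i :
  measurable_fun setT pr -> measurable_fun setT (extend_fun pr h i).
Proof.
move=> mpr; rewrite /extend_fun; case: unliftP => [j _|_].
  by apply: measurableT_comp => //; exact: measurable_funPT.
exact: measurableT_comp.
Qed.

Definition extend_theta (h : 'I_n -> {RV P >-> R}) i : {RV extended_prob >-> R} :=
  mkRV extended_prob (@measurable_extend_fun fst h i measurable_fst).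

Definition extend_xi (h : 'I_n -> {RV P >-> R}) i : {RV extended_prob >-> R} :=
  mkRV extended_prob (@measurable_extend_fun snd h i measurable_snd).

Lemma extended_probX (A : set (measurableTypeR R * measurableTypeR R)) (B : set T) :
  measurable A -> measurable B ->
  (extended_prob (A `*` B) = (pdf_prob hf \x pdf_prob hg) A * P B)%E.
Proof. by move=> mA mB; rewrite /extended_prob/= product_measure1E. Qed.

Lemma preimage_extend_theta0 (h : 'I_n -> {RV P >-> R}) A :
  extend_theta h ord0 @^-1` A = (A `*` setT) `*` setT.
Proof.
apply/seteqP; split=> [[[x y] z]|[[x y] z] [[]]]; rewrite /= /extend_fun unlift_none//=.
Qed.

Lemma preimage_extend_xi0 (h : 'I_n -> {RV P >-> R}) A :
  extend_xi h ord0 @^-1` A = (setT `*` A) `*` setT.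
Proof.
apply/seteqP; split=> [[[x y] z]|[[x y] z] [[]]]; rewrite /= /extend_fun unlift_none//=.
Qed.

Lemma preimage_extend_thetaS (h : 'I_n -> {RV P >-> R}) j A :
  extend_theta h (lift ord0 j) @^-1` A = setT `*` (h j @^-1` A).
Proof.
by apply/seteqP; split=> [[[x y] z]|[[x y] z] []]; rewrite /= /extend_fun liftK//=.
Qed.

Lemma preimage_extend_xiS (h : 'I_n -> {RV P >-> R}) j A :
  extend_xi h (lift ord0 j) @^-1` A = setT `*` (h j @^-1` A).
Proof.
by apply/seteqP; split=> [[[x y] z]|[[x y] z] []]; rewrite /= /extend_fun liftK//=.
Qed.

Lemma mpre (h : {RV P >-> R}) (A : set R) : measurable A -> measurable (h @^-1` A).
Proof. by move=> mA; rewrite -[X in measurable X]setTI; exact: measurable_funPT. Qed.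

Lemma probXX (A B : set R) : measurable A -> measurable B ->
  ((pdf_prob hf \x pdf_prob hg) (A `*` B) = pdf_prob hf A * pdf_prob hg B)%E.
Proof. by move=> mA mB; rewrite product_measure1E. Qed.

Lemma probT (A : set R) : measurable A ->
  ((pdf_prob hf \x pdf_prob hg) (A `*` setT) = pdf_prob hf A)%E.
Proof. by move=> mA; rewrite product_measure1E// [X in (_ * X)%E]probability_setT mule1. Qed.

Lemma probT2 (A : set R) : measurable A ->
  ((pdf_prob hf \x pdf_prob hg) (setT `*` A) = pdf_prob hg A)%E.
Proof. by move=> mA; rewrite product_measure1E// [X in (X * _)%E]probability_setT mul1e. Qed.

Lemma extended_theta0 (h : 'I_n -> {RV P >-> R}) A : measurable A ->
  extended_prob (extend_theta h ord0 @^-1` A) = pdf_prob hf A.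
Proof.
move=> mA; rewrite preimage_extend_theta0 extended_probX//; last exact: measurableX.
by rewrite probT// [X in (_ * X)%E]probability_setT mule1.
Qed.

Lemma extended_xi0 (h : 'I_n -> {RV P >-> R}) A : measurable A ->
  extended_prob (extend_xi h ord0 @^-1` A) = pdf_prob hg A.
Proof.
move=> mA; rewrite preimage_extend_xi0 extended_probX//; last exact: measurableX.
by rewrite probT2// [X in (_ * X)%E]probability_setT mule1.
Qed.

Lemma extended_setTX (B : set T) : measurable B ->
  extended_prob (setT `*` B) = P B.
Proof.
move=> mB; rewrite extended_probX//.
by rewrite [X in (X * _)%E]probability_setT mul1e.
Qed.

(** An event prescribing all coordinates is a rectangle: the conditions at [ord0] concern the added
    pair and the others the old space. The product measure therefore splits off exactly the two new
    factors. *)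
Lemma extended_deconvolution_model (theta xi : 'I_n -> {RV P >-> R}) :
  deconvolution_model theta xi f g ->
  deconvolution_model (extend_theta theta) (extend_xi xi) f g.
Proof.
move=> [Ht Hx Hi]; split.
- move=> i A mA; have [j ->|->] := unliftP ord0 i; last exact: extended_theta0.
  by rewrite preimage_extend_thetaS extended_setTX ?Ht//; exact: mpre.
- move=> i A mA; have [j ->|->] := unliftP ord0 i; last exact: extended_xi0.
  by rewrite preimage_extend_xiS extended_setTX ?Hx//; exact: mpre.
move=> A B mA mB.
have eA : \bigcap_i (extend_theta theta i @^-1` A i) =
    (extend_theta theta ord0 @^-1` A ord0) `&`
    (\bigcap_j (extend_theta theta (lift ord0 j) @^-1` A (lift ord0 j))).
  apply/seteqP; split=> z; first by move=> H; split=> [|j _]; exact: H.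
  by move=> [H0 H1] i _; have [j ->|->] := unliftP ord0 i; [exact: H1|].
have eB : \bigcap_i (extend_xi xi i @^-1` B i) =
    (extend_xi xi ord0 @^-1` B ord0) `&`
    (\bigcap_j (extend_xi xi (lift ord0 j) @^-1` B (lift ord0 j))).
  apply/seteqP; split=> z; first by move=> H; split=> [|j _]; exact: H.
  by move=> [H0 H1] i _; have [j ->|->] := unliftP ord0 i; [exact: H1|].
have E : (\bigcap_i (extend_theta theta i @^-1` A i)) `&`
    (\bigcap_i (extend_xi xi i @^-1` B i)) =
    (A ord0 `*` B ord0) `*` ((\bigcap_j (theta j @^-1` A (lift ord0 j))) `&`
    (\bigcap_j (xi j @^-1` B (lift ord0 j)))).
  rewrite eA eB preimage_extend_theta0 preimage_extend_xi0.
  under eq_bigcapr do rewrite preimage_extend_thetaS.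
  under [X in _ `&` (_ `&` X)]eq_bigcapr do rewrite preimage_extend_xiS.
  apply/seteqP; split=> [[[x y] z] /=|[[x y] z] /=].
    move=> [[[[Ax _] _] HA] [[[_ By] _] HB]]; split; first by split.
    by split=> j _; [have [] := HA j I|have [] := HB j I].
  move=> [[Ax By] [HA HB]]; split; split=> //.
    by move=> j _; split=> //; exact: HA.
  by move=> j _; split=> //; exact: HB.
have mcap (h : 'I_n -> {RV P >-> R}) (C : 'I_n.+1 -> set R) : (forall i, measurable (C i)) ->
    measurable (\bigcap_j (h j @^-1` C (lift ord0 j))).
  move=> mC; apply: fin_bigcap_measurable => // j _; exact: mpre.
rewrite E extended_probX; last 2 first.
- by apply: measurableX; [exact: mA|exact: mB].
- by apply: measurableI; exact: mcap.
have Hij := Hi (fun j => A (lift ord0 j)) (fun j => B (lift ord0 j))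
  (fun j => mA _) (fun j => mB _).
cbv beta in Hij; rewrite probXX// Hij.
rewrite !big_ord_recl extended_theta0// extended_xi0//.
have eT : (\prod_(j < n) extended_prob (extend_theta theta (lift ord0 j) @^-1` A (lift ord0 j)) =
    \prod_(j < n) P (theta j @^-1` A (lift ord0 j)))%E.
  apply: eq_bigr => j _; rewrite preimage_extend_thetaS extended_setTX//.
  exact: mpre.
have eX : (\prod_(j < n) extended_prob (extend_xi xi (lift ord0 j) @^-1` B (lift ord0 j)) =
    \prod_(j < n) P (xi j @^-1` B (lift ord0 j)))%E.
  apply: eq_bigr => j _; rewrite preimage_extend_xiS extended_setTX//.
  exact: mpre.
rewrite eT eX.
by rewrite muleACA.
Qed.

End model_extension.

(** [p] is a density of theta + xi, expressed through test functions with values in the extended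
    reals, so that it applies directly to partially integrated losses such as [slice]. *)
Definition sum_density (R : realType) (f g : R -> R) (hf : is_pdf f) (hg : is_pdf g)
    (p : R -> R) : Prop :=
  forall F : R -> \bar R, measurable_fun setT F -> (forall y, (0 <= F y)%E) ->
  (\int[pdf_prob hf]_x \int[pdf_prob hg]_y F (x + y)%R =
   \int[\mu]_y (F y * (p y)%:E))%E.

Section two_point.
Variables (R : realType).

Definition observations d (T : measurableType d) (P : probability T R) n
    (theta xi : 'I_n -> {RV P >-> R}) (w : T) : n.-tuple R :=
  [tuple theta i w + xi i w | i < n].

Lemma measurable_observations d (T : measurableType d) (P : probability T R) n
    (theta xi : 'I_n -> {RV P >-> R}) :
  measurable_fun setT (observations theta xi).
Proof.
apply/measurable_fun_tnthP => i /=.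
rewrite (_ : _ \o _ = fun w => theta i w + xi i w); last first.
  by apply/funext => w /=; rewrite tnth_mktuple.
by apply: measurable_funD; exact: measurable_funPT.
Qed.

Section extension.
Variables (f g : R -> R) (hf : is_pdf f) (hg : is_pdf g) (p : R -> R).
Variable fgp : sum_density hf hg p.
Variables (n : nat) (d : measure_display) (T : measurableType d)
  (P : probability T R) (theta xi : 'I_n -> {RV P >-> R}).

(** The conditional expectation of [u] given that the newest observation equals y. *)
Definition slice (u : n.+1.-tuple R -> R) (y : R) : \bar R :=
  (\int[P]_t (u [the n.+1.-tuple R of y :: observations theta xi t])%:E)%E.

Lemma measurable_cons_observations :
  measurable_fun setT (fun z : R * T =>
    [the n.+1.-tuple R of z.1 :: observations theta xi z.2]).
Proof.
apply: measurable_cons => //; apply: measurableT_comp => //.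
exact: measurable_observations.
Qed.

Lemma measurable_slice (u : n.+1.-tuple R -> R) : measurable_fun setT u -> (forall t, 0 <= u t) ->
  measurable_fun setT (slice u).
Proof.
move=> mu u0.
apply: (@measurable_fun_fubini_tonelli_F _ _ R T R P (fun z : R * T =>
  (u [the n.+1.-tuple R of z.1 :: observations theta xi z.2])%:E)).
- by apply/measurable_EFinP; apply: measurableT_comp => //; exact: measurable_cons_observations.
- by move=> z; rewrite lee_fin.
Qed.

Lemma observations_extend z :
  observations (extend_theta hf hg theta) (extend_xi hf hg xi) z =
  [the n.+1.-tuple R of (z.1.1 + z.1.2) :: observations theta xi z.2].
Proof.
apply: eq_from_tnth => i; rewrite tnth_mktuple /= /extend_fun.
case: unliftP => [j ->|->]; last by rewrite tnth0.
by rewrite tnthS tnth_mktuple.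
Qed.

Lemma integral_extended_observations (u : n.+1.-tuple R -> R) :
  measurable_fun setT u -> (forall t, 0 <= u t) ->
  (\int[extended_prob hf hg P]_z
     (u (observations (extend_theta hf hg theta) (extend_xi hf hg xi) z))%:E =
   \int[\mu]_y (slice u y * (p y)%:E))%E.
Proof.
move=> mu u0.
rewrite -(fgp (measurable_slice mu u0)); last first.
  by move=> y; apply: integral_ge0 => t _; rewrite lee_fin.
under eq_integral do rewrite observations_extend.
have msum : measurable_fun setT (fun z : measurableTypeR R * measurableTypeR R => (z.1 + z.2 : R)).
  exact: measurable_funD.
have m3 : measurable_fun setT (fun z : measurableTypeR R * measurableTypeR R * T =>
    (u [the n.+1.-tuple R of (z.1.1 + z.1.2) :: observations theta xi z.2])%:E).
  apply/measurable_EFinP; apply: measurableT_comp => //.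
  apply: measurable_cons; first exact: (measurableT_comp msum measurable_fst).
  by apply: measurableT_comp => //; exact: measurable_observations.
rewrite /extended_prob fubini_tonelli1//; last by move=> z; rewrite lee_fin.
rewrite /fubini_F.
rewrite (@fubini_tonelli1 _ _ _ _ R (pdf_prob hf) (pdf_prob hg)
  (fun z => slice u (z.1 + z.2)))//.
- by apply: measurableT_comp => //; exact: measurable_slice.
- by move=> z; apply: integral_ge0 => t _; rewrite lee_fin.
Qed.

End extension.

(* Le Cam's bound without densities of the sample: the weight [lam] carries the
   likelihood ratio of the observations already integrated out, so that the
   induction on [n] adds one observation at a time. *)
Lemma two_point_models (f0 f1 g p0 p1 : R -> R) (hf0 : is_pdf f0) (hf1 : is_pdf f1)
    (hg : is_pdf g) (k : R) :
  sum_density hf0 hg p0 -> sum_density hf1 hg p1 ->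
  measurable_fun setT p0 -> measurable_fun setT p1 ->
  (forall x, 0 < p0 x) -> (forall x, 0 <= p1 x) ->
  (\int[\mu]_x (p1 x)%:E = 1)%E ->
  (\int[\mu]_x (p1 x ^+ 2 / p0 x)%:E <= k%:E)%E -> 0 <= k ->
  forall n, exists (d0 : measure_display) (T0 : measurableType d0)
    (P0 : probability T0 R) (theta0 xi0 : 'I_n -> {RV P0 >-> R})
    (d1 : measure_display) (T1 : measurableType d1)
    (P1 : probability T1 R) (theta1 xi1 : 'I_n -> {RV P1 >-> R}),
  [/\ deconvolution_model theta0 xi0 f0 g, deconvolution_model theta1 xi1 f1 g &
    forall u v : n.-tuple R -> R, measurable_fun setT u -> measurable_fun setT v ->
    (forall t, 0 <= u t) -> (forall t, 0 <= v t) ->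
    forall A lam : R, 0 <= A -> 0 <= lam -> (forall t, A <= u t + v t) ->
    ((A * lam)%:E <= \int[P0]_w (u (observations theta0 xi0 w))%:E +
       lam%:E * \int[P1]_w (v (observations theta1 xi1 w))%:E +
       (A / 2 * lam ^+ 2 * k ^+ n)%:E)%E].
Proof.
move=> s0 s1 mp0 mp1 p00 p10 Ip1 Ik k0; elim=> [|n].
  have E : 'I_0 -> {RV (\d_tt : probability unit R) >-> R} by case.
  exists _, unit, (\d_tt), E, E, _, unit, (\d_tt), E, E; split.
  - split; [by case|by case|] => A B _ _.
    by rewrite !big_ord0 mule1 (_ : _ `&` _ = setT) ?probability_setT//;
       apply/seteqP; split=> // w _; split; case.
  - split; [by case|by case|] => A B _ _.
    by rewrite !big_ord0 mule1 (_ : _ `&` _ = setT) ?probability_setT//;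
       apply/seteqP; split=> // w _; split; case.
  - move=> u v mu mv u0 v0 A lam A0 lam0 uv.
    rewrite !integral_dirac//= !diracT !mul1e -!EFinM -!EFinD lee_fin expr0 mulr1.
    set t := observations _ _ _; have := uv t; have := u0 t; have := v0 t.
    move: (u t) (v t) => a b b0 a0 ab.
    (* With an empty sample: if lam <= 1 then lam (a + b) <= a + lam b; otherwise A lam - A lam^2 /
       2 <= A / 2 <= a + b. *)
    have [l1|l1] := leP lam 1; last by have := sqr_ge0 (lam - 1); nra.
    have : 0 <= A / 2 * lam ^+ 2 by rewrite mulr_ge0 ?sqr_ge0 ?divr_ge0.
    nra.
move=> [d0 [T0 [P0 [th0 [xi0 [d1 [T1 [P1 [th1 [xi1 [M0 M1 H]]]]]]]]]]].
exists _, _, (extended_prob hf0 hg P0), (extend_theta hf0 hg th0), (extend_xi hf0 hg xi0).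
exists _, _, (extended_prob hf1 hg P1), (extend_theta hf1 hg th1), (extend_xi hf1 hg xi1).
split; [exact: extended_deconvolution_model|exact: extended_deconvolution_model|].
move=> u v mu mv u0 v0 A lam A0 lam0 uv.
rewrite (integral_extended_observations s0)// (integral_extended_observations s1)//.
set F := slice th0 xi0 u; set G := slice th1 xi1 v.
have F0 y : (0 <= F y)%E by apply: integral_ge0 => t _; rewrite lee_fin.
have G0 y : (0 <= G y)%E by apply: integral_ge0 => t _; rewrite lee_fin.
have mF : measurable_fun setT F by exact: measurable_slice.
have mG : measurable_fun setT G by exact: measurable_slice.
pose r y := p1 y ^+ 2 / p0 y.
have r0 y : 0 <= r y by rewrite divr_ge0 ?sqr_ge0 ?ltW.
have mr : measurable_fun setT r.
  apply: measurable_funM; first exact: measurable_funX.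
  have -> : (fun y => (p0 y)^-1) = (fun y => expR (- ln (p0 y))).
    by apply/funext => y; rewrite expRN lnK ?posrE.
  apply: (measurableT_comp (@measurable_expR R)).
  apply: (measurableT_comp (@oppr_measurable R _)).
  exact: (measurableT_comp (@measurable_ln R)).
pose c := A / 2 * lam ^+ 2 * k ^+ n.
have c0 : 0 <= c by rewrite !mulr_ge0 ?sqr_ge0 ?exprn_ge0 ?divr_ge0.
have pointwise y : (((A * lam) * p1 y)%:E <=
    F y * (p0 y)%:E + lam%:E * (G y * (p1 y)%:E) + (c * r y)%:E)%E.
  (* The weight is updated by the likelihood ratio of the observation y. Multiplied by p0(y), the
     quadratic term becomes lam^2 p1^2 / p0, whose integral supplies one more factor k. *)
  pose lam' := lam * p1 y / p0 y.
  have lam'0 : 0 <= lam' by rewrite /lam' divr_ge0 ?mulr_ge0// ltW.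
  have cons_m (w : n.+1.-tuple R -> R) : measurable_fun setT w ->
      measurable_fun setT (fun t : n.-tuple R => w [the n.+1.-tuple R of y :: t]).
    by move=> mw; apply: measurableT_comp => //; exact: measurable_cons.
  have := H (fun t => u [the n.+1.-tuple R of y :: t]) (fun t => v [the n.+1.-tuple R of y :: t])
    (cons_m u mu) (cons_m v mv) (fun t => u0 _) (fun t => v0 _) A lam' A0 lam'0 (fun t => uv _).
  rewrite -/(F y) -/(G y) => Hy.
  have p0y : (0 <= (p0 y)%:E)%E by rewrite lee_fin ltW.
  have pn : p0 y != 0 by rewrite gt_eqF.
  have cc0 : 0 <= A / 2 * lam' ^+ 2 * k ^+ n.
    by rewrite !mulr_ge0 ?invr_ge0 ?exprn_ge0.
  have lG0 : (0 <= lam'%:E * G y)%E by rewrite mule_ge0// lee_fin.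
  have cE0 : (0 <= (A / 2 * lam' ^+ 2 * k ^+ n)%:E)%E by rewrite lee_fin.
  have lp : lam' * p0 y = lam * p1 y by rewrite /lam'; field.
  have -> : (F y * (p0 y)%:E + lam%:E * (G y * (p1 y)%:E) + (c * r y)%:E =
      (F y + lam'%:E * G y + (A / 2 * lam' ^+ 2 * k ^+ n)%:E) * (p0 y)%:E)%E.
    rewrite (ge0_muleDl _ (adde_ge0 (F0 y) lG0) cE0) (ge0_muleDl _ (F0 y) lG0).
    congr (_ + _ + _)%E; first by rewrite muleAC -EFinM lp EFinM -muleA (muleC (G y)).
    by rewrite -EFinM; congr EFin; rewrite /lam' /c /r; field.
  have -> : (A * lam * p1 y)%:E = ((A * lam')%:E * (p0 y)%:E)%E.
    by rewrite -EFinM; congr EFin; rewrite -[in RHS]mulrA lp mulrA.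
  exact: lee_wpmul2r.
have m1 : measurable_fun setT (fun y => F y * (p0 y)%:E)%E.
  by apply: emeasurable_funM => //; exact/measurable_EFinP.
have m2 : measurable_fun setT (fun y => G y * (p1 y)%:E)%E.
  by apply: emeasurable_funM => //; exact/measurable_EFinP.
have -> : (A * lam)%:E = (\int[\mu]_y ((A * lam) * p1 y)%:E)%E.
  under eq_integral do rewrite EFinM.
  rewrite ge0_integralZl// ?Ip1 ?mule1//; first exact/measurable_EFinP.
  - by move=> y _; rewrite lee_fin.
  - by rewrite lee_fin mulr_ge0.
apply: (@le_trans _ _
  (\int[\mu]_y (F y * (p0 y)%:E + lam%:E * (G y * (p1 y)%:E) + (c * r y)%:E))%E).
  apply: ge0_le_integral => //.
  - by move=> y _; rewrite lee_fin !mulr_ge0.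
  - by apply/measurable_EFinP; exact: measurable_funM.
  - apply: emeasurable_funD; last by apply/measurable_EFinP; exact: measurable_funM.
    by apply: emeasurable_funD => //; exact: emeasurable_funM.
rewrite ge0_integralD//; last 4 first.
- by move=> y _; rewrite adde_ge0 ?mule_ge0 ?lee_fin// ltW.
- by apply: emeasurable_funD => //; exact: emeasurable_funM.
- by move=> y _; rewrite lee_fin mulr_ge0.
- by apply/measurable_EFinP; exact: measurable_funM.
rewrite ge0_integralD//; last 3 first.
- by move=> y _; rewrite mule_ge0// lee_fin ltW.
- by move=> y _; rewrite !mule_ge0// lee_fin.
- exact: emeasurable_funM.
rewrite ge0_integralZl//; last first.
- by move=> y _; rewrite mule_ge0// lee_fin.
apply: leeD => //.
under eq_integral do rewrite EFinM.
rewrite ge0_integralZl//; last 2 first.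
- exact/measurable_EFinP.
- by move=> y _; rewrite lee_fin.
rewrite (_ : A / 2 * lam ^+ 2 * k ^+ n.+1 = c * k); last by rewrite /c [k ^+ _]exprSr mulrA.
by rewrite [leRHS]EFinM; apply: lee_wpmul2l => //; rewrite lee_fin.
Qed.

End two_point.

(** * The density of an observation *)

Section convolution_density.
Variable R : realType.
Local Notation I f := (Rintegral \mu setT f).

Lemma pdf_L1 (f : R -> R) : is_pdf f -> L1 f.
Proof. by move=> [mf f0 f1]; apply: L1_ge0 => //; rewrite f1 ltry. Qed.

Lemma pdf_I (f : R -> R) : is_pdf f -> I f = 1.
Proof. by move=> [mf f0 f1]; rewrite /Rintegral f1. Qed.

Lemma is_pdfP (f : R -> R) : L1 f -> (forall x, 0 <= f x) -> I f = 1 -> is_pdf f.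
Proof.
by move=> If f0 f1; split=> //; [exact: L1_measurable|rewrite L1_EFin// f1].
Qed.

Definition convolution (f g : R -> R) (x : R) : R := I (fun y => g y * f (x - y)).

(** Tonelli, a translation of the inner variable, and Tonelli back. The bound on [f] ensures that
    the convolution is a convergent integral at every point. *)
Lemma convolution_sum_density (f g : R -> R) (hf : is_pdf f) (hg : is_pdf g) (A : R) :
  (forall x, `|f x| <= A) -> sum_density hf hg (convolution f g).
Proof.
move=> fA F mF F0.
have If := pdf_L1 hf; have Ig := pdf_L1 hg.
have mf := L1_measurable If; have mg := L1_measurable Ig.
have f0 x : 0 <= f x by case: hf.
have g0 x : 0 <= g x by case: hg.
have ms x : measurable_fun setT (fun y : R => F (x + y)).
  by apply: measurableT_comp => //; exact: measurable_funD.
have mpair : measurable_fun setT (fun z : R * R => F (z.1 + z.2)).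
  by apply: measurableT_comp => //; exact: measurable_funD.
have mG : measurable_fun setT (fun x : R => (\int[pdf_prob hg]_y F (x + y)%R)%E).
  by apply: (@measurable_fun_fubini_tonelli_F _ _ R (measurableTypeR R) R (pdf_prob hg)
    (fun z => F (z.1 + z.2))).
rewrite pdf_prob_integral//; last by move=> x; exact: integral_ge0.
pose H (z : measurableTypeR R * measurableTypeR R) := (F (z.1 + z.2)%R * (g z.2 * f z.1)%:E)%E.
have mH : measurable_fun setT H.
  apply: emeasurable_funM => //.
  apply/measurable_EFinP; apply: measurable_funM; exact: measurableT_comp.
have H0 z : (0 <= H z)%E by rewrite mule_ge0// lee_fin mulr_ge0.
transitivity (\int[\mu]_x \int[\mu]_y H (x, y))%E.
  apply: eq_integral => x _; rewrite pdf_prob_integral//.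
  rewrite -ge0_integralZr//; last 3 first.
  - by apply: emeasurable_funM; [exact: ms|exact/measurable_EFinP].
  - by move=> y _; rewrite mule_ge0// lee_fin.
  - by rewrite lee_fin.
  by apply: eq_integral => y _; rewrite /H/= EFinM muleA.
rewrite (@fubini_tonelli _ _ _ _ R \mu \mu H mH H0).
pose H' (z : measurableTypeR R * measurableTypeR R) := (F z.1 * (g z.2 * f (z.1 - z.2))%:E)%E.
have mH' : measurable_fun setT H'.
  apply: emeasurable_funM; first exact: measurableT_comp.
  apply/measurable_EFinP; apply: measurable_funM; apply: measurableT_comp => //.
  exact: measurable_funB.
have H'0 z : (0 <= H' z)%E by rewrite mule_ge0// lee_fin mulr_ge0.
transitivity (\int[\mu]_y \int[\mu]_x H' (x, y))%E.
  apply: eq_integral => y _.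
  rewrite -(@ge0_integral_shift _ y (fun x => H' (x, y))).
  - by apply: eq_integral => x _; rewrite /H /H'/= addrK.
  - by apply: measurableT_comp => //; exact: pair2_measurable.
  - by move=> x; exact: H'0.
rewrite -(@fubini_tonelli _ _ _ _ R \mu \mu H' mH' H'0).
apply: eq_integral => x _.
have Ic := L1_convolution_pointwise x If Ig fA.
rewrite /convolution -L1_EFin// -ge0_integralZl//.
- by apply/measurable_EFinP; exact: L1_measurable.
- by move=> y _; rewrite lee_fin mulr_ge0.
Qed.

Lemma convolution_pdf (f g : R -> R) (A : R) : is_pdf f -> is_pdf g ->
  (forall x, `|f x| <= A) -> is_pdf (convolution f g).
Proof.
move=> hf hg fA; have [J E] := convolution_L1 (pdf_L1 hf) (pdf_L1 hg) fA.
apply: is_pdfP => //; last by rewrite E !pdf_I// mulr1.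
by move=> x; apply: I_ge0 => y; rewrite mulr_ge0//; [case: hg|case: hf].
Qed.

End convolution_density.

(** [two_point_models] is taken with lam = 1 and A half the squared separation. As k^n <= 3/2, it
    gives A <= 2 sup + 3A/4, so the worst risk is at least A/8, a sixteenth of the squared
    separation. *)
Lemma minimax_risk_two_points (R : realType) (phi g f0 f1 p0 p1 : R -> R)
    (S : set (R -> R)) (n : nat) (k : R)
    (hf0 : is_pdf f0) (hf1 : is_pdf f1) (hg : is_pdf g) :
  S f0 -> S f1 ->
  sum_density hf0 hg p0 -> sum_density hf1 hg p1 ->
  measurable_fun setT p0 -> is_pdf p1 -> (forall x, 0 < p0 x) ->
  (\int[\mu]_x (p1 x ^+ 2 / p0 x)%:E <= k%:E)%E -> 0 <= k -> k ^+ n <= 3 / 2 ->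
  (((Phi phi f1 - Phi phi f0) ^+ 2 / 16)%:E <= minimax_risk phi g S n)%E.
Proof.
move=> S0 S1 s0 s1 mp0 [mp1 p10 Ip1] p00 Ik k0 kn.
have [d0 [T0 [P0 [th0 [xi0 [d1 [T1 [P1 [th1 [xi1 [M0 M1 H]]]]]]]]]]] :=
  two_point_models s0 s1 mp0 mp1 p00 p10 Ip1 Ik k0 n.
apply: le_ereal_inf_tmp => _ [Phit mPhit <-].
set Phi0 := Phi phi f0; set Phi1 := Phi phi f1.
pose u t := (Phit t - Phi0) ^+ 2; pose v t := (Phit t - Phi1) ^+ 2.
have mu : measurable_fun setT u by apply: measurable_funX; exact: measurable_funB.
have mv : measurable_fun setT v by apply: measurable_funX; exact: measurable_funB.
pose A := (Phi1 - Phi0) ^+ 2 / 2.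
have A0 : 0 <= A by rewrite divr_ge0 ?sqr_ge0.
have uv t : A <= u t + v t.
  by rewrite /A /u /v; have := sqr_ge0 (2 * Phit t - Phi0 - Phi1); nra.
have := H u v mu mv (fun t => sqr_ge0 _) (fun t => sqr_ge0 _) A 1 A0 ler01 uv.
rewrite mulr1 mul1e expr1n mulr1.
set r0 := (\int[P0]_w _)%E; set r1 := (\int[P1]_w _)%E => Hle.
set sup := ereal_sup _.
have r0sup : (r0 <= sup)%E.
  apply: ereal_sup_ubound; exists f0; split=> //.
  exists d0, T0, P0, th0, xi0; split=> //.
  by rewrite unlock.
have r1sup : (r1 <= sup)%E.
  apply: ereal_sup_ubound; exists f1; split=> //.
  exists d1, T1, P1, th1, xi1; split=> //.
  by rewrite unlock.
have : (A%:E <= sup + sup + (A / 2 * k ^+ n)%:E)%E.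
  by apply: (le_trans Hle); rewrite leeD2r// leeD.
move: sup r0sup r1sup => [sup| |] _ _; rewrite ?leey//=.
rewrite -!EFinD !lee_fin => Hs.
have : A / 2 * k ^+ n <= A / 2 * (3 / 2) by rewrite ler_wpM2l// divr_ge0.
by rewrite /A in Hs *; lra.
Qed.

(** * Band-limited perturbations of a Cauchy density *)

Section sobolev_class.
Variable R : realType.
Implicit Types f g v : R -> R.
Local Notation I f := (Rintegral \mu setT f).

Lemma fourierE f w : fourier f w = Complex (Cf f w) (Sf f w).
Proof.
rewrite /fourier /cintegral; congr Complex; apply: eqI => x /=; ring.
Qed.

Lemma normc_fourier_sqr f w : normc (fourier f w) ^+ 2 = power_spectrum f w.
Proof. by rewrite fourierE /= sqr_sqrtr// power_spectrum_ge0. Qed.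

Lemma power_spectrumD f g w : L1 f -> L1 g ->
  power_spectrum (fun x => f x + g x) w <= 2 * power_spectrum f w + 2 * power_spectrum g w.
Proof.
move=> If Ig; rewrite /power_spectrum.
have -> : Cf (fun x => f x + g x) w = Cf f w + Cf g w.
  rewrite /Cf -(ID (L1_cos_mul w If) (L1_cos_mul w Ig)).
  by apply: eqI => x; rewrite mulrDr.
have -> : Sf (fun x => f x + g x) w = Sf f w + Sf g w.
  rewrite /Sf -(ID (L1_sin_mul w If) (L1_sin_mul w Ig)).
  by apply: eqI => x; rewrite mulrDr.
have := sqr_ge0 (Cf f w - Cf g w); have := sqr_ge0 (Sf f w - Sf g w); nra.
Qed.

Lemma power_spectrumZ c f w : L1 f ->
  power_spectrum (fun x => c * f x) w = c ^+ 2 * power_spectrum f w.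
Proof.
move=> If; rewrite /power_spectrum.
have -> : Cf (fun x => c * f x) w = c * Cf f w.
  rewrite /Cf -(IZ _ (L1_cos_mul w If)).
  by apply: eqI => x; rewrite mulrCA.
have -> : Sf (fun x => c * f x) w = c * Sf f w.
  rewrite /Sf -(IZ _ (L1_sin_mul w If)).
  by apply: eqI => x; rewrite mulrCA.
by ring.
Qed.

Definition sobolev_weight (s w : R) : R := (w ^+ 2 + 1) `^ s.

Lemma sobolev_weight_ge0 s w : 0 <= sobolev_weight s w.
Proof. exact: powR_ge0. Qed.

Lemma measurable_sobolev_weight s : measurable_fun setT (sobolev_weight s).
Proof.
apply: (measurableT_comp (@measurable_powR R s)).
by apply: measurable_funD => //; exact: measurable_funX.
Qed.

(** With |w| = m y the weight is at most (m (1 + y))^(2s), and (1 + y)^k <= k^k exp(y) follows from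
    1 + y <= k (1 + y/k) <= k exp(y/k). The constant depends on s alone, which lets m grow later. *)
Lemma sobolev_weight_le s : 0 <= s -> exists C, 1 <= C /\ forall m w, 1 <= m ->
  sobolev_weight s w <= C * m `^ (2 * s) * expR (`|w| / m).
Proof.
move=> s0; pose k := (Num.truncn (2 * s)).+1.
have sk : 2 * s <= k%:R.
  by rewrite ltW// /k truncnS_gt.
have k0 : (0 : R) < k%:R by rewrite ltr0n.
have k1 : (1 : R) <= k%:R by rewrite ler1n.
exists (k%:R ^+ k); split; first exact: exprn_ege1.
move=> m w m1; have m0 : 0 < m by rewrite (lt_le_trans ltr01).
pose y := `|w| / m.
have y0 : 0 <= y by rewrite divr_ge0// ltW.
have wy : `|w| = m * y by rewrite /y mulrC divfK// gt_eqF.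
have h1 : w ^+ 2 + 1 <= (m * (1 + y)) ^+ 2.
  rewrite -(real_normK (num_real w)) wy; have : 1 <= m ^+ 2 by exact: exprn_ege1.
  by have := sqr_ge0 m; nra.
have h2 : (1 + y) ^+ k <= k%:R ^+ k * expR y.
  apply: (@le_trans _ _ ((k%:R * expR (y / k%:R)) ^+ k)).
    rewrite lerXn2r ?nnegrE ?mulr_ge0 ?expR_ge0 ?addr_ge0//.
    apply: (@le_trans _ _ (k%:R * (1 + y / k%:R))).
      by rewrite mulrDr mulr1 mulrCA divff ?mulr1 ?gt_eqF// lerD2r.
    by rewrite ler_wpM2l ?(ltW k0)// expR_ge1Dx.
  by rewrite exprMn -expRM_natl [_ * (y / _)]mulrC divfK// gt_eqF.
rewrite /sobolev_weight.
apply: (@le_trans _ _ (((m * (1 + y)) ^+ 2) `^ s)).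
  by apply: ge0_ler_powR => //; rewrite nnegrE ?addr_ge0 ?sqr_ge0.
have my0 : 0 <= m * (1 + y) by rewrite mulr_ge0 ?addr_ge0// ltW.
rewrite -powR_mulrn// -powRrM powRM ?addr_ge0 ?(ltW m0)//.
rewrite (mulrC (k%:R ^+ k)) -mulrA ler_wpM2l ?powR_ge0//.
apply: le_trans h2; rewrite -powR_mulrn ?addr_ge0//.
by apply: ler_powR; rewrite ?lerDl.
Qed.

Definition sobolev_integral s f : \bar R :=
  (\int[\mu]_w (normc (fourier f w) ^+ 2 * (w ^+ 2 + 1) `^ s)%:E)%E.

Lemma sobolev_integral_le s f (h : R -> R) (M : R) : L1 f -> L1 h ->
  (forall w, power_spectrum f w * sobolev_weight s w <= h w) -> I h <= M ->
  (sobolev_integral s f <= M%:E)%E.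
Proof.
move=> If Ih fh hM.
apply: (@le_trans _ _ (\int[\mu]_w (h w)%:E)%E); last by rewrite L1_EFin// lee_fin.
apply: ge0_le_integral => //.
- by move=> w _; rewrite lee_fin mulr_ge0 ?sqr_ge0 ?powR_ge0.
- apply/measurable_EFinP; apply: measurable_funM; last exact: measurable_sobolev_weight.
  rewrite (_ : (fun w => _) = power_spectrum f); first exact: measurable_power_spectrum.
  by apply/funext => w; exact: normc_fourier_sqr.
- by apply/measurable_EFinP; exact: L1_measurable.
- by move=> w _; rewrite lee_fin normc_fourier_sqr.
Qed.

Definition cauchy_pdf (h x : R) : R := (2 * pi)^-1 * q h x.

Lemma is_pdf_cauchy h : 0 < h -> is_pdf (cauchy_pdf h).
Proof.
move=> h0; have pi0 : (pi : R) != 0 by rewrite gt_eqF// pi_gt0.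
apply: is_pdfP; first exact: (L1Z _ (L1_q h0)).
  by move=> x; rewrite mulr_ge0 ?q_ge0// invr_ge0 mulr_ge0// pi_ge0.
rewrite (IZ _ (L1_q h0)) I_q// mulVf//.
by rewrite mulf_neq0.
Qed.

Lemma power_spectrum_cauchy h w : 0 < h ->
  power_spectrum (cauchy_pdf h) w = expR (- (2 * h) * `|w|).
Proof.
move=> h0; have pi0 : (pi : R) != 0 by rewrite gt_eqF// pi_gt0.
rewrite power_spectrumZ; last exact: L1_q.
rewrite /power_spectrum Sf_q// Cf_q//.
have -> : - (2 * h) * `|w| = (- h * `|w|) + (- h * `|w|) by ring.
rewrite expRD; move: (expR _) pi0; move: (pi : R) => p E p0.
by field.
Qed.

(** A Cauchy density of large scale has its transform concentrated near 0, so its Sobolev integral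
    can be made arbitrarily small although the transform equals 1 at 0. *)
Lemma cauchy_sobolev s (B : R) : 0 <= s -> 0 < B -> exists h, 1 <= h /\ exists Q : R -> R,
  [/\ L1 Q, (forall w, 0 <= Q w),
   (forall w, power_spectrum (cauchy_pdf h) w * sobolev_weight s w <= Q w) & I Q <= B].
Proof.
move=> s0 B0; have [C [C1 HC]] := sobolev_weight_le s0.
have C0 : 0 < C by rewrite (lt_le_trans ltr01).
(* Twice the scale is 1 + e: the 1 pays for the exponential in the bound on the weight, and the
   remaining integral 2C/e is at most B. *)
pose e := 1 + 2 * C / B.
have e1 : 1 < e by rewrite ltrDl divr_gt0// mulr_gt0.
have e0 : 0 < e by rewrite (lt_trans ltr01).
have h1 : 1 <= (1 + e) / 2 by lra.
have h0 : 0 < (1 + e) / 2 by lra.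
exists ((1 + e) / 2); split=> //; exists (fun w => C * expR (- e * `|w|)); split.
- exact: (L1Z _ (L1_expabs e0)).
- by move=> w; rewrite mulr_ge0 ?expR_ge0// ltW.
- move=> w; rewrite power_spectrum_cauchy//.
  have := HC 1 w (lexx _); rewrite powR1 mulr1 divr1 => HCw.
  have -> : - (2 * ((1 + e) / 2)) * `|w| = - e * `|w| - `|w| by field.
  rewrite expRD; apply: (@le_trans _ _ (expR (- e * `|w|) * expR (- `|w|) * (C * expR `|w|))).
    by rewrite ler_wpM2l// mulr_ge0 ?expR_ge0.
  have -> : expR (- e * `|w|) * expR (- `|w|) * (C * expR `|w|) =
     C * expR (- e * `|w|) * (expR (- `|w|) * expR `|w|) by ring.
  by rewrite -expRD addNr expR0 mulr1.
- rewrite (IZ _ (L1_expabs e0)) I_expabs// mulrA ler_pdivrMr//.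
  have -> : B * e = B + 2 * C by rewrite /e; field; rewrite gt_eqF.
  by lra.
Qed.

(** For h >= 1, h^2 + (x - y)^2 <= 2 h^2 (1 + x^2)(1 + y^2), which separates x from y under the
    integral. What remains is the integral of g against the positive function [q 1]; it could vanish
    only if g did almost everywhere. *)
Lemma convolution_cauchy_ge (h : R) g : 1 <= h -> is_pdf g -> exists c, 0 < c /\
  forall x, c / (1 + x ^+ 2) <= convolution (cauchy_pdf h) g x.
Proof.
move=> h1 hg; have h0 : 0 < h by rewrite (lt_le_trans ltr01).
have Ig := pdf_L1 hg; have g0 x : 0 <= g x by case: hg.
have mg := L1_measurable Ig.
have mq := measurable_q h0.
pose J := I (fun y => g y * q 1 y).
have IJ : L1 (fun y => g y * q 1 y).
  apply: L1_mulC; apply: (L1_mul_bounded _ (norm_q_le (@ltr01 R)) Ig).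
  exact: measurable_q.
have J0 : 0 < J.
  rewrite lt0r (I_ge0 (f := fun y => g y * q 1 y)) ?andbT; last first.
    by move=> y; rewrite mulr_ge0 ?q_ge0.
  apply/negP => /eqP J0.
  have : (\int[\mu]_y `|(g y * q 1 y)%:E| = 0)%E.
    transitivity (\int[\mu]_y (g y * q 1 y)%:E)%E.
      apply: eq_integral => y _; rewrite gee0_abs// lee_fin mulr_ge0//.
      exact: q_ge0.
    by rewrite L1_EFin// -/J J0.
  have mgq : measurable_fun setT (fun y => (g y * q 1 y)%:E).
    by apply/measurable_EFinP; exact: L1_measurable.
  move=> /(ae_eq_integral_abs \mu measurableT mgq) gq0.
  have : (\int[\mu]_y (g y)%:E = 0)%E.
    rewrite (ae_eq_integral (cst 0)%E) ?integral0//.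
      exact/measurable_EFinP.
    apply: filterS gq0 => y /(_ Logic.I) [] /eqP.
    by rewrite mulf_eq0 (gt_eqF (q_gt0 y (@ltr01 R))) orbF => /eqP -> _.
  by case: hg => _ _ ->; move/eqP; rewrite eqe oner_eq0.
have pi0 : 0 < (2 * pi : R)^-1 by rewrite invr_gt0 mulr_gt0// pi_gt0.
exists ((2 * pi)^-1 * ((2 * h)^-1 * J)); split.
  by rewrite !mulr_gt0// invr_gt0 mulr_gt0.
move=> x; have p0 : 0 < 1 + x ^+ 2 by rewrite ltr_wpDr ?sqr_ge0.
have qB z : `|cauchy_pdf h z| <= (2 * pi)^-1 * (2 / h).
  by rewrite /cauchy_pdf normrM (gtr0_norm pi0) ler_wpM2l ?(ltW pi0)// norm_q_le.
have [hc _ _] := is_pdf_cauchy h0.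
have Iq := pdf_L1 (is_pdf_cauchy h0).
have -> : (2 * pi)^-1 * ((2 * h)^-1 * J) / (1 + x ^+ 2) =
    I (fun y => ((2 * pi)^-1 * ((2 * h)^-1 / (1 + x ^+ 2))) * (g y * q 1 y)).
  by rewrite (IZ _ IJ) -/J; move: (2 * pi)^-1 => P; ring.
apply: I_le.
- exact: (L1Z _ IJ).
- exact: L1_convolution_pointwise Iq Ig qB.
move=> y; rewrite /cauchy_pdf [leRHS]mulrCA -mulrA ler_wpM2l ?(ltW pi0)//.
rewrite mulrCA ler_wpM2l// /q expr1n.
have y0 : 0 < 1 + y ^+ 2 by rewrite ltr_wpDr ?sqr_ge0.
have -> : (2 * h)^-1 / (1 + x ^+ 2) * (2 * 1 / (1 + y ^+ 2)) =
    2 * h / (2 * (h ^+ 2 * ((1 + x ^+ 2) * (1 + y ^+ 2)))).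
  by field; rewrite !gt_eqF.
rewrite ler_wpM2l ?mulr_ge0 ?(ltW h0)// lef_pV2 ?posrE ?mulr_gt0 ?exprn_gt0 ?q_den_gt0//.
have h2 : 1 <= h ^+ 2 by exact: exprn_ege1.
have e1 : (x - y) ^+ 2 <= 2 * (x ^+ 2 + y ^+ 2) by have := sqr_ge0 (x + y); nra.
have := sqr_ge0 x; have := sqr_ge0 y; move: (x ^+ 2) (y ^+ 2) e1 h2 => X Y e1 h2 Y0 X0.
have : 0 <= h ^+ 2 * (X * Y) by apply: mulr_ge0; [exact: sqr_ge0|exact: mulr_ge0].
nra.
Qed.

End sobolev_class.

(** * Products, twists and Poisson majorants *)

Section perturbation.
Variable R : realType.
Implicit Types f g v : R -> R.
Local Notation I f := (Rintegral \mu setT f).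

Lemma sl_L_ge0 v (l w A L : R) : supported_lipschitz v l w A L -> 0 <= L.
Proof.
move=> H; have := sl_lipschitz H 1 0; rewrite subr0 normr1 mulr1.
exact: le_trans.
Qed.

(** The factor [p] is controlled on the support interval only. When y lies outside it, v(y) = 0, so
    |v(x)| <= L |x - y| already provides the Lipschitz bound. *)
Lemma sl_mul v (p : R -> R) (l w A L B M : R) : supported_lipschitz v l w A L ->
  (forall x, l <= x <= l + w -> `|p x| <= B) ->
  (forall x y, l <= x <= l + w -> l <= y <= l + w -> `|p x - p y| <= M * `|x - y|) ->
  supported_lipschitz (fun x => v x * p x) l w (A * B) (L * B + A * M).
Proof.
move=> H pB pM.
have A0 := sl_A_ge0 H; have L0 := sl_L_ge0 H; have w0 := sl_width H.
have lin : l <= l <= l + w by rewrite lexx lerDl ltW.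
have B0 : 0 <= B by exact: le_trans (normr_ge0 _) (pB l lin).
have M0 : 0 <= M.
  have rin : l <= l + w <= l + w by rewrite lexx lerDl ltW.
  have := pM _ _ lin rin; rewrite opprD addrA subrr sub0r normrN (gtr0_norm w0).
  by move/(le_trans (normr_ge0 _)); rewrite pmulr_lge0.
have one x y : l <= x <= l + w -> ~~ (l <= y <= l + w) ->
    `|v x * p x - v y * p y| <= (L * B + A * M) * `|x - y|.
  move=> xin yout; rewrite (sl_support H yout) mul0r subr0 normrM.
  apply: (@le_trans _ _ (L * `|x - y| * B)).
    rewrite ler_pM ?pB// (le_trans _ (sl_lipschitz H x y))//.
    by rewrite (sl_support H yout) subr0.
  by rewrite mulrAC ler_wpM2r// lerDl mulr_ge0.
split=> //.
- by move=> x /(sl_support H) ->; rewrite mul0r.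
- move=> x; have [xin|xout] := boolP (l <= x <= l + w).
    by rewrite normrM ler_pM ?(sl_bound H) ?pB.
  by rewrite (sl_support H xout) mul0r normr0 mulr_ge0.
- move=> x y; have [xin|xout] := boolP (l <= x <= l + w); last first.
    have [yin|yout] := boolP (l <= y <= l + w).
      by rewrite distrC (distrC x y) one.
    rewrite (sl_support H xout) (sl_support H yout) !mul0r subrr normr0.
    by rewrite mulr_ge0// addr_ge0 ?mulr_ge0.
  have [yin|yout] := boolP (l <= y <= l + w); last exact: one.
  have -> : v x * p x - v y * p y = (v x - v y) * p x + v y * (p x - p y) by ring.
  rewrite (le_trans (ler_normD _ _))// !normrM mulrDl lerD//.
    by rewrite (mulrAC L) ler_pM ?(sl_lipschitz H) ?pB.
  by rewrite -mulrA ler_pM ?(sl_bound H) ?pM.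
Qed.

Lemma slD v1 v2 (l w A1 L1' A2 L2 : R) : supported_lipschitz v1 l w A1 L1' ->
  supported_lipschitz v2 l w A2 L2 ->
  supported_lipschitz (fun x => v1 x + v2 x) l w (A1 + A2) (L1' + L2).
Proof.
move=> H1 H2; split; first exact: sl_width H1.
- by move=> x xo; rewrite (sl_support H1 xo) (sl_support H2 xo) addr0.
- by move=> x; rewrite (le_trans (ler_normD _ _))// lerD ?(sl_bound H1) ?(sl_bound H2).
- move=> x y; rewrite opprD addrACA (le_trans (ler_normD _ _))// mulrDl.
  by rewrite lerD ?(sl_lipschitz H1) ?(sl_lipschitz H2).
Qed.

Lemma slN v (l w A L : R) : supported_lipschitz v l w A L ->
  supported_lipschitz (fun x => - v x) l w A L.
Proof.
move=> H; split; first exact: sl_width H.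
- by move=> x xo; rewrite (sl_support H xo) oppr0.
- by move=> x; rewrite normrN (sl_bound H).
- by move=> x y; rewrite -opprD normrN (sl_lipschitz H).
Qed.

Lemma sl_le v (l w A L A' L' : R) : supported_lipschitz v l w A L -> A <= A' -> L <= L' ->
  supported_lipschitz v l w A' L'.
Proof.
move=> H AA LL; split; [exact: sl_width H|exact: sl_support H| |].
- by move=> x; rewrite (le_trans (sl_bound H x)).
- by move=> x y; rewrite (le_trans (sl_lipschitz H x y))// ler_wpM2r.
Qed.

Lemma sl_bounded_lipschitz v (l w A L : R) : supported_lipschitz v l w A L ->
  bounded_lipschitz v.
Proof. by move=> H; exists A, L; split; [exact: sl_bound H|exact: sl_lipschitz H]. Qed.

(** On [m, 2m] the factor exp(x/m) is at most e^2 and has Lipschitz constant e^2/m, so undoing a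
    Poisson damping of scale 1/m costs a constant independent of m. *)
Lemma sl_exp_twist v (m w A L : R) : 1 <= m -> w <= m -> supported_lipschitz v m w A L ->
  supported_lipschitz (fun x => v x * expR (x / m)) m w (A * expR 2) (expR 2 * (A + L)).
Proof.
move=> m1 wm H; have m0 : 0 < m by rewrite (lt_le_trans ltr01).
have A0 := sl_A_ge0 H.
have xm x : m <= x <= m + w -> 0 <= x / m <= 2.
  move=> /andP[mx xw]; apply/andP; split; last by rewrite ler_pdivrMr//; lra.
  by rewrite divr_ge0//; lra.
apply: (sl_le (@sl_mul v (fun x => expR (x / m)) m w A L (expR 2) (expR 2 / m) H _ _)) => //.
- by move=> x /xm/andP[_ x2]; rewrite ger0_norm ?expR_ge0// ler_expR.
- move=> x y xin yin; have [/andP[x0 x2] /andP[y0 y2]] := (xm x xin, xm y yin).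
  have -> : expR (x / m) - expR (y / m) =
      expR 2 * (expR (- (2 - x / m)) - expR (- (2 - y / m))).
    by rewrite mulrBr -!expRD; congr (expR _ - expR _); ring.
  rewrite normrM (ger0_norm (expR_ge0 _)) -mulrA ler_wpM2l ?expR_ge0//.
  rewrite (le_trans (expR_lipschitz _ _)) ?subr_ge0//.
  have -> : 2 - x / m - (2 - y / m) = - (m^-1 * (x - y)) by ring.
  by rewrite normrN normrM (gtr0_norm (_ : 0 < m^-1))// invr_gt0.
- rewrite mulrDr addrC mulrCA mulrC (mulrC L) lerD2r.
  by rewrite mulrC ler_wpM2l ?expR_ge0// ler_piMr// invf_le1.
Qed.

Lemma poisson_ge_norm (h : R) (b : R -> R) (x : R) : 0 < h -> L1 b ->
  `|poisson h b x| <= poisson h (fun y => `|b y|) x.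
Proof.
move=> h0 Ib; rewrite /poisson.
have p0 : 0 <= (2 * pi : R)^-1 by rewrite invr_ge0 mulr_ge0// pi_ge0.
rewrite normrM (ger0_norm p0) ler_wpM2l//.
apply: norm_I_le.
- exact: L1_convolution_pointwise (L1_q h0) Ib (norm_q_le h0).
- exact: L1_convolution_pointwise (L1_q h0) (L1_norm Ib) (norm_q_le h0).
- by move=> y; rewrite normrM (ger0_norm (q_ge0 (x - y) h0)).
Qed.

Lemma poisson_ge0 (h : R) (b : R -> R) (x : R) : 0 < h -> (forall y, 0 <= b y) ->
  0 <= poisson h b x.
Proof.
move=> h0 b0; rewrite /poisson mulr_ge0 ?invr_ge0 ?mulr_ge0 ?pi_ge0//.
by apply: I_ge0 => y; rewrite mulr_ge0// q_ge0.
Qed.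

Lemma poisson_le (h : R) (b : R -> R) (x : R) : 0 < h -> L1 b ->
  `|poisson h b x| <= (2 * pi)^-1 * (2 / h * I (fun y => `|b y|)).
Proof.
move=> h0 Ib; rewrite (le_trans (poisson_ge_norm x h0 Ib))// /poisson.
rewrite ler_wpM2l ?invr_ge0 ?mulr_ge0 ?pi_ge0// -(IZ _ (L1_norm Ib)).
apply: I_le.
- exact: L1_convolution_pointwise (L1_q h0) (L1_norm Ib) (norm_q_le h0).
- exact: (L1Z _ (L1_norm Ib)).
- by move=> y; rewrite mulrC ler_wpM2r// q_le.
Qed.

(** From 1 + k <= exp(k) and exp(-1/4) >= 3/4, the power is even at most 4/3. *)
Lemma exprn_le_3half (k : R) (n : nat) : 0 <= k -> n%:R * k <= 1/4 ->
  (1 + k) ^+ n <= 3/2.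
Proof.
move=> k0 nk.
apply: (@le_trans _ _ (expR (n%:R * k))).
  rewrite expRM_natl lerXn2r ?nnegrE ?expR_ge0 ?addr_ge0//.
  exact: expR_ge1Dx.
have := expR_ge1Dx (- (n%:R * k)); rewrite expRN => h.
have e0 := expR_gt0 (n%:R * k).
have h2 : 3/4 <= (expR (n%:R * k))^-1 by lra.
have : expR (n%:R * k) * (3/4) <= 1 by rewrite -ler_pdivlMl// mulr1.
by lra.
Qed.

End perturbation.

Section band_limited_perturbation.
Variable R : realType.
Implicit Types f g v : R -> R.
Local Notation I f := (Rintegral \mu setT f).

Lemma bessel_const_gt0 : 0 < bessel_const R.
Proof. by rewrite divr_gt0 ?mulr_gt0 ?pi_gt0 ?exprn_gt0 ?cos1_gt0. Qed.

Lemma le1_mul3 (E : R) : 1 <= E -> 1 <= 3 * E. Proof. lra. Qed.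

Lemma twist_sqr_le (E A L : R) :
  (A * E) ^+ 2 + (E * (A + L)) ^+ 2 <= 3 * E ^+ 2 * (A ^+ 2 + L ^+ 2).
Proof.
have q : A ^+ 2 + (A + L) ^+ 2 <= 3 * (A ^+ 2 + L ^+ 2).
  by have := sqr_ge0 (A - L); nra.
by have := ler_wpM2l (sqr_ge0 E) q; lra.
Qed.

Lemma mul2_distr (x y z : R) : (2 * x + 2 * y) * z = 2 * (x * z) + 2 * (y * z).
Proof. ring. Qed.

Lemma sum_le_weights (q k j : R) : 0 <= q -> 0 <= k -> 0 <= j ->
  2 * q + 2 * k <= 4 * q + 4 * k + 2 * j.
Proof. lra. Qed.

Lemma sum_le_weights2 (q k j x y : R) : x <= 2 * q + 2 * k -> y <= j ->
  2 * x + 2 * y <= 4 * q + 4 * k + 2 * j.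
Proof. lra. Qed.

(** The damping exp(-|y|/m) of the Poisson average cancels the twist exactly, because y is positive
    on the support. *)
Lemma inv_fourier_untwist (m w A L x : R) (v1 v2 : R -> R) : 1 <= m ->
  supported_lipschitz v1 m w A L -> supported_lipschitz v2 m w A L ->
  L1 (fun x => v1 x * expR (x / m)) -> L1 (fun x => v2 x * expR (x / m)) ->
  poisson (m^-1) (inv_fourier (fun x => v1 x * expR (x / m))
    (fun x => v2 x * expR (x / m))) x = inv_fourier v1 v2 x.
Proof.
move=> m1 H1 H2 I1 I2; have m0 : 0 < m by rewrite (lt_le_trans ltr01).
rewrite poisson_inv_fourier ?invr_gt0//.
have e v : supported_lipschitz v m w A L ->
    (fun y => expR (- m^-1 * `|y|) * (v y * expR (y / m))) = v.
  move=> H; apply/funext => y; have [yin|yout] := boolP (m <= y <= m + w).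
    have y0 : 0 <= y by case/andP: yin => my _; lra.
    rewrite mulrCA -expRD ger0_norm// mulNr mulrC (mulrC y) addNr expR0 mul1r//.
  by rewrite (sl_support H yout) mul0r mulr0.
by rewrite (e v1 H1) (e v2 H2).
Qed.

(* The lower density is a Cauchy density plus G, and the upper one adds K, where
   G = P * |K'| >= |P * K'| = |K| for the Poisson kernel P of scale 1/m: since
   |K| only enters through P, G inherits the Sobolev norm of K for every s. *)
Lemma band_limited_two_points (phi g : R -> R) (s B : R) : 0 <= s -> 0 < B -> is_pdf g ->
  exists c0, 0 < c0 /\
  forall (n : nat) (m w A L AH LH : R) (v1 v2 : R -> R), 1 <= m -> w <= m ->
  supported_lipschitz v1 m w A L -> supported_lipschitz v2 m w A L ->
  supported_lipschitz (fun x => v1 x * Cf g x - v2 x * Sf g x) m w AH LH ->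
  supported_lipschitz (fun x => v1 x * Sf g x + v2 x * Cf g x) m w AH LH ->
  w * (A ^+ 2 + L ^+ 2) * m `^ (2 * s) <= c0 ->
  n%:R * (w * (AH ^+ 2 + LH ^+ 2)) <= c0 ->
  exists f0 f1, [/\ Omega s B f0, Omega s B f1,
    (forall t, Cf f1 t - Cf f0 t = v1 t + v1 (- t)),
    (forall t, Sf f1 t - Sf f0 t = v2 t - v2 (- t)) &
    (((Phi phi f1 - Phi phi f0) ^+ 2 / 16)%:E <= minimax_risk phi g (Omega s B) n)%E].
Proof.
move=> s0 B0 hg; have Ig := pdf_L1 hg.
have B20 : 0 < B ^+ 2 / 8 by rewrite divr_gt0 ?exprn_gt0.
have [h [h1 [Q [IQ Q0 QW QB]]]] := cauchy_sobolev s0 B20.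
have h0 : 0 < h by rewrite (lt_le_trans ltr01).
have [cb [cb0 Hcb]] := convolution_cauchy_ge h1 hg.
have [C [C1 HC]] := sobolev_weight_le s0.
have C0 : 0 < C by rewrite (lt_le_trans ltr01).
have pi0 := pi_gt0 R.
pose D : R := 8 * pi * C + 4 * pi * C * expR 2.
have D0 : 0 < D by rewrite addr_gt0 ?mulr_gt0 ?expR_gt0.
(* The first bound makes the mass of G at most 1/2; the second, with D collecting the constants of G
   and of K, keeps their Sobolev contribution within B^2/2. *)
pose sigma : R := Num.min ((pi + 1)^-1) (B ^+ 2 / (2 * D)).
have sigma0 : 0 < sigma.
  by rewrite lt_min invr_gt0 (addr_gt0 pi0 ltr01)/= divr_gt0 ?exprn_gt0 ?mulr_gt0.
have tpi0 : 0 <= 2 * (pi : R) by apply: mulr_ge0 => //; exact: ltW.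
have pi1 : 0 < (pi : R) + 1 by exact: addr_gt0.
have pi12 : 0 <= ((pi : R) + 1) / 2 by apply: divr_ge0 => //; exact: ltW.
have sigma1 : sigma * ((pi + 1) / 2) <= 1/2.
  apply: (@le_trans _ _ ((pi + 1)^-1 * ((pi + 1) / 2))).
    by rewrite ler_wpM2r// ge_min lexx.
  by rewrite mulrA mulVf// gt_eqF.
have sigmale1 : sigma <= 1.
  have s1 : sigma <= (pi + 1)^-1 by rewrite ge_min lexx.
  by rewrite (le_trans s1)// invf_le1// lerDr ltW.
have sigmaD : sigma ^+ 2 * D <= B ^+ 2 / 2.
  apply: (@le_trans _ _ (sigma * D)).
    by rewrite ler_wpM2r ?(ltW D0)// expr2 ler_piMr// ltW.
  apply: (@le_trans _ _ (B ^+ 2 / (2 * D) * D)).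
    by rewrite ler_wpM2r ?(ltW D0)// ge_min lexx orbT.
  by rewrite invfM mulrA divfK ?gt_eqF.
have [bc [bcE bc0]] : exists bc, bc = bessel_const R /\ 0 < bc.
  by exists (bessel_const R); split; last exact: bessel_const_gt0.
(* The first quantity keeps the weighted norms of K and K' below sigma m^(-s); the second makes n
   times the excess of the chi-square integral over 1 at most 1/4. *)
pose c0 : R := Num.min (sigma ^+ 2 / (3 * expR 2 ^+ 2 * bc)) (cb / (8 * bc)).
exists c0; split.
  by rewrite lt_min !divr_gt0 ?mulr_gt0 ?exprn_gt0 ?expR_gt0.
move=> n m w A L AH LH v1 v2 m1 wm H1 H2 J1 J2 cond1 cond2.
have m0 : 0 < m by rewrite (lt_le_trans ltr01).
have mV0 : 0 < m^-1 by rewrite invr_gt0.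
have w0 := sl_width H1.
have A0 := sl_A_ge0 H1; have L0 := sl_L_ge0 H1.
have T1 := sl_exp_twist m1 wm H1; have T2 := sl_exp_twist m1 wm H2.
set u1 := (fun x => v1 x * expR (x / m)) in T1.
set u2 := (fun x => v2 x * expR (x / m)) in T2.
pose K := inv_fourier v1 v2.
pose K' := inv_fourier u1 u2.
pose k x := `|K' x|.
pose G := poisson (m^-1) k.
have e2 : 1 <= expR 2 :> R by rewrite -expR0 ler_expR.
have ms0 : 0 < m `^ (- s) by exact: powR_gt0.
have msE : (m `^ (- s)) ^+ 2 * m `^ (2 * s) = 1.
  rewrite expr2 -!powRD; last 2 first.
  - by rewrite (gt_eqF m0) implybT.
  - by rewrite (gt_eqF m0) implybT.
  by rewrite (_ : _ + _ = 0) ?powRr0//; ring.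
have m2s0 : 0 < m `^ (2 * s) by exact: powR_gt0.
(* The factor m^(-s) offsets the Sobolev weight, which is of order m^(2s) where the transform of K
   lives. *)
pose sm := sigma * m `^ (- s).
have sm0 : 0 < sm by rewrite mulr_gt0.
have smE : sm ^+ 2 * m `^ (2 * s) = sigma ^+ 2 by rewrite exprMn -mulrA msE mulr1.
have smle : sm <= sigma.
  rewrite ler_piMr ?(ltW sigma0)// powRN invf_le1//.
    by rewrite -(powRr0 m) ler_powR.
  exact: powR_gt0.
have wAL : 3 * expR 2 ^+ 2 * bc * (w * (A ^+ 2 + L ^+ 2)) <= sm ^+ 2.
  rewrite -(ler_pM2r m2s0) smE.
  have : w * (A ^+ 2 + L ^+ 2) * m `^ (2 * s) <= sigma ^+ 2 / (3 * expR 2 ^+ 2 * bc).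
    by rewrite (le_trans cond1)// ge_min lexx.
  rewrite ler_pdivlMr ?mulr_gt0 ?exprn_gt0 ?expR_gt0//.
  by move=> hh; rewrite (le_trans _ hh)// le_eqVlt; apply/orP; left; apply/eqP; ring.
have wAL0 : 0 <= w * (A ^+ 2 + L ^+ 2).
  by rewrite mulr_ge0 ?(ltW w0)// addr_ge0 ?sqr_ge0.
have [IK2 EK2] := inv_fourier_weighted_L2 H1 H2.
have [IK'2 EK'2] := inv_fourier_weighted_L2 T1 T2.
have SK : I (fun x => (1 + x ^+ 2) * K x ^+ 2) <= sm ^+ 2.
  apply: (le_trans EK2); apply: le_trans wAL; rewrite -bcE.
  rewrite [leRHS](_ : _ = (3 * expR 2 ^+ 2) * (bc * (w * (A ^+ 2 + L ^+ 2)))); last by ring.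
  have e4 : 1 <= expR 2 ^+ 2 :> R by exact: exprn_ege1.
  apply: ler_peMl; first exact: mulr_ge0 (ltW bc0) wAL0.
  exact: le1_mul3.
have SK' : I (fun x => (1 + x ^+ 2) * K' x ^+ 2) <= sm ^+ 2.
  apply: (le_trans EK'2); apply: le_trans wAL; rewrite -bcE.
  rewrite [leRHS](_ : _ = bc * (w * (3 * expR 2 ^+ 2 * (A ^+ 2 + L ^+ 2)))); last by ring.
  apply: ler_wpM2l; first exact: ltW.
  apply: ler_wpM2l; first exact: ltW.
  exact: twist_sqr_le.
have Iu1 := sl_L1 T1; have Iu2 := sl_L1 T2.
have Iv1 := sl_L1 H1; have Iv2 := sl_L1 H2.
have mK : measurable_fun setT K by exact: measurable_inv_fourier.
have mK' : measurable_fun setT K' by exact: measurable_inv_fourier.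
have [IK IKsq EKsq _] := L1_weighted_L2 mK sm0 IK2 SK.
have [IK' IK'sq EK'sq EK'1] := L1_weighted_L2 mK' sm0 IK'2 SK'.
have Ik : L1 k by exact: L1_norm.
have Iksq : L1 (fun x => k x ^+ 2).
  by apply: eqL1 IK'sq => x; rewrite /k real_normK// num_real.
have Eksq : I (fun x => k x ^+ 2) <= sm ^+ 2.
  by apply: le_trans EK'sq; rewrite le_eqVlt; apply/orP; left; apply/eqP; apply: eqI => x;
     rewrite /k real_normK// num_real.
have k0 x : 0 <= k x by exact: normr_ge0.
pose eps := I k.
have eps0 : 0 <= eps by exact: I_ge0.
have epsle : eps <= 1/2.
  apply: (le_trans EK'1); apply: le_trans sigma1.
  by rewrite ler_wpM2r.
have [IG EG] := poisson_L1 mV0 Ik.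
have Kle x : `|K x| <= G x.
  rewrite /K -(inv_fourier_untwist x m1 H1 H2 Iu1 Iu2).
  exact: poisson_ge_norm.
have G0 x : 0 <= G x by exact: poisson_ge0.
pose b := cauchy_pdf h.
have hb : is_pdf b by exact: is_pdf_cauchy.
have Ib := pdf_L1 hb; have b0 x : 0 <= b x by case: hb.
(* The Cauchy part is scaled down by exactly the mass of G, so the integral is 1; at least half of
   it remains, which keeps the lower bound on the density of Y. *)
pose f0 x := ((1 - eps) * b x + G x).
pose f1 x := f0 x + K x.
have If0 : L1 f0 by exact: (L1D (L1Z _ Ib) IG).
have If1 : L1 f1 by exact: (L1D If0 IK).
have eps1 : 0 <= 1 - eps by clear -epsle; lra.
have eps2 : 1/2 <= 1 - eps by clear -epsle; lra.
have eps3 : 1 - eps <= 1 by clear -eps0; lra.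
have f00 x : 0 <= f0 x by rewrite addr_ge0// mulr_ge0.
have f10 x : 0 <= f1 x.
  have := Kle x; rewrite ler_norml => /andP[Kx _].
  have bx : 0 <= (1 - eps) * b x by rewrite mulr_ge0.
  rewrite /f1 /f0 -addrA addr_ge0//.
  by rewrite -lerBlDl sub0r.
have [inv_c inv_s] : (forall t, Cf K t = v1 t + v1 (- t)) /\
    (forall t, Sf K t = v2 t - v2 (- t)).
  by split=> t; have [] := fourier_inversion t Iv1 Iv2 (sl_bounded_lipschitz H1)
    (sl_bounded_lipschitz H2) IK.
have supp0 v x : supported_lipschitz v m w A L -> x < m -> v x = 0.
  by move=> H xm; apply: (sl_support H); rewrite negb_and -ltNge xm.
have supp2 v x : supported_lipschitz v m w A L -> 2 * m < x -> v x = 0.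
  move=> H xm; apply: (sl_support H); rewrite negb_and -!ltNge; apply/orP; right.
  by clear -wm xm; lra.
(* The perturbation has no mass because its transform vanishes near the origin. *)
have EK : I K = 0.
  have <- : Cf K 0 = I K by apply: eqI => x; rewrite mul0r cos0 mul1r.
  by rewrite inv_c oppr0 (supp0 v1)// addr0.
have hf0 : is_pdf f0.
  apply: is_pdfP => //.
  by rewrite (ID (L1Z _ Ib) IG) (IZ _ Ib) pdf_I// EG /eps; ring.
have hf1 : is_pdf f1.
  by apply: is_pdfP => //; rewrite (ID If0 IK) EK addr0 pdf_I.
have PSG t : power_spectrum G t * sobolev_weight s t <= C * m `^ (2 * s) * power_spectrum k t.
  have [e1 e1'] := poisson_transform t mV0 Ik.
  rewrite /power_spectrum e1 e1'.
  have -> : (expR (- m^-1 * `|t|) * Cf k t) ^+ 2 + (expR (- m^-1 * `|t|) * Sf k t) ^+ 2 =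
     expR (- m^-1 * `|t|) ^+ 2 * power_spectrum k t by rewrite /power_spectrum; ring.
  rewrite mulrAC ler_wpM2r ?power_spectrum_ge0//.
  apply: (@le_trans _ _ (expR (- m^-1 * `|t|) ^+ 2 * (C * m `^ (2 * s) * expR (`|t| / m)))).
    by rewrite ler_wpM2l ?sqr_ge0// HC.
  have -> : expR (- m^-1 * `|t|) ^+ 2 * (C * m `^ (2 * s) * expR (`|t| / m)) =
    C * m `^ (2 * s) * (expR (- m^-1 * `|t|) * (expR (- m^-1 * `|t|) * expR (`|t| / m))).
    by ring.
  rewrite -expRD mulNr (mulrC `|t|) addNr expR0 mulr1 ler_piMr//.
    by rewrite mulr_ge0 ?powR_ge0// ltW.
  by rewrite -mulNr expabs_le1.
(* Beyond 2m the transform of K is 0; below, the weight is at most C e^2 m^(2s). *)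
have PSK t : power_spectrum K t * sobolev_weight s t <=
    C * expR 2 * m `^ (2 * s) * power_spectrum K t.
  have [tm|tm] := leP `|t| (2 * m).
    rewrite mulrC ler_wpM2r ?power_spectrum_ge0//.
    apply: (le_trans (HC m t m1)); rewrite mulrAC ler_wpM2r ?powR_ge0//.
    by rewrite ler_wpM2l ?(ltW C0)// ler_expR ler_pdivrMr.
  have z v : supported_lipschitz v m w A L -> v t = 0 /\ v (- t) = 0.
    move=> H; have [t0|t0] := leP 0 t.
      rewrite ger0_norm// in tm; rewrite (supp2 v)// (supp0 v)//.
      by clear -tm m0; lra.
    rewrite ltr0_norm// in tm; rewrite (supp2 v (- t))// (supp0 v t)//.
    by clear -tm m0; lra.
  have [z1 z1'] := z v1 H1; have [z2 z2'] := z v2 H2.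
  rewrite /power_spectrum inv_c inv_s z1 z1' z2 z2' subrr addr0.
  by rewrite expr0n/= addr0 mul0r mulr0.
have [IPk EPk] := bessel_inequality Ik Iksq.
have [IPK EPK] := bessel_inequality IK IKsq.
pose Hw t := 4 * Q t + 4 * (C * m `^ (2 * s)) * power_spectrum k t +
   2 * (C * expR 2 * m `^ (2 * s)) * power_spectrum K t.
have IHw : L1 Hw.
  apply: (L1D (L1D (L1Z _ IQ) (L1Z _ IPk)) (L1Z _ IPK)).
have EHw : I Hw <= B ^+ 2.
  rewrite (ID (L1D (L1Z _ IQ) (L1Z _ IPk)) (L1Z _ IPK)) (ID (L1Z _ IQ) (L1Z _ IPk)).
  rewrite (IZ _ IQ) (IZ _ IPk) (IZ _ IPK).
  have b1 : 4 * I Q <= B ^+ 2 / 2.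
    by apply: (@le_trans _ _ (4 * (B ^+ 2 / 8))); [exact: ler_wpM2l|clear; lra].
  have b2 : 4 * (C * m `^ (2 * s)) * I (power_spectrum k) <= 8 * pi * C * sigma ^+ 2.
    rewrite -smE; apply: (@le_trans _ _ (4 * (C * m `^ (2 * s)) * (2 * pi * sm ^+ 2))).
      rewrite ler_wpM2l ?mulr_ge0 ?(ltW C0) ?(ltW m2s0)//.
      exact: le_trans EPk (ler_wpM2l tpi0 Eksq).
    by rewrite le_eqVlt; apply/orP; left; apply/eqP; move: (pi : R) => p; ring.
  have b3 : 2 * (C * expR 2 * m `^ (2 * s)) * I (power_spectrum K) <=
     4 * pi * C * expR 2 * sigma ^+ 2.
    rewrite -smE; apply: (@le_trans _ _ (2 * (C * expR 2 * m `^ (2 * s)) * (2 * pi * sm ^+ 2))).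
      rewrite ler_wpM2l ?mulr_ge0 ?expR_ge0 ?(ltW C0) ?(ltW m2s0)//.
      exact: le_trans EPK (ler_wpM2l tpi0 EKsq).
    by rewrite le_eqVlt; apply/orP; left; apply/eqP; move: (pi : R) => p; ring.
  have b4 : 8 * pi * C * sigma ^+ 2 + 4 * pi * C * expR 2 * sigma ^+ 2 <= B ^+ 2 / 2.
    apply: le_trans sigmaD; rewrite le_eqVlt; apply/orP; left; apply/eqP; rewrite /D.
    by move: (pi : R) => p; ring.
  apply: (@le_trans _ _ (B ^+ 2 / 2 + B ^+ 2 / 2)); last by clear; lra.
  rewrite -addrA; apply: lerD => //.
  by apply: le_trans b4; exact: lerD.
have psf0 t : power_spectrum f0 t <= 2 * power_spectrum b t + 2 * power_spectrum G t.
  apply: (le_trans (power_spectrumD t (L1Z _ Ib) IG)); rewrite lerD2r ler_wpM2l//.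
  rewrite power_spectrumZ// ler_piMl ?power_spectrum_ge0//.
  by rewrite expr_le1.
have W0 t : 0 <= sobolev_weight s t by exact: sobolev_weight_ge0.
have kPS t : 0 <= C * m `^ (2 * s) * power_spectrum k t.
  by rewrite !mulr_ge0 ?power_spectrum_ge0 ?powR_ge0// ltW.
have KPS t : 0 <= C * expR 2 * m `^ (2 * s) * power_spectrum K t.
  by rewrite !mulr_ge0 ?power_spectrum_ge0 ?powR_ge0 ?expR_ge0// ltW.
have wf0 t : power_spectrum f0 t * sobolev_weight s t <= 
    2 * Q t + 2 * (C * m `^ (2 * s) * power_spectrum k t).
  apply: (@le_trans _ _ ((2 * power_spectrum b t + 2 * power_spectrum G t) * sobolev_weight s t)).
    by rewrite ler_wpM2r.
  rewrite mulrDl; apply: lerD; rewrite -[leLHS]mulrA; apply: ler_wpM2l => //.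
have HwE t : Hw t = 4 * Q t + 4 * (C * m `^ (2 * s) * power_spectrum k t) +
    2 * (C * expR 2 * m `^ (2 * s) * power_spectrum K t) by rewrite /Hw !mulrA.
have O0 : Omega s B f0.
  split=> //; apply: (sobolev_integral_le If0 IHw _ EHw) => t.
  by rewrite HwE; apply: (le_trans (wf0 t)); exact: sum_le_weights.
have O1 : Omega s B f1.
  split=> //; apply: (sobolev_integral_le If1 IHw _ EHw) => t.
  apply: (@le_trans _ _ ((2 * power_spectrum f0 t + 2 * power_spectrum K t) * sobolev_weight s t)).
    by rewrite ler_wpM2r// power_spectrumD.
  rewrite HwE mul2_distr.
  exact: sum_le_weights2 (wf0 t) (PSK t).
have bB x : `|b x| <= (2 * pi)^-1 * (2 / h).
  rewrite /b /cauchy_pdf normrM ger0_norm ?invr_ge0 ?mulr_ge0 ?(ltW pi0)//.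
  by rewrite ler_wpM2l ?invr_ge0 ?mulr_ge0 ?(ltW pi0)// norm_q_le.
pose M0 : R := (2 * pi)^-1 * (2 / h) + (2 * pi)^-1 * (2 / m^-1 * I (fun y => `|k y|)).
pose MK : R := pi^-1 * (I (fun x => `|v1 x|) + I (fun x => `|v2 x|)).
have KB x : `|K x| <= MK by exact: norm_inv_fourier_le.
have f0B x : `|f0 x| <= M0.
  rewrite (le_trans (ler_normD _ _))// lerD//; last exact: poisson_le.
  by rewrite normrM (le_trans _ (bB x))//; apply: ler_piMl => //; rewrite ger0_norm.
have f1B x : `|f1 x| <= M0 + MK by rewrite (le_trans (ler_normD _ _))// lerD.
pose p0 := convolution f0 g; pose p1 := convolution f1 g.
have hp0 : is_pdf p0 by exact: convolution_pdf f0B.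
have hp1 : is_pdf p1 by exact: convolution_pdf f1B.
have Ip0 := pdf_L1 hp0; have Ip1 := pdf_L1 hp1.
pose N := inv_fourier (fun w => v1 w * Cf g w - v2 w * Sf g w)
              (fun w => v1 w * Sf g w + v2 w * Cf g w).
have p1E x : p1 x = p0 x + N x.
  rewrite /N -convolution_inv_fourier// /p1 /p0 /convolution.
  have C0' := L1_convolution_pointwise x If0 Ig f0B.
  have CK := L1_convolution_pointwise x IK Ig KB.
  by rewrite -(ID C0' CK); apply: eqI => y; rewrite mulrDr.
have p0ge x : cb / 2 / (1 + x ^+ 2) <= p0 x.
  apply: (@le_trans _ _ (1/2 * convolution b g x)).
    by have := Hcb x; rewrite -/b => hcb; rewrite mulrAC mulrC div1r ler_wpM2l.
  have Cb := L1_convolution_pointwise x Ib Ig bB.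
  rewrite /convolution -(IZ _ Cb); apply: I_le.
  - exact: (L1Z _ Cb).
  - exact: L1_convolution_pointwise x If0 Ig f0B.
  - move=> y; have g0 : 0 <= g y by case: hg.
    rewrite mulrCA ler_wpM2l// /f0.
    rewrite (le_trans (ler_wpM2r (b0 _) eps2))// lerDl.
    exact: G0.
have x20 x : 0 < 1 + x ^+ 2 :> R by rewrite ltr_wpDr ?sqr_ge0.
have p00 x : 0 < p0 x.
  by apply: lt_le_trans (p0ge x); rewrite !divr_gt0.
have [IN EN] := inv_fourier_weighted_L2 J1 J2; rewrite -bcE in EN.
pose kap : R := 2 / cb * (bc * (w * (AH ^+ 2 + LH ^+ 2))).
have kap0 : 0 <= kap.
  by rewrite !mulr_ge0 ?invr_ge0 ?(ltW cb0) ?(ltW bc0) ?(ltW w0) ?addr_ge0 ?sqr_ge0.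
have INL : L1 N.
  by apply: eqL1 (L1B Ip1 Ip0) => x; rewrite p1E addrC addKr.
have EN0 : I N = 0.
  rewrite (eqI (g := fun x => p1 x - p0 x)); last by move=> x; rewrite p1E addrC addKr.
  by rewrite (IB Ip1 Ip0) !pdf_I// subrr.
(* A majorant of p1^2 / p0 = p0 + 2N + N^2 / p0: the linear term integrates to 0, and the lower
   bound on p0 produces the weight 1 + x^2. *)
pose Z x := p0 x + 2 * N x + 2 / cb * ((1 + x ^+ 2) * N x ^+ 2).
have IZ' : L1 Z by exact: (L1D (L1D Ip0 (L1Z _ INL)) (L1Z _ IN)).
have EZ : I Z <= 1 + kap.
  rewrite (ID (L1D Ip0 (L1Z _ INL)) (L1Z _ IN)) (ID Ip0 (L1Z _ INL)).
  rewrite (IZ _ INL) (IZ _ IN) EN0 mulr0 addr0 pdf_I// lerD2l.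
  by rewrite ler_wpM2l// divr_ge0// ltW.
have chi2 : (\int[\mu]_x (p1 x ^+ 2 / p0 x)%:E <= (1 + kap)%:E)%E.
  apply: (@le_trans _ _ (\int[\mu]_x (Z x)%:E)%E); last by rewrite L1_EFin// lee_fin.
  have mp0 := L1_measurable Ip0; have mp1 := L1_measurable Ip1.
  apply: ge0_le_integral => //.
  - by move=> x _; rewrite lee_fin divr_ge0 ?sqr_ge0// ltW.
  - apply/measurable_EFinP; apply: measurable_funM; first exact: measurable_funX.
    have -> : (fun y => (p0 y)^-1) = (fun y => expR (- ln (p0 y))).
      by apply/funext => y; rewrite expRN lnK ?posrE.
    apply: (measurableT_comp (@measurable_expR R)).
    apply: (measurableT_comp (@oppr_measurable R _)).
    exact: (measurableT_comp (@measurable_ln R)).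
  - by apply/measurable_EFinP; exact: L1_measurable.
  - move=> x _; rewrite lee_fin p1E /Z.
    have -> : (p0 x + N x) ^+ 2 / p0 x = p0 x + 2 * N x + N x ^+ 2 / p0 x.
      by field; rewrite gt_eqF.
    rewrite lerD2l mulrA mulrC ler_wpM2r ?sqr_ge0//.
    rewrite -[leRHS]invrK lef_pV2 ?posrE ?p00 ?invr_gt0 ?mulr_gt0 ?invr_gt0//.
    apply: le_trans (p0ge x); rewrite le_eqVlt; apply/orP; left; apply/eqP.
    by field; rewrite !gt_eqF.
have kn : (1 + kap) ^+ n <= 3/2.
  apply: exprn_le_3half => //.
  have cond3 : n%:R * (w * (AH ^+ 2 + LH ^+ 2)) <= cb / (8 * bc).
    by rewrite (le_trans cond2)// ge_min lexx orbT.
  have -> : n%:R * kap = 2 / cb * bc * (n%:R * (w * (AH ^+ 2 + LH ^+ 2))).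
    by rewrite /kap; ring.
  apply: (@le_trans _ _ (2 / cb * bc * (cb / (8 * bc)))).
    by rewrite ler_wpM2l// !mulr_ge0 ?invr_ge0 ?(ltW cb0) ?(ltW bc0).
  rewrite le_eqVlt; apply/orP; left; apply/eqP.
  have cbn := lt0r_neq0 cb0; have bcn := lt0r_neq0 bc0.
  by field; rewrite cbn bcn.
exists f0, f1; split=> //.
- move=> t; rewrite -inv_c /Cf.
  rewrite -(IB (L1_cos_mul t If1) (L1_cos_mul t If0)).
  by apply: eqI => x; rewrite /f1 mulrDr addrC addKr.
- move=> t; rewrite -inv_s /Sf.
  rewrite -(IB (L1_sin_mul t If1) (L1_sin_mul t If0)).
  by apply: eqI => x; rewrite /f1 mulrDr addrC addKr.
apply: (@minimax_risk_two_points _ phi g f0 f1 p0 p1 _ n (1 + kap) hf0 hf1 hg) => //.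
- exact: convolution_sum_density f0B.
- exact: convolution_sum_density f1B.
- exact: L1_measurable.
- by rewrite addr_ge0.
Qed.

End band_limited_perturbation.

(** * Modulated bumps and the functional *)

Section bump.
Variable R : realType.
Local Notation I f := (Rintegral \mu setT f).

Lemma derivable_lipschitz (f : R -> R) (l r M : R) :
  (forall x, l <= x <= r -> derivable f x 1 /\ `|derive1 f x| <= M) ->
  forall x y, l <= x <= r -> l <= y <= r -> `|f x - f y| <= M * `|x - y|.
Proof.
move=> fM x y xin yin.
wlog xy : x y xin yin / x < y.
  move=> H; case: (ltgtP x y) => xy.
  - exact: H.
  - by rewrite distrC (distrC x y); exact: H.
  - by rewrite xy !subrr normr0 mulr0.
move/andP: xin => [lx xr]; move/andP: yin => [ly yr].
have df z : z \in `]x, y[%R -> is_derive z (1 : R) f (derive1 f z).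
  rewrite in_itv/= => /andP[xz zy]; rewrite derive1E; apply/derivableP.
  apply: (fM z _).1.
  by rewrite (le_trans lx (ltW xz)) (le_trans (ltW zy) yr).
have cf : {within `[x, y], continuous f}.
  apply: derivable_within_continuous => z; rewrite in_itv/= => /andP[xz zy].
  apply: (fM z _).1.
  by rewrite (le_trans lx xz) (le_trans zy yr).
have [c] := MVT xy df cf.
rewrite in_itv/= => /andP[xc cy] E.
have cin : l <= c <= r by rewrite (le_trans lx (ltW xc)) (le_trans (ltW cy) yr).
have [_ Mc] := fM c cin.
by rewrite distrC E normrM (distrC x y) ler_wpM2r.
Qed.

Lemma cos_lipschitz (x y : R) : `|cos x - cos y| <= `|x - y|.
Proof.
rewrite -[leRHS]mul1r.
apply: (@derivable_lipschitz cos (Num.min x y) (Num.max x y)).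
- move=> z _; split; first by have [] := is_derive_cos z.
  by rewrite derive1E derive_val normrN norm_sin_le1.
- by rewrite ge_min le_max !lexx.
- by rewrite ge_min le_max !lexx !orbT.
Qed.

Lemma sin_lipschitz (x y : R) : `|sin x - sin y| <= `|x - y|.
Proof.
rewrite -[leRHS]mul1r.
apply: (@derivable_lipschitz sin (Num.min x y) (Num.max x y)).
- move=> z _; split; first by have [] := is_derive_sin z.
  by rewrite derive1E derive_val norm_cos_le1.
- by rewrite ge_min le_max !lexx.
- by rewrite ge_min le_max !lexx !orbT.
Qed.

(** A triangular bump on [m, m + w]. It is only Lipschitz, which is all that the weighted Bessel
    inequality asks of a transform. *)
Definition hat (delta m w x : R) : R :=
  delta * Num.max 0 (1 - `|x - (m + w / 2)| * (2 / w)).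

Lemma hat_ge0 delta m w x : 0 <= delta -> 0 <= hat delta m w x.
Proof. by move=> d0; rewrite mulr_ge0// le_max lexx. Qed.

Lemma hat_sl delta m w : 0 <= delta -> 0 < w ->
  supported_lipschitz (hat delta m w) m w delta (delta * (2 / w)).
Proof.
move=> d0 w0; split=> //.
- move=> x; rewrite negb_and -!ltNge => xo; rewrite /hat.
  rewrite max_l ?mulr0// subr_le0 mulrA ler_pdivlMr// mul1r.
  case/orP: xo => xo.
    by rewrite ltr0_norm; lra.
  by rewrite gtr0_norm; lra.
- move=> x; rewrite ger0_norm ?hat_ge0// ler_piMr// ge_max ler01/= lerBlDr lerDl.
  by rewrite mulr_ge0// divr_ge0// ltW.
- move=> x y; rewrite /hat -mulrBr normrM (ger0_norm d0) -mulrA ler_wpM2l//.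
  set a := 1 - _; set b := 1 - _.
  apply: (@le_trans _ _ `|a - b|).
    have [a0|a0] := leP 0 a; have [b0|b0] := leP 0 b.
    - by [].
    - by rewrite subr0 !ger0_norm//; lra.
    - by rewrite sub0r normrN (ger0_norm b0) ltr0_norm; lra.
    - by rewrite subr0 normr0.
  have -> : a - b = (`|y - (m + w / 2)| - `|x - (m + w / 2)|) * (2 / w) by rewrite /a /b; ring.
  have w2 : 0 < 2 / w by rewrite divr_gt0.
  rewrite normrM (gtr0_norm w2) mulrC ler_wpM2l ?(ltW w2)//.
  rewrite (le_trans (ler_dist_dist _ _))//.
  have -> : y - (m + w / 2) - (x - (m + w / 2)) = - (x - y) by ring.
  by rewrite normrN.
Qed.

(** The bump is at least delta/2 on the middle half of its support. *)
Lemma hat_integral_ge delta m w : 0 <= delta -> 0 < w ->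
  delta * w / 4 <= I (hat delta m w).
Proof.
move=> d0 w0; have H := hat_sl m d0 w0; have Ih := sl_L1 H.
pose J : R -> R := \1_`[m + w / 4, m + 3 * w / 4].
have EJ : (\int[\mu]_x (J x)%:E = (w / 2)%:E)%E.
  rewrite /J integral_indic// setIT [LHS]lebesgue_measure_itv/= lte_fin ifT; last by lra.
  by rewrite -EFinB; congr EFin; field.
have IJ : L1 J.
  by apply: L1_ge0; [exact: measurable_indic|move=> x; rewrite /J indicE ler0n|rewrite EJ ltry].
apply: (@le_trans _ _ (I (fun x => delta / 2 * J x))).
  by rewrite (IZ _ IJ) /Rintegral EJ/= le_eqVlt; apply/orP; left; apply/eqP; field.
apply: I_le => //; first exact: (L1Z _ IJ).
move=> x; rewrite /J indicE; case: (boolP (x \in _)) => [|_]; last first.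
  by rewrite mulr0 hat_ge0.
rewrite inE/= in_itv/= mulr1 => /andP[x1 x2].
rewrite /hat ler_wpM2l// le_max; apply/orP; right.
rewrite lerBrDr -lerBrDl mulrA ler_pdivrMr//.
by have : `|x - (m + w / 2)| <= w / 4 by [rewrite ler_norml; lra]; lra.
Qed.

End bump.

(** * The change of the functional *)

Section functional_difference.
Variable R : realType.
Local Notation I f := (Rintegral \mu setT f).

Lemma ae_opp (P : R -> Prop) : {ae \mu, forall x : R, P x} -> {ae \mu, forall x : R, P (- x)}.
Proof.
move=> [N [mN N0 PN]]; exists (-%R @^-1` N); split.
- by rewrite -[X in measurable X]setTI; exact: (@oppr_measurable R setT).
- by rewrite -N0; exact: (lebesgue_measureN mN).
- by move=> x /= /PN.
Qed.

Lemma Cf_opp (v : R -> R) t : Cf v (- t) = Cf v t.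
Proof. by apply: eqI => x; rewrite mulNr cosN. Qed.

Lemma Sf_opp (v : R -> R) t : L1 v -> Sf v (- t) = - Sf v t.
Proof.
move=> Iv; rewrite /Sf -[RHS]mulN1r -(IZ (-1) (L1_sin_mul t Iv)).
by apply: eqI => x; rewrite mulNr sinN mulNr mulN1r.
Qed.

(** As [phi] is real, every truncated transform is conjugate symmetric. For almost every w the
    limits exist at both w and -w, null sets being invariant under reflection, and the symmetry
    passes to them. *)
Lemma is_fourier_conj (phi : R -> R) (phis : R -> R[i]) : is_fourier phi phis ->
  {ae \mu, forall w : R, complex.Re (phis (- w)) = complex.Re (phis w) /\
    complex.Im (phis (- w)) = - complex.Im (phis w)}.
Proof.
move=> [Iphi lim_phis]; have lim_opp := ae_opp lim_phis.
have Iphi_A (A : R) : L1 (phi \_ `[- A, A]).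
  have /integrable_mkcond := Iphi A; rewrite restrict_EFin.
  by apply.
apply: (@filterS2 _ _ (ae_filter_ringOfSetsType \mu) _ _ _ _ lim_phis lim_opp).
move=> w [r1 i1] [r2 i2]; split.
- have e : (fun A => complex.Re (fourier (phi \_ `[- A, A]) (- w))) =
      (fun A => complex.Re (fourier (phi \_ `[- A, A]) w)).
    by apply/funext => A; rewrite !fourierE/= Cf_opp.
  by rewrite e in r2; exact: cvg_unique r2 r1.
- have e : (fun A => complex.Im (fourier (phi \_ `[- A, A]) (- w))) =
      (fun A => - complex.Im (fourier (phi \_ `[- A, A]) w)).
    by apply/funext => A; rewrite !fourierE/= Sf_opp.
  by rewrite e in i2; exact: cvg_unique i2 (cvgN i1).
Qed.

Lemma I_ge0_ae (f : R -> R) : L1 f -> {ae \mu, forall x : R, 0 <= f x} -> 0 <= I f.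
Proof.
move=> If f0.
rewrite (_ : I f = I (fun x => `|f x|)); first by apply: I_ge0 => x.
rewrite /Rintegral; congr fine; apply: ae_eq_integral => //.
- by apply/measurable_EFinP; exact: L1_measurable.
- by apply/measurable_EFinP; exact: L1_measurable (L1_norm If).
- apply: (@filterS _ _ (ae_filter_ringOfSetsType \mu) _ _ _ f0) => x {}f0 _.
  by rewrite ger0_norm.
Qed.

Lemma parseval_real (phi : R -> R) (phis : R -> R[i]) f : parseval phi phis f ->
  L1 (fun w => Cf f w * complex.Re (phis (- w)) - Sf f w * complex.Im (phis (- w))) /\
  Phi phi f = (2 * pi)^-1 *
    I (fun w => Cf f w * complex.Re (phis (- w)) - Sf f w * complex.Im (phis (- w))).
Proof.
have E w : complex.Re (fourier f w * phis (- w)) =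
    Cf f w * complex.Re (phis (- w)) - Sf f w * complex.Im (phis (- w)).
  by rewrite fourierE; case: (phis (- w)).
move=> [_ [IRe _] [+ _]]; rewrite mul0r subr0 => ->.
split; first exact: eqL1 E IRe.
by congr (_ * _); exact: eqI.
Qed.

(* The phase of the bump cancels that of [phis], so the integrand of Parseval's
   formula is nonnegative; on [-m-w, -m] this uses [phis (-w) = conj (phis w)]. *)
Lemma Phi_difference_ge (phi : R -> R) (phis : R -> R[i]) (f0 f1 chi psi : R -> R)
    (m w P : R) :
  is_fourier phi phis -> parseval phi phis f0 -> parseval phi phis f1 ->
  0 < m -> 0 <= P -> L1 chi -> (forall x, 0 <= chi x) ->
  (forall x, ~~ (m <= x <= m + w) -> chi x = 0) ->
  (forall x, m <= x <= m + w -> P <= normc (phis (- x)) /\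
     phis (- x) = (normc (phis (- x)))%:C%C * expi (- psi x)) ->
  (forall t, Cf f1 t - Cf f0 t = chi t * cos (psi t) + chi (- t) * cos (psi (- t))) ->
  (forall t, Sf f1 t - Sf f0 t = chi t * sin (psi t) - chi (- t) * sin (psi (- t))) ->
  (2 * pi)^-1 * (P * I chi) <= Phi phi f1 - Phi phi f0.
Proof.
move=> Fphi /parseval_real[I0 ->] /parseval_real[I1 ->] m0 P0 Ichi chi0 chi_out phase dC dS.
rewrite -mulrBr ler_wpM2l ?invr_ge0 ?mulr_ge0 ?pi_ge0//.
rewrite -(IB I1 I0) -(IZ P Ichi) -subr_ge0 -(IB (L1B I1 I0) (L1Z P Ichi)).
apply: I_ge0_ae; first exact: L1B (L1B I1 I0) (L1Z P Ichi).
apply: (@filterS _ _ (ae_filter_ringOfSetsType \mu) _ _ _ (is_fourier_conj Fphi)).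
move=> x [conjR conjI].
have -> : Cf f1 x * complex.Re (phis (- x)) - Sf f1 x * complex.Im (phis (- x)) -
    (Cf f0 x * complex.Re (phis (- x)) - Sf f0 x * complex.Im (phis (- x))) - P * chi x =
  (Cf f1 x - Cf f0 x) * complex.Re (phis (- x)) -
    (Sf f1 x - Sf f0 x) * complex.Im (phis (- x)) - P * chi x by ring.
rewrite dC dS subr_ge0.
have expiE y : m <= y <= m + w -> P <= normc (phis (- y)) /\
    complex.Re (phis (- y)) = normc (phis (- y)) * cos (psi y) /\
    complex.Im (phis (- y)) = - (normc (phis (- y)) * sin (psi y)).
  move=> /phase[Py E]; split=> //.
  move: E; move: (normc _) => r ->.
  by rewrite /= cosN sinN !mul0r subr0 addr0 mulrN.
have [xin|xout] := boolP (m <= x <= m + w).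
  have nxout : ~~ (m <= - x <= m + w) by move: xin; lra.
  rewrite (chi_out _ nxout) !mul0r addr0 subr0.
  have [Px [-> ->]] := expiE x xin.
  have -> : chi x * cos (psi x) * (normc (phis (- x)) * cos (psi x)) -
      chi x * sin (psi x) * - (normc (phis (- x)) * sin (psi x)) =
      normc (phis (- x)) * chi x * (cos (psi x) ^+ 2 + sin (psi x) ^+ 2) by ring.
  by rewrite cos2Dsin2 mulr1 ler_wpM2r.
rewrite (chi_out _ xout) !mul0r add0r sub0r mulr0.
have [xin|nxout] := boolP (m <= - x <= m + w); last first.
  by rewrite (chi_out _ nxout) !mul0r oppr0 mul0r subr0.
have := expiE _ xin; rewrite opprK -conjR => -[Px [-> Eim]].
rewrite conjI Eim.
have -> : chi (- x) * cos (psi (- x)) * (normc (phis x) * cos (psi (- x))) -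
    - (chi (- x) * sin (psi (- x))) * - - (normc (phis x) * sin (psi (- x))) =
    chi (- x) * normc (phis x) * (cos (psi (- x)) ^+ 2 + sin (psi (- x)) ^+ 2) by ring.
by rewrite cos2Dsin2 mulr1 mulr_ge0// (le_trans P0).
Qed.

End functional_difference.

(** * Decay bounds and constants for the modulated bump *)

Section power_weights.
Variable R : realType.

Lemma norm_Re_le (z : R[i]) : `|complex.Re z| <= normc z.
Proof. by case: z => x y /=; rewrite -sqrtr_sqr ler_wsqrtr// lerDl sqr_ge0. Qed.

Lemma norm_Im_le (z : R[i]) : `|complex.Im z| <= normc z.
Proof. by case: z => x y /=; rewrite -sqrtr_sqr ler_wsqrtr// lerDr sqr_ge0. Qed.

Lemma powR_sqr_half (x p : R) : 0 <= x -> (x ^+ 2) `^ (p / 2) = x `^ p.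
Proof. by move=> x0; rewrite -powR_mulrn// -powRrM mulrC divfK. Qed.

Lemma sobolev_decay_le (m x p : R) : 0 <= p -> 0 < m -> m <= x ->
  (x ^+ 2 + 1) `^ (- p / 2) <= m `^ (- p).
Proof.
move=> p0 m0 mx; rewrite -(powR_sqr_half _ (ltW m0)) mulNr !powRN.
have x2 : m ^+ 2 <= x ^+ 2 + 1.
  by rewrite ler_wpDr// lerXn2r// nnegrE ltW// (lt_le_trans m0).
have h : 0 < m ^+ 2 by rewrite exprn_gt0.
rewrite lef_pV2 ?posrE ?powR_gt0 ?(lt_le_trans h)//.
apply: ge0_ler_powR; rewrite ?divr_ge0 ?nnegrE ?addr_ge0 ?sqr_ge0//.
Qed.

Lemma sobolev_decay_ge (m x p : R) : 0 <= p -> 1 <= m -> 0 <= x <= 2 * m ->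
  5 `^ (- p / 2) * m `^ (- p) <= (x ^+ 2 + 1) `^ (- p / 2).
Proof.
move=> p0 m1 /andP[x0 xm]; have m0 : 0 <= m by lra.
rewrite -(powR_sqr_half _ m0) -powRM ?sqr_ge0// mulNr !powRN.
have x2 : x ^+ 2 + 1 <= 5 * m ^+ 2 by nra.
have h : 0 < x ^+ 2 + 1 by rewrite ltr_wpDl ?sqr_ge0.
rewrite lef_pV2 ?posrE ?powR_gt0 ?(lt_le_trans h)//.
by apply: ge0_ler_powR; rewrite ?divr_ge0 ?nnegrE ?mulr_ge0 ?addr_ge0 ?sqr_ge0.
Qed.

Lemma expR_powR_le (c p x y : R) : 0 <= c -> 0 <= p -> 0 <= x -> x <= y ->
  expR (- c * y `^ p) <= expR (- c * x `^ p).
Proof.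
move=> c0 p0 x0 xy; rewrite ler_expR ler_wnM2l ?oppr_le0//.
by apply: ge0_ler_powR; rewrite // nnegrE (le_trans x0).
Qed.

End power_weights.

Section modulated_bump.
Variables (R : realType) (g : R -> R) (Cg2 alpha beta gamma Cg tau : R).

Lemma fourier_decay (m x : R) : 0 < Cg2 -> 0 <= alpha -> 0 <= beta -> 0 <= gamma ->
  (forall w : R, normc (fourier g w) <=
     Cg2 * (w ^+ 2 + 1) `^ (- alpha / 2) * expR (- gamma * `|w| `^ beta)) ->
  0 < m -> m <= x ->
  normc (fourier g x) <= Cg2 * (m `^ (- alpha) * expR (- gamma * m `^ beta)).
Proof.
move=> C0 a0 b0 g0 hgs m0 mx; have x0 : 0 <= x by rewrite (le_trans (ltW m0)).
apply: (le_trans (hgs x)); rewrite -mulrA (ger0_norm x0).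
apply: ler_wpM2l; first exact: ltW.
apply: ler_pM; [exact: powR_ge0|exact: expR_ge0|exact: sobolev_decay_le|].
exact: expR_powR_le (ltW m0) mx.
Qed.

(** The logarithmic derivative bound transfers the decay of the transform of g to its derivative at
    the price of m^tau; the constant 3 comes from 1 + x <= 3m on [m, 2m]. *)
Lemma fourier_derivative_decay (m x Ag : R) : 0 < Cg -> 0 <= tau -> 0 <= Ag ->
  (forall w : R, fourier g w != 0 /\
     normc (cderive (fourier g) w) / normc (fourier g w) <= Cg * (1 + `|w|) `^ tau) ->
  1 <= m -> m <= x -> x <= 2 * m -> normc (fourier g x) <= Ag ->
  normc (cderive (fourier g) x) <= Cg * 3 `^ tau * m `^ tau * Ag.
Proof.
move=> C0 t0 Ag0 ratio m1 mx xm gAg; have [gx0 rx] := ratio x.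
have n0 : 0 < normc (fourier g x).
  rewrite lt_neqAle eq_sym (_ : 0 <= normc _) ?andbT; last first.
    by rewrite fourierE sqrtr_ge0.
  by apply: contra gx0 => /eqP/ComplexField.Normc.eq0_normc ->.
rewrite ler_pdivrMr// in rx; apply: (le_trans rx); apply: ler_pM => //.
- by rewrite mulr_ge0 ?powR_ge0// ltW.
- exact: ltW.
- rewrite -mulrA ler_wpM2l ?(ltW C0)// -powRM; [|lra|lra].
  rewrite ger0_norm; last by lra.
  by apply: ge0_ler_powR; rewrite // ?nnegrE; lra.
Qed.

Lemma sl_modulated (m w delta M : R) (psi u : R -> R) : 0 <= delta -> 0 < w ->
  (forall x y, `|u x - u y| <= `|x - y|) -> (forall x, `|u x| <= 1) ->
  (forall x y, m <= x <= m + w -> m <= y <= m + w ->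
     `|psi x - psi y| <= M * `|x - y|) ->
  supported_lipschitz (fun x => hat delta m w x * u (psi x)) m w
    delta (delta * (2 / w + M)).
Proof.
move=> d0 w0 uL u1 psiL.
apply: (sl_le (sl_mul (p := fun x => u (psi x)) (B := 1) (M := M) (hat_sl m d0 w0) _ _)).
- by move=> x _; exact: u1.
- by move=> x y xin yin; rewrite (le_trans (uL _ _))// psiL.
- by rewrite mulr1.
- by rewrite mulr1 mulrDr.
Qed.

Lemma sl_twisted (m w A L Ag M : R) (v1 v2 p1 p2 : R -> R) :
  supported_lipschitz v1 m w A L -> supported_lipschitz v2 m w A L ->
  (forall x, m <= x <= m + w -> `|p1 x| <= Ag /\ `|p2 x| <= Ag) ->
  (forall x y, m <= x <= m + w -> m <= y <= m + w ->
     `|p1 x - p1 y| <= M * `|x - y|) ->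
  (forall x y, m <= x <= m + w -> m <= y <= m + w ->
     `|p2 x - p2 y| <= M * `|x - y|) ->
  supported_lipschitz (fun x => v1 x * p1 x - v2 x * p2 x) m w
    (A * Ag + A * Ag) ((L * Ag + A * M) + (L * Ag + A * M)).
Proof.
move=> H1 H2 pA p1M p2M; apply: slD; last apply: slN.
  by apply: (sl_mul H1) => // x /pA[].
by apply: (sl_mul H2) => // x /pA[].
Qed.

(** The left side collects the squared height and slope of the modulated bump: 2/w is the slope of
    the hat and r that of the phase. The difference of the two sides is an explicit sum of
    squares. *)
Lemma sum_sqr_le (delta w r : R) : 0 < w -> 0 <= r ->
  delta ^+ 2 + (delta * (2 / w + r)) ^+ 2 <=
    (9 + 2 * r ^+ 2) * (delta ^+ 2 * (1 + w ^- 2)).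
Proof.
move=> w0 r0; have -> : w ^- 2 = (w^-1) ^+ 2 by rewrite exprVn.
move: (w^-1) => u; rewrite -subr_ge0.
have -> : (9 + 2 * r ^+ 2) * (delta ^+ 2 * (1 + u ^+ 2)) -
    (delta ^+ 2 + (delta * (2 * u + r)) ^+ 2) =
    delta ^+ 2 * ((2 * u - r) ^+ 2 + 8 + u ^+ 2 + 2 * r ^+ 2 * u ^+ 2) by ring.
rewrite mulr_ge0 ?sqr_ge0// !addr_ge0 ?sqr_ge0//.
by rewrite mulr_ge0 ?sqr_ge0// mulr_ge0// sqr_ge0.
Qed.

(** The analogue after multiplication by the transform of g, of size E and slope k t E; the doubled
    terms come from the two products in each real or imaginary part. *)
Lemma sum_sqr_twisted_le (delta w r E k t : R) : 0 < w ->
  (delta * E + delta * E) ^+ 2 +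
    ((delta * (2 / w + r) * E + delta * (k * t * E)) +
     (delta * (2 / w + r) * E + delta * (k * t * E))) ^+ 2 <=
  4 * (13 + 3 * r ^+ 2 + 3 * k ^+ 2) *
    (delta ^+ 2 * E ^+ 2 * (t ^+ 2 + 1 + w ^- 2)).
Proof.
move=> w0; have -> : w ^- 2 = (w^-1) ^+ 2 by rewrite exprVn.
move: (w^-1) => u; rewrite -subr_ge0.
have -> : 4 * (13 + 3 * r ^+ 2 + 3 * k ^+ 2) *
    (delta ^+ 2 * E ^+ 2 * (t ^+ 2 + 1 + u ^+ 2)) -
  ((delta * E + delta * E) ^+ 2 +
    ((delta * (2 * u + r) * E + delta * (k * t * E)) +
     (delta * (2 * u + r) * E + delta * (k * t * E))) ^+ 2) =
  4 * ((delta * E) ^+ 2 * ((2 * u - r) ^+ 2 + (2 * u - k * t) ^+ 2 + (r - k * t) ^+ 2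
   + 12 + u ^+ 2 + 13 * t ^+ 2 + 3 * r ^+ 2 * (t ^+ 2 + u ^+ 2) + 3 * k ^+ 2 * (1 + u ^+ 2))).
  by ring.
have h (x : R) := sqr_ge0 x.
rewrite mulr_ge0// mulr_ge0 ?h//.
have := h (2 * u - r); have := h (2 * u - k * t); have := h (r - k * t).
have := mulr_ge0 (h r) (h t); have := mulr_ge0 (h r) (h u); have := mulr_ge0 (h k) (h u).
by have := h u; have := h t; have := h k; lra.
Qed.

End modulated_bump.

(** The statistical problem is reduced here to three numbers m, w, delta. The first condition keeps
    both densities in the Sobolev ball, the second bounds the chi-square distance of n observations,
    and the conclusion carries the squared change of the functional. *)
Lemma minimax_risk_bump (R : realType) (phi g : R -> R) (phis : R -> R[i])
  (s B Cg2 Cphi1 alpha beta gamma a b d Cg tau omega0 rhomax : R) (rho : R -> R) :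
  0 <= s -> 0 < B -> is_pdf g -> is_fourier phi phis ->
  (forall f, Omega s B f -> parseval phi phis f) ->
  0 < Cg2 -> 0 < Cphi1 -> 0 <= alpha -> 0 <= beta -> 0 <= gamma ->
  0 <= a -> 0 <= b -> 0 <= d ->
  (forall w : R, normc (fourier g w) <=
     Cg2 * (w ^+ 2 + 1) `^ (- alpha / 2) * expR (- gamma * `|w| `^ beta)) ->
  (forall w : R, Cphi1 * (w ^+ 2 + 1) `^ (- a / 2) * expR (- d * `|w| `^ b)
     <= normc (phis w)) ->
  (forall w : R, cderivable (fourier g) w) -> 0 < Cg -> 0 <= tau ->
  (forall w : R, fourier g w != 0 /\
     normc (cderive (fourier g) w) / normc (fourier g w) <= Cg * (1 + `|w|) `^ tau) ->
  0 < omega0 ->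
  (forall w : R, omega0 < `|w| ->
     [/\ phis w = (normc (phis w))%:C%C * expi (rho w),
         derivable rho w 1 & `|derive1 rho w| <= rhomax]) ->
  exists c C m0 : R, [/\ 0 < c, 0 < C, 1 <= m0 & forall (n : nat) (m w delta : R),
    m0 <= m -> 0 < w -> w <= m -> 0 < delta ->
    delta ^+ 2 * (1 + w ^- 2) * w * m `^ (2 * s) <= c ->
    n%:R * (delta ^+ 2 * (m `^ (- alpha) * expR (- gamma * m `^ beta)) ^+ 2
      * ((m `^ tau) ^+ 2 + 1 + w ^- 2) * w) <= c ->
    ((C * (delta * w * (m `^ (- a) * expR (- d * (m + w) `^ b))) ^+ 2)%:E <=
      minimax_risk phi g (Omega s B) n)%E].
Proof.
move=> s0 B0 hg Fphi hPhi Cg20 Cphi0 alpha0 beta0 gamma0 a0 b0 d0 hgs hphis hder Cg0 tau0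
  ratio omega00 hrho.
have [c0 [c00 band]] := band_limited_two_points phi s0 B0 hg.
have r0 : 0 <= rhomax.
  have [|_ _] := hrho (omega0 + 1); first by rewrite gtr0_norm; lra.
  exact: le_trans.
pose k := Cg * 3 `^ tau.
pose K1 := 9 + 2 * rhomax ^+ 2.
pose K2 := 4 * (13 + 3 * rhomax ^+ 2 + 3 * k ^+ 2).
have K10 : 0 < K1 by rewrite /K1 ltr_pwDl// mulr_ge0// sqr_ge0.
have K20 : 0 < K2.
  by have := sqr_ge0 k; have := sqr_ge0 rhomax; rewrite /K2; clear; lra.
have pi20 : 0 < (2 * pi : R)^-1 by rewrite invr_gt0 mulr_gt0// pi_gt0.
have p50 : 0 < 5 `^ (- a / 2) :> R by rewrite powR_gt0.
(* The threshold omega0 + 1 keeps the bump where the phase is differentiable. In the second constant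
   5^(-a/2) is the loss in the decay of phi over [m, 2m], and 1/4 comes from the area of the hat. *)
exists (Num.min (c0 / K1) (c0 / (K2 * Cg2 ^+ 2))),
  (((2 * pi)^-1 * (Cphi1 * 5 `^ (- a / 2)) / 4) ^+ 2 / 16), (omega0 + 1); split.
- by rewrite lt_min !divr_gt0// mulr_gt0// exprn_gt0.
- by rewrite divr_gt0// exprn_gt0// divr_gt0// mulr_gt0// mulr_gt0.
- by rewrite lerDr ltW.
move=> n m w delta m0m w0 wm delta0.
rewrite !le_min => /andP[cond1 _] /andP[_ cond2].
have m1 : 1 <= m by clear -m0m omega00; lra.
have m0 : 0 < m by rewrite (lt_le_trans ltr01).
have mo : omega0 < m by clear -m0m; lra.
pose t := m `^ tau; pose E := m `^ (- alpha) * expR (- gamma * m `^ beta).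
have E0 : 0 <= E by rewrite mulr_ge0 ?powR_ge0 ?expR_ge0.
(* Parseval's formula evaluates [phis] at the opposite frequency, so this phase cancels it; rho
   itself is used on [-m-w, -m]. *)
pose psi x := - rho (- x).
pose v1 x := hat delta m w x * cos (psi x).
pose v2 x := hat delta m w x * sin (psi x).
have phase x : m <= x <= m + w -> omega0 < `|- x|.
  by move=> /andP[mx _]; rewrite normrN (lt_le_trans mo)// (le_trans mx)// ler_norm.
have psiL x y : m <= x <= m + w -> m <= y <= m + w ->
    `|psi x - psi y| <= rhomax * `|x - y|.
  move=> xin yin; have -> : psi x - psi y = - (rho (- x) - rho (- y)).
    by rewrite /psi; ring.
  have -> : `|x - y| = `|- x - - y| by rewrite -normrN; congr `|_|; ring.
  rewrite normrN; apply: (@derivable_lipschitz R rho (- (m + w)) (- m)).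
  - move=> z zin; have [|_ dz ez] // := hrho z.
    by rewrite -[z]opprK phase//; move: zin; clear; lra.
  - by move: xin; clear; lra.
  - by move: yin; clear; lra.
have H1 : supported_lipschitz v1 m w delta (delta * (2 / w + rhomax)).
  by apply: sl_modulated (ltW delta0) w0 _ _ psiL; [exact: cos_lipschitz|exact: norm_cos_le1].
have H2 : supported_lipschitz v2 m w delta (delta * (2 / w + rhomax)).
  by apply: sl_modulated (ltW delta0) w0 _ _ psiL; [exact: sin_lipschitz|exact: norm_sin_le1].
have gE x : m <= x -> normc (fourier g x) <= Cg2 * E by move=> mx; exact: fourier_decay.
have CgE0 : 0 <= Cg2 * E by rewrite mulr_ge0// ltW.
have Cfb x : m <= x -> `|Cf g x| <= Cg2 * E.
  move=> mx; rewrite (le_trans _ (gE x mx))//.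
  by have := norm_Re_le (fourier g x); rewrite {1}fourierE.
have Sfb x : m <= x -> `|Sf g x| <= Cg2 * E.
  move=> mx; rewrite (le_trans _ (gE x mx))//.
  by have := norm_Im_le (fourier g x); rewrite {1}fourierE.
have dE x : m <= x <= m + w -> normc (cderive (fourier g) x) <= k * t * (Cg2 * E).
  move=> /andP[mx xw]; apply: fourier_derivative_decay => //; last exact: gE.
  by clear -xw wm; lra.
have ReE : (fun x => complex.Re (fourier g x)) = Cf g.
  by apply/funext => x; rewrite fourierE.
have ImE : (fun x => complex.Im (fourier g x)) = Sf g.
  by apply/funext => x; rewrite fourierE.
have CfL x y : m <= x <= m + w -> m <= y <= m + w ->
    `|Cf g x - Cf g y| <= k * t * (Cg2 * E) * `|x - y|.
  apply: derivable_lipschitz => z zin; have [+ _] := hder z; rewrite ReE => dz.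
  split=> //; rewrite (le_trans _ (dE z zin))//.
  by have := norm_Re_le (cderive (fourier g) z); rewrite /= ReE.
have SfL x y : m <= x <= m + w -> m <= y <= m + w ->
    `|Sf g x - Sf g y| <= k * t * (Cg2 * E) * `|x - y|.
  apply: derivable_lipschitz => z zin; have [_ +] := hder z; rewrite ImE => dz.
  split=> //; rewrite (le_trans _ (dE z zin))//.
  by have := norm_Im_le (cderive (fourier g) z); rewrite /= ImE.
have H3 := sl_twisted (p1 := Cf g) (p2 := Sf g) (Ag := Cg2 * E) H1 H2
  (fun x xin => conj (Cfb x (andP xin).1) (Sfb x (andP xin).1)) CfL SfL.
have H4' := sl_twisted (p1 := Sf g) (p2 := fun x => - Cf g x) (Ag := Cg2 * E) H1 H2.
have H4 : supported_lipschitz (fun x => v1 x * Sf g x + v2 x * Cf g x) m w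
    (delta * (Cg2 * E) + delta * (Cg2 * E))
    (delta * (2 / w + rhomax) * (Cg2 * E) + delta * (k * t * (Cg2 * E)) +
     (delta * (2 / w + rhomax) * (Cg2 * E) + delta * (k * t * (Cg2 * E)))).
  rewrite (_ : (fun x => _) = (fun x => v1 x * Sf g x - v2 x * - Cf g x)); last first.
    by apply/funext => x; rewrite mulrN opprK.
  apply: H4' => //.
  - by move=> x /andP[mx _]; rewrite normrN Cfb// Sfb.
  - by move=> x y xin yin; rewrite -opprD normrN CfL.
have c1 : w * (delta ^+ 2 + (delta * (2 / w + rhomax)) ^+ 2) * m `^ (2 * s) <= c0.
  rewrite ler_pdivlMr// in cond1; apply: le_trans cond1.
  have -> : delta ^+ 2 * (1 + w ^- 2) * w * m `^ (2 * s) * K1 =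
    w * (K1 * (delta ^+ 2 * (1 + w ^- 2))) * m `^ (2 * s) by ring.
  rewrite ler_wpM2r ?powR_ge0// ler_wpM2l ?(ltW w0)//.
  exact: sum_sqr_le.
have c2 := sum_sqr_twisted_le delta rhomax (Cg2 * E) k t w0.
have {}c2 := ler_wpM2l (ler0n R n) (ler_wpM2l (ltW w0) c2).
have cond2' : n%:R * (w * (4 * (13 + 3 * rhomax ^+ 2 + 3 * k ^+ 2) *
    (delta ^+ 2 * (Cg2 * E) ^+ 2 * (t ^+ 2 + 1 + w ^- 2)))) <= c0.
  have K30 : 0 < K2 * Cg2 ^+ 2 by apply: mulr_gt0 => //; exact: exprn_gt0.
  rewrite (ler_pdivlMr _ _ K30) in cond2; apply: le_trans cond2.
  rewrite le_eqVlt; apply/orP; left; apply/eqP; rewrite -/K2 -/t -/E.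
  by move: (w ^- 2) => u; rewrite exprMn; ring.
have [f0 [f1 [f0O f1O dC dS]]] :=
  band n m w _ _ _ _ v1 v2 m1 wm H1 H2 H3 H4 c1 (le_trans c2 cond2').
apply: le_trans; rewrite lee_fin.
pose P := Cphi1 * 5 `^ (- a / 2) * (m `^ (- a) * expR (- d * (m + w) `^ b)).
have P0 : 0 <= P.
  by rewrite /P !mulr_ge0 ?powR_ge0 ?expR_ge0// ltW.
have hH := hat_sl m (ltW delta0) w0.
have D : (2 * pi)^-1 * (P * Rintegral \mu setT (hat delta m w)) <= Phi phi f1 - Phi phi f0.
  apply: (@Phi_difference_ge R phi phis f0 f1 (hat delta m w) psi m w P) => //.
  - exact: hPhi.
  - exact: hPhi.
  - exact: (sl_L1 hH).
  - by move=> x; rewrite hat_ge0// ltW.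
  - exact: (sl_support hH).
  - move=> x xin; have [e _ _] := hrho _ (phase x xin); split; last by rewrite opprK.
    move: xin => /andP[mx xw]; apply: le_trans (hphis (- x)); rewrite sqrrN normrN.
    have x0 : 0 <= x by rewrite (le_trans (ltW m0)).
    rewrite (ger0_norm x0) /P mulrA; apply: ler_pM.
    - by rewrite mulr_ge0 ?powR_ge0// mulr_ge0 ?powR_ge0// ltW.
    - exact: expR_ge0.
    - rewrite -mulrA; apply: ler_wpM2l; first exact: ltW.
      apply: sobolev_decay_ge => //; rewrite x0/=.
      by move: xw wm; clear; lra.
    - exact: expR_powR_le x0 xw.
have hi := hat_integral_ge m (ltW delta0) w0.
have D' : (2 * pi)^-1 * (P * (delta * w / 4)) <= Phi phi f1 - Phi phi f0.
  by apply: le_trans D; rewrite ler_wpM2l ?(ltW pi20)// ler_wpM2l.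
have X0 : 0 <= (2 * pi)^-1 * (P * (delta * w / 4)).
  apply: mulr_ge0; first exact: ltW.
  by rewrite mulr_ge0// divr_ge0// mulr_ge0// ltW.
rewrite mulrAC ler_wpM2r// -exprMn.
apply: (@le_trans _ _ (((2 * pi)^-1 * (P * (delta * w / 4))) ^+ 2)).
  rewrite le_eqVlt; apply/orP; left; apply/eqP; congr (_ ^+ 2).
  by rewrite /P; move: (2 * pi)^-1 => p; ring.
by rewrite lerXn2r// nnegrE (le_trans X0).
Qed.

(** * Rates *)

Section real_powers.
Variable R : realType.

Lemma powR_expR (x p : R) : 0 < x -> x `^ p = expR (p * ln x).
Proof. by move=> x0; rewrite /powR gt_eqF. Qed.

Lemma powR_le1 (x p : R) : 1 <= x -> p <= 0 -> x `^ p <= 1.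
Proof.
move=> x1 p0; rewrite powR_expR ?(lt_le_trans ltr01)// -expR0 ler_expR.
by rewrite mulr_le0_ge0// ln_ge0.
Qed.

Lemma powR_sqr (x p : R) : (x `^ p) ^+ 2 = x `^ (2 * p).
Proof. by rewrite -powR_mulrn ?powR_ge0// -powRrM mulrC. Qed.

Lemma expR_le_chord (y : R) : expR y <= 1 + y * expR y.
Proof.
have h := expR_ge1Dx (- y); have e0 := expR_gt0 y.
have : expR y * (1 - y) <= expR y * expR (- y) by rewrite ler_wpM2l// ltW.
rewrite -expRD subrr expR0; lra.
Qed.

(* With [w = m^(1-b)] the factor [(m+w)^b] exceeds [m^b] by a bounded amount only. *)
Lemma powR_add_le (b m : R) : 0 <= b -> 1 <= m ->
  (m + m `^ (1 - b)) `^ b <= m `^ b + b * expR b.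
Proof.
move=> b0 m1; have m0 : 0 < m by rewrite (lt_le_trans ltr01).
have -> : m + m `^ (1 - b) = m * (1 + m `^ (- b)).
  rewrite mulrDr mulr1; congr (_ + _).
  rewrite -{2}(@lnK _ m) ?posrE// !powR_expR// -expRD; congr expR; ring.
have u0 : 0 <= m `^ (- b) by exact: powR_ge0.
have u1 : m `^ (- b) <= 1 by rewrite powR_le1// oppr_le0.
have mbu : m `^ b * m `^ (- b) = 1.
  by rewrite !powR_expR// -expRD -(expR0 R); congr expR; ring.
rewrite powRM ?(ltW m0) ?addr_ge0//; move: u0 u1 mbu; move: (m `^ (- b)) => u u0 u1 mbu.
apply: (@le_trans _ _ (m `^ b * (1 + b * u * expR b))).
  rewrite ler_wpM2l ?powR_ge0// powR_expR ?ltr_pwDl//.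
  apply: (@le_trans _ _ (expR (b * u))).
    rewrite ler_expR ler_wpM2l// -ler_expR lnK ?expR_ge1Dx// posrE ltr_pwDl//.
  apply: (le_trans (expR_le_chord _)).
  by rewrite lerD2l ler_wpM2l ?mulr_ge0// ler_expR ler_piMr.
have -> : m `^ b * (1 + b * u * expR b) = m `^ b + b * expR b * (m `^ b * u) by ring.
by rewrite mbu mulr1.
Qed.

(** After division by x^t this is (1 + z)^t <= 1 + z with z = y/x. It bounds the effect of a small
    shift y on a power of x with exponent at most 1. *)
Lemma powR_subadditive_le (x y t : R) : 0 < x -> 0 <= y -> 0 <= t -> t <= 1 ->
  (x + y) `^ t <= x `^ t + y * x `^ (t - 1).
Proof.
move=> x0 y0 t0 t1.
have -> : x + y = x * (1 + y / x) by rewrite mulrDr mulr1 mulrC divfK ?gt_eqF.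
have z0 : 0 <= y / x by rewrite divr_ge0// ltW.
have -> : x `^ t + y * x `^ (t - 1) = x `^ t * (1 + y / x).
  rewrite mulrDr mulr1; congr (_ + _).
  rewrite powRB ?(gt_eqF x0) ?implybT// powRr1 ?(ltW x0)//; ring.
rewrite powRM ?(ltW x0) ?addr_ge0// ler_wpM2l ?powR_ge0//.
rewrite -[leRHS]powRr1 ?addr_ge0//; apply: ler_powR => //.
by rewrite lerDl.
Qed.

Lemma ln_le_powR (x e : R) : 0 < e -> 0 < x -> ln x <= x `^ e / e.
Proof.
move=> e0 x0; rewrite ler_pdivlMr// mulrC powR_expR//.
by have := expR_ge1Dx (e * ln x); lra.
Qed.

Lemma ln_nat_unbounded (X : R) : exists N : nat, forall n, (N <= n)%N -> X <= ln n%:R.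
Proof.
exists (Num.truncn (expR X)).+1 => n nN.
have h : expR X < n%:R by rewrite (lt_le_trans (truncnS_gt _))// ler_nat.
by rewrite -ler_expR lnK ?(ltW h)// posrE (lt_trans (expR_gt0 _) h).
Qed.

(** As ln L <= 2 sqrt L, the logarithmic term is at most L/4 once L >= 64 p^2, and |k| <= L/4 once L
    >= 4 |k|. *)
Lemma log_correction_le (p k : R) : exists X, 1 <= X /\ forall L, X <= L ->
  L / 2 <= L - p * ln L + k <= 2 * L.
Proof.
exists (1 + 64 * p ^+ 2 + 4 * `|k|); split.
  by have := sqr_ge0 p; have := normr_ge0 k; lra.
move=> L XL; have p2 := sqr_ge0 p; have k0 := normr_ge0 k.
have L1' : 1 <= L by move: XL p2 k0; clear; lra.
have L0 : 0 < L := lt_le_trans ltr01 L1'.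
have ln0 : 0 <= ln L by exact: ln_ge0.
have h : ln L <= 2 * Num.sqrt L.
  have := ln_le_powR (_ : 0 < 2^-1 :> R) L0; rewrite invr_gt0 => /(_ (ltr0Sn _ _)).
  by rewrite invrK powR12_sqrt ?(ltW L0)// mulrC.
pose r := Num.sqrt L; have r0 : 0 <= r by exact: sqrtr_ge0.
have rr : r ^+ 2 = L by rewrite sqr_sqrtr// ltW.
have pr : `|p| * (8 * r) <= L.
  have : 8 * `|p| <= r.
    
    rewrite -(@ler_pXn2r _ 2) ?nnegrE ?mulr_ge0// ?sqrtr_ge0//.
    rewrite rr exprMn real_normK ?num_real//; move: XL k0; clear; lra.
  by rewrite -rr; move: r0; clear; nra.
have pl : `|p * ln L| <= L / 4.
  rewrite normrM (ger0_norm ln0).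
  have : `|p| * ln L <= `|p| * (2 * r) by rewrite ler_wpM2l.
  by move: pr; clear; lra.
have kL : `|k| <= L / 4 by move: XL p2; clear; lra.
by move: pl kL L0; rewrite !ler_norml; clear; lra.
Qed.

(** M is comparable to L with fixed ratios; adding the powers of both extreme ratios gives one bound
    for either sign of r. *)
Lemma powR_sandwich (g L M r : R) : 0 < g -> 0 < L -> L / (4 * g) <= M -> M <= L / g ->
  M `^ r <= L `^ r * (g^-1 `^ r + (4 * g)^-1 `^ r).
Proof.
move=> g0 L0 lM Mu; have g4 : 0 < 4 * g by rewrite mulr_gt0.
have M0 : 0 < M by apply: lt_le_trans lM; rewrite divr_gt0.
rewrite mulrDr -!powRM ?invr_ge0 ?(ltW L0) ?(ltW g0) ?(ltW g4)//.
have [r0|r0] := leP 0 r.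
  rewrite ler_wpDr ?powR_ge0//; apply: ge0_ler_powR => //.
  - by rewrite nnegrE ltW.
  - by rewrite nnegrE divr_ge0 ?ltW.
rewrite ler_wpDl ?powR_ge0// -[r]opprK !(powRN _ (- r)).
rewrite lef_pV2 ?posrE ?powR_gt0 ?divr_gt0//; apply: ge0_ler_powR => //.
- by rewrite oppr_ge0 ltW.
- by rewrite nnegrE divr_ge0 ?ltW.
- by rewrite nnegrE ltW.
Qed.

End real_powers.

(** * Choice of frequency, width and height of the bump *)

Section rates.
Variable R : realType.
Variables (V : nat -> \bar R) (s alpha beta gamma a b d tau c C m0 : R).
Variables (s0 : 0 <= s) (b0 : 0 <= b) (d0 : 0 <= d) (tau0 : 0 <= tau)
  (c0 : 0 < c) (C0 : 0 < C) (m01 : 1 <= m0).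
Variable bump : forall (n : nat) (m w delta : R),
    m0 <= m -> 0 < w -> w <= m -> 0 < delta ->
    delta ^+ 2 * (1 + w ^- 2) * w * m `^ (2 * s) <= c ->
    n%:R * (delta ^+ 2 * (m `^ (- alpha) * expR (- gamma * m `^ beta)) ^+ 2
      * ((m `^ tau) ^+ 2 + 1 + w ^- 2) * w) <= c ->
    ((C * (delta * w * (m `^ (- a) * expR (- d * (m + w) `^ b))) ^+ 2)%:E <= V n)%E.

Definition lower_rate (r : nat -> R) : Prop :=
  exists K, 0 < K /\ exists N : nat, forall n, (N <= n)%N -> ((K * r n)%:E <= V n)%E.

Lemma bump_sqr (n : nat) (m w D : R) :
    m0 <= m -> 0 < w -> w <= m -> 0 < D ->
    D * (1 + w ^- 2) * w * m `^ (2 * s) <= c ->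
    n%:R * (D * (m `^ (- alpha) * expR (- gamma * m `^ beta)) ^+ 2
      * ((m `^ tau) ^+ 2 + 1 + w ^- 2) * w) <= c ->
    ((C * (D * (w * (m `^ (- a) * expR (- d * (m + w) `^ b))) ^+ 2))%:E <= V n)%E.
Proof.
move=> m0m w0 wm D0 c1 c2; have D2 : Num.sqrt D ^+ 2 = D by rewrite sqr_sqrtr// ltW.
have := @bump n m w (Num.sqrt D) m0m w0 wm; rewrite sqrtr_gt0 D2 => /(_ D0 c1 c2).
by rewrite -(mulrA (Num.sqrt D)) exprMn D2.
Qed.

Lemma parametric_rate : lower_rate (fun n => n%:R^-1).
Proof.
have mp : 0 < m0 by rewrite (lt_le_trans ltr01).
pose X := (m0 `^ (- alpha) * expR (- gamma * m0 `^ beta)) ^+ 2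
      * ((m0 `^ tau) ^+ 2 + 1 + 1 ^- 2).
have X0 : 0 < X.
  rewrite mulr_gt0//; first by rewrite exprn_gt0// mulr_gt0 ?powR_gt0 ?expR_gt0.
  by rewrite expr1n invr1 -addrA ltr_wpDl ?sqr_ge0.
pose Y := 2 * m0 `^ (2 * s).
have Y0 : 0 < Y by rewrite mulr_gt0 ?powR_gt0.
pose k := Num.min (c / X) (c / Y).
have k0 : 0 < k by rewrite lt_min !divr_gt0.
pose F := (1 * (m0 `^ (- a) * expR (- d * (m0 + 1) `^ b))) ^+ 2.
have F0 : 0 < F by rewrite /F mul1r exprn_gt0// mulr_gt0 ?powR_gt0 ?expR_gt0.
exists (C * (k * F)); split; first by rewrite mulr_gt0// mulr_gt0.
exists 1%N => n n1; have n0 : 0 < n%:R :> R by rewrite ltr0n.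
have -> : C * (k * F) / n%:R = C * (k / n%:R * F) by ring.
apply: bump_sqr => //.
- exact: divr_gt0.
- rewrite expr1n invr1 mulr1 -mulrA -/Y.
  rewrite -ler_pdivlMr//; apply: (@le_trans _ _ k); last by rewrite ge_min lexx orbT.
  by rewrite ler_pdivrMr// ler_peMr ?(ltW k0)// ler1n.
- apply: (@le_trans _ _ (k * X)); last by rewrite -ler_pdivlMr// ge_min lexx.
  rewrite mulr1 -[k / _ * _ * _]mulrA -/X le_eqVlt; apply/orP; left; apply/eqP.
  by field; rewrite gt_eqF.
Qed.

(* Bump of width [m^(1-b)] and squared height of order [m^(-2s-1-6b)]. *)
Lemma bump_scaled : exists c' C', [/\ 0 < c', 0 < C' & forall (n : nat) (m : R), m0 <= m ->
  n%:R * (expR (- (2 * gamma) * m `^ beta) * m `^ (- (2 * s + 7 * b + 2 * alpha)) *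
    (m `^ (2 * tau) + 1 + m `^ (2 * b - 2))) <= c' ->
  ((C' * (m `^ (- (2 * a + 2 * s + 8 * b - 1)) *
    expR (- (2 * d) * (m + m `^ (1 - b)) `^ b)))%:E <= V n)%E].
Proof.
exists 2, (C * (c / 2)); split=> //; first by rewrite mulr_gt0// divr_gt0.
move=> n m m0m cond.
have m1 : 1 <= m := le_trans m01 m0m; have mp : 0 < m := lt_le_trans ltr01 m1.
pose w := m `^ (1 - b); have w0 : 0 < w by exact: powR_gt0.
have wm : w <= m.
  rewrite -[leRHS]powRr1 ?(ltW mp)//; apply: ler_powR => //.
  by rewrite gerBl.
(* With w = m^(1-b) the Sobolev condition becomes (c/2)(m^(-7b) + m^(-5b-2)) <= c. Multiplying D by
   w^2 m^(-2a) gives the exponent -(2a+2s+8b-1), and by w m^(-2 alpha) the exponent -(2s+7b+2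
   alpha). *)
pose D := c / 2 * m `^ (- 2 * s - 1 - 6 * b).
have D0 : 0 < D by rewrite mulr_gt0 ?powR_gt0// divr_gt0.
have w2 : w ^- 2 = m `^ (2 * b - 2).
  by rewrite powR_sqr -powRN; congr (_ `^ _); ring.
have E (p q r : R) : r = p + q -> m `^ r = m `^ p * m `^ q.
  by move=> ->; rewrite powRD// (gt_eqF mp) implybT.
have -> : C * (c / 2) * (m `^ (- (2 * a + 2 * s + 8 * b - 1)) *
    expR (- (2 * d) * (m + w) `^ b)) =
  C * (D * (w * (m `^ (- a) * expR (- d * (m + w) `^ b))) ^+ 2).
  have -> : - (2 * d) * (m + w) `^ b = - d * (m + w) `^ b + - d * (m + w) `^ b by ring.
  rewrite expRD (E (- 2 * s - 1 - 6 * b) ((1 - b) + (1 - b) + (- a + - a))); last by ring.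
  rewrite (E ((1 - b) + (1 - b)) (- a + - a) _ erefl) (E (1 - b) (1 - b) _ erefl).
  rewrite (E (- a) (- a) _ erefl).
  by rewrite /D -/w; ring.
apply: bump_sqr => //.
- rewrite w2 /D.
  have -> : c / 2 * m `^ (- 2 * s - 1 - 6 * b) * (1 + m `^ (2 * b - 2)) * w * m `^ (2 * s) =
     c / 2 * (m `^ (- (7 * b)) + m `^ (- 5 * b - 2)).
    rewrite (E (- 2 * s - 1 - 6 * b) (1 - b + 2 * s) (- (7 * b))); last by ring.
    rewrite (E (- 2 * s - 1 - 6 * b) (2 * b - 2 + (1 - b + 2 * s)) (- 5 * b - 2)); last by ring.
    by rewrite (E (2 * b - 2) (1 - b + 2 * s) _ erefl) (E (1 - b) (2 * s) _ erefl) -/w; ring.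
  rewrite -mulrA ler_piMr ?(ltW c0)// ler_pdivrMl// mulr1.
  rewrite (_ : 2 = 1 + 1)//; apply: lerD; apply: powR_le1 => //.
    by rewrite oppr_le0 mulr_ge0.
  by have := b0; lra.
- rewrite w2 !powR_sqr; apply: le_trans (_ : c / 2 * 2 <= c); last by rewrite divfK.
  apply: le_trans (ler_wpM2l (ltW (divr_gt0 c0 (@ltr0Sn R 1))) cond).
  have -> : (m `^ (- alpha) * expR (- gamma * m `^ beta)) ^+ 2 =
     m `^ (- (2 * alpha)) * expR (- (2 * gamma) * m `^ beta).
    rewrite exprMn powR_sqr mulrN; congr (_ * _); rewrite expr2 -expRD; congr expR; ring.
  rewrite (E (- 2 * s - 1 - 6 * b) (1 - b + - (2 * alpha))
    (- (2 * s + 7 * b + 2 * alpha))); last by ring.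
  rewrite (E (1 - b) (- (2 * alpha)) _ erefl) /D -/w.
  by rewrite le_eqVlt; apply/orP; left; apply/eqP; ring.
Qed.

Lemma polynomial_rate : b = 0 -> d = 0 -> gamma = 0 -> tau = 0 -> 0 < alpha ->
  lower_rate (fun n => n%:R `^ (- ((2 * s + 2 * a - 1) / (2 * s + 2 * alpha)))).
Proof.
move=> b_0 d_0 gamma_0 tau_0 alpha_gt0.
have [c' [C' [c'0 C'0]]] := bump_scaled.
rewrite b_0 d_0 gamma_0 tau_0 !mulr0 !oppr0 !addr0 add0r => H.
pose q := 2 * s + 2 * alpha.
have q0 : 0 < q by rewrite ltr_wpDl ?mulr_ge0 ?mulr_gt0.
(* The frequency will solve m^(2s + 2 alpha) = k n; the 3 bounds the sum 1 + 1 + m^(-2) left in the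
   chi-square condition. *)
pose k := 3 / c'; have k0 : 0 < k by exact: divr_gt0.
exists (C' * k `^ (- ((2 * s + 2 * a - 1) / q))); split.
  by rewrite mulr_gt0 ?powR_gt0.
exists (Num.truncn (m0 `^ q / k)).+1 => n nN.
have nm : m0 `^ q / k <= n%:R.
  by rewrite (le_trans (ltW (truncnS_gt _)))// ler_nat.
have n0 : (0 : R) < n%:R.
  by apply: lt_le_trans nm; rewrite divr_gt0// powR_gt0// (lt_le_trans ltr01).
have kn0 : 0 < k * n%:R by exact: mulr_gt0.
pose m := (k * n%:R) `^ q^-1.
have mq r : m `^ r = (k * n%:R) `^ (r / q) by rewrite -powRrM (mulrC q^-1).
have m0m : m0 <= m.
  have -> : m0 = (m0 `^ q) `^ q^-1.
    by rewrite -powRrM mulfV ?gt_eqF// powRr1// (le_trans ler01).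
  apply: ge0_ler_powR; rewrite ?invr_ge0 ?(ltW q0)// ?nnegrE ?powR_ge0 ?(ltW kn0)//.
  by rewrite mulrC -ler_pdivrMr.
have m1 : 1 <= m := le_trans m01 m0m.
have := H n m m0m; rewrite !mul0r expR0 mul1r mulr1 -/q !powRr0 => Hn.
have -> : C' * k `^ (- ((2 * s + 2 * a - 1) / q)) * n%:R `^ (- ((2 * s + 2 * a - 1) / q)) =
    C' * m `^ (- (2 * a + 2 * s - 1)).
  rewrite -mulrA -powRM ?(ltW k0) ?(ltW n0)// mq; congr (_ * _ `^ _); ring.
apply: Hn; rewrite mq mulNr divff ?gt_eqF// powRN powRr1 ?(ltW kn0)//.
have h : m `^ (- 2) <= 1 by apply: powR_le1 => //; rewrite oppr_le0.
have -> : n%:R * ((k * n%:R)^-1 * (1 + 1 + m `^ (- 2))) = c' / 3 * (1 + 1 + m `^ (- 2)).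
  by rewrite /k; field; rewrite !gt_eqF.
by move: h c'0; move: (m `^ _) => u h c'0; nra.
Qed.

Section logarithmic.
Variables (beta_gt0 : 0 < beta) (gamma_gt0 : 0 < gamma).

(** The growth exponent of m^(2 tau) + 1 + m^(2b-2), that is, the larger of the squared slopes of
    the transform of g and of the bump, relative to their heights. When b = beta, U_tau is 7 beta -
    1 - [excess]. *)
Let excess := Num.max (Num.max (2 * tau) (2 * b - 2)) 0.
Let p := (2 * s + 7 * b + 2 * alpha - excess) / beta.

(* The exponent [p] makes [n e^(-2 gamma M) m^(-(2s+7b+2alpha)) m^excess], the
   chi-square distance for [m^beta = M], of order 1. *)
Lemma logarithmic_bump : exists K k : R, 0 < K /\ exists N : nat, forall n : nat, (N <= n)%N ->
  let L := ln n%:R in let M := (L - p * ln L + k) / (2 * gamma) in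
  [/\ 0 < n%:R :> R, 1 <= L, 0 < M &
    ((K * (L `^ (- ((2 * a + 2 * s + 8 * b - 1) / beta)) *
      expR (- (2 * d) * M `^ (b / beta))))%:E <= V n)%E].
Proof.
have [c' [C' [c'0 C'0 H]]] := bump_scaled.
pose up (r : R) := gamma^-1 `^ r + (4 * gamma)^-1 `^ r.
have up0 r : 0 < up r.
  by rewrite addr_gt0 ?powR_gt0 ?invr_gt0// mulr_gt0.
pose U4 := 2 * a + 2 * s + 8 * b - 1.
(* Shifting M by this constant divides the chi-square quantity by exp(k), which brings its leftover
   constant 3 up(-p) down to exactly c'. *)
pose k := ln (3 * up (- p) / c').
(* The factor with [up] accounts for replacing m^(-U4) by a power of L, the exponential for the
   bounded growth b e^b of (m + w)^b over m^b. *)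
exists (C' * (up (U4 / beta))^-1 * expR (- (2 * d) * (b * expR b))), k; split.
  by rewrite !mulr_gt0 ?invr_gt0 ?expR_gt0.
have [X [X1 HX]] := log_correction_le p k.
(* The first threshold makes M comparable to L, the second then forces m >= m0. *)
have [N HN] := ln_nat_unbounded (Num.max X (4 * gamma * m0 `^ beta)).
exists (maxn N 1) => n; rewrite geq_max => /andP[nN n1] L M.
have n0 : (0 : R) < n%:R by rewrite ltr0n.
have := HN n nN; rewrite ge_max -/L => /andP[XL mL].
have L1' : 1 <= L := le_trans X1 XL; have L0 : 0 < L := lt_le_trans ltr01 L1'.
have /andP[lo hi] := HX L XL.
have lM : L / (4 * gamma) <= M.
  have -> : L / (4 * gamma) = L / 2 / (2 * gamma) by field; rewrite gt_eqF.
  by rewrite ler_wpM2r// invr_ge0 mulr_ge0// ltW.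
have uM : M <= L / gamma.
  have -> : L / gamma = 2 * L / (2 * gamma) by field; rewrite gt_eqF.
  by rewrite ler_wpM2r// invr_ge0 mulr_ge0// ltW.
have M0 : 0 < M by apply: lt_le_trans lM; rewrite divr_gt0// mulr_gt0.
split=> //.
pose m := M `^ beta^-1.
have mq r : m `^ r = M `^ (r / beta) by rewrite -powRrM (mulrC beta^-1).
have mbeta : m `^ beta = M by rewrite mq divff ?gt_eqF// powRr1// ltW.
have m0m : m0 <= m.
  have m00 : 0 <= m0 by rewrite (le_trans ler01).
  have -> : m0 = (m0 `^ beta) `^ beta^-1.
    by rewrite -powRrM mulfV ?gt_eqF// powRr1.
  apply: ge0_ler_powR; rewrite ?invr_ge0 ?(ltW beta_gt0)// ?nnegrE ?powR_ge0 ?(ltW M0)//.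
  by apply: le_trans lM; rewrite ler_pdivlMr ?mulr_gt0// mulrC.
have m1 : 1 <= m := le_trans m01 m0m; have mp : 0 < m := lt_le_trans ltr01 m1.
have cond : n%:R * (expR (- (2 * gamma) * m `^ beta) *
    m `^ (- (2 * s + 7 * b + 2 * alpha)) * (m `^ (2 * tau) + 1 + m `^ (2 * b - 2))) <= c'.
  have nE : n%:R * expR (- (2 * gamma) * m `^ beta) = L `^ p * expR (- k).
    rewrite mbeta -[n%:R]lnK ?posrE// -/L powR_expR// -!expRD; congr expR.
    by rewrite /M; field; rewrite gt_eqF.
  have tail : m `^ (2 * tau) + 1 + m `^ (2 * b - 2) <= 3 * m `^ excess.
    have e1 : m `^ (2 * tau) <= m `^ excess by rewrite ler_powR// !le_max lexx.
    have e2 : m `^ (2 * b - 2) <= m `^ excess by rewrite ler_powR// !le_max lexx orbT.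
    have e3 : 1 <= m `^ excess by rewrite -(powRr0 m) ler_powR// le_max lexx orbT.
    by move: e1 e2 e3; move: (m `^ _) (m `^ _) (m `^ _) => x y z; lra.
  rewrite mulrA mulrA nE.
  apply: (@le_trans _ _ (L `^ p * expR (- k) * m `^ (- (2 * s + 7 * b + 2 * alpha)) *
    (3 * m `^ excess))).
    by rewrite ler_wpM2l// !mulr_ge0 ?powR_ge0 ?expR_ge0.
  have -> : L `^ p * expR (- k) * m `^ (- (2 * s + 7 * b + 2 * alpha)) * (3 * m `^ excess) =
     3 * expR (- k) * L `^ p * (m `^ (- (2 * s + 7 * b + 2 * alpha)) * m `^ excess) by ring.
  rewrite -powRD; last by rewrite (gt_eqF mp) implybT.
  rewrite mq (_ : _ / beta = - p); last by rewrite /p; field; rewrite gt_eqF.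
  apply: (@le_trans _ _ (3 * expR (- k) * L `^ p * (L `^ (- p) * up (- p)))).
    rewrite ler_wpM2l//; first by rewrite !mulr_ge0 ?powR_ge0 ?expR_ge0.
    exact: powR_sandwich.
  have kE : expR (- k) * (3 * up (- p)) = c'.
    rewrite expRN lnK ?posrE ?divr_gt0 ?mulr_gt0//.
    by move: (up0 (- p)); move: (up _) => u u0; field; rewrite !gt_eqF.
  have -> : 3 * expR (- k) * L `^ p * (L `^ (- p) * up (- p)) =
    L `^ p * L `^ (- p) * (expR (- k) * (3 * up (- p))) by ring.
  by rewrite kE -powRD ?subrr ?powRr0 ?mul1r// (gt_eqF L0) implybT.
apply: le_trans (H n m m0m cond); rewrite lee_fin -/U4.
have hb := powR_add_le b0 m1.
have eb : expR (- (2 * d) * (b * expR b)) * expR (- (2 * d) * M `^ (b / beta)) <=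
    expR (- (2 * d) * (m + m `^ (1 - b)) `^ b).
  rewrite -expRD ler_expR -mulrDr ler_wnM2l ?oppr_le0 ?mulr_ge0//.
  by rewrite (addrC (b * expR b)) -mq.
have eL : (up (U4 / beta))^-1 * L `^ (- (U4 / beta)) <= m `^ (- U4).
  rewrite mq mulNr !powRN -invfM lef_pV2 ?posrE ?(mulr_gt0 (up0 _)) ?powR_gt0//.
  by rewrite [leRHS]mulrC; exact: powR_sandwich.
have -> : C' * (up (U4 / beta))^-1 * expR (- (2 * d) * (b * expR b)) *
    (L `^ (- (U4 / beta)) * expR (- (2 * d) * M `^ (b / beta))) =
  C' * ((up (U4 / beta))^-1 * L `^ (- (U4 / beta)) *
   (expR (- (2 * d) * (b * expR b)) * expR (- (2 * d) * M `^ (b / beta)))) by ring.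
rewrite ler_wpM2l ?(ltW C'0)// ler_pM// ?mulr_ge0 ?expR_ge0 ?powR_ge0//.
by rewrite invr_ge0 ltW.
Qed.

(** For b = beta the exponential is linear in M, so exp(-2dM) equals L^(p d / gamma) n^(-d / gamma)
    up to a constant: the logarithmic correction of M is not negligible but changes the power of L.
    This is how U4 turns into U3. *)
Lemma critical_rate : b = beta -> d <= gamma ->
  let Utau := Num.min (7 * beta - 2 * tau - 1) (5 * beta + 1) in
  let U3 := 2 * a + 2 * s * (1 - d / gamma) - 2 * d * alpha / gamma
            + 8 * beta - (Utau + 1) * d / gamma - 1 in
  lower_rate (fun n => (ln n%:R) `^ (- (U3 / beta)) * n%:R `^ (- (d / gamma))).
Proof.
move=> b_beta d_gamma Utau U3.
have [K [k [K0 [N HN]]]] := logarithmic_bump.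
exists (K * expR (- (d / gamma * k))); split; first by rewrite mulr_gt0 ?expR_gt0.
exists N => n nN; have [n0 L1' M0] := HN n nN; apply: le_trans.
have L0 : 0 < ln (n%:R : R) := lt_le_trans ltr01 L1'.
rewrite b_beta divff ?gt_eqF// powRr1 ?(ltW M0)// lee_fin -(mulrA K) ler_wpM2l ?(ltW K0)//.
move: M0; set M := (_ / (2 * gamma)) => M0.
have -> : expR (- (2 * d) * M) =
    ln n%:R `^ (d / gamma * p) * (expR (- (d / gamma * k)) * n%:R `^ (- (d / gamma))).
  rewrite (powR_expR _ L0) (powR_expR _ n0) -!expRD; congr expR.
  by rewrite /M; field; rewrite gt_eqF.
rewrite mulrCA [leRHS]mulrA.
have E0 : 0 <= expR (- (d / gamma * k)) * n%:R `^ (- (d / gamma)).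
  by rewrite mulr_ge0 ?expR_ge0 ?powR_ge0.
rewrite -powRD; last by rewrite (gt_eqF L0) implybT.
rewrite ler_wpM2r//; apply: ler_powR => //.
have r0 : 0 <= d / gamma by rewrite divr_ge0// ltW.
have gap : 0 <= 7 * beta - excess - Utau - 1.
  have u1 : Utau <= 7 * beta - 2 * tau - 1 by rewrite ge_min lexx.
  have u2 : Utau <= 5 * beta + 1 by rewrite ge_min lexx orbT.
  have : excess <= 7 * beta - 1 - Utau.
    by rewrite !ge_max b_beta; have := tau0; move: u1 u2; lra.
  by lra.
have -> : - ((2 * a + 2 * s + 8 * beta - 1) / beta) + d / gamma * p =
    - (U3 / beta) + d / gamma * (7 * beta - excess - Utau - 1) / beta.
  by rewrite /p /U3 b_beta; field; rewrite !gt_eqF.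
by rewrite lerDl; apply: divr_ge0; [exact: mulr_ge0|exact: ltW].
Qed.

(** With exponent b / beta < 1 the correction of order ln L in M moves M^(b / beta) by at most a
    multiple of ln L times L^(b / beta - 1), which is bounded. It therefore costs only a constant
    factor. *)
Lemma subcritical_rate : b < beta ->
  lower_rate (fun n => (ln n%:R) `^ (- ((2 * a + 2 * s + 8 * b - 1) / beta)) *
    expR (- 2 * d * (ln n%:R / (2 * gamma)) `^ (b / beta))).
Proof.
move=> b_beta; have [K [k [K0 [N HN]]]] := logarithmic_bump.
pose e := 1 - b / beta.
have t1 : b / beta < 1 by rewrite ltr_pdivrMr// mul1r.
have e0 : 0 < e by rewrite subr_gt0.
have g20 : 0 < 2 * gamma by rewrite mulr_gt0.
(* This bounds the shift for all L >= 1, by ln L <= L^e / e and 1 <= L^e. *)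
pose B1 := (`|p| / e + `|k|) / (2 * gamma) * (2 * gamma)^-1 `^ (- e).
exists (K * expR (- (2 * d) * B1)); split; first by rewrite mulr_gt0 ?expR_gt0.
exists N => n nN; have [n0 L1' M0] := HN n nN; apply: le_trans.
have L0 : 0 < ln (n%:R : R) := lt_le_trans ltr01 L1'.
move: (ln (n%:R : R)) L1' L0 M0 => L L1' L0; set M := (_ / (2 * gamma)) => M0.
rewrite lee_fin -(mulrA K) ler_wpM2l ?(ltW K0)// mulrCA ler_wpM2l ?powR_ge0// -expRD ler_expR.
have -> : - 2 * d * (L / (2 * gamma)) `^ (b / beta) =
  - (2 * d) * (L / (2 * gamma)) `^ (b / beta) by ring.
rewrite -mulrDr ler_wnM2l ?oppr_le0 ?mulr_ge0//.
have x0 : 0 < L / (2 * gamma) by exact: divr_gt0.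
pose y := (`|p| * ln L + `|k|) / (2 * gamma).
have ln0 : 0 <= ln L by exact: ln_ge0.
have y0 : 0 <= y by rewrite divr_ge0 ?(ltW g20)// addr_ge0 ?mulr_ge0.
have My : M <= L / (2 * gamma) + y.
  rewrite /M /y -mulrDl ler_wpM2r ?invr_ge0 ?(ltW g20)// -addrA lerD2l lerD ?ler_norm//.
  by rewrite -mulNr ler_wpM2r// -normrN ler_norm.
have b1 : 0 <= b / beta by rewrite divr_ge0 ?(ltW beta_gt0).
have step : M `^ (b / beta) <= (L / (2 * gamma) + y) `^ (b / beta).
  apply: ge0_ler_powR => //; first by rewrite nnegrE ltW.
  by rewrite nnegrE addr_ge0 ?(ltW x0).
apply: (le_trans step); apply: (le_trans (powR_subadditive_le x0 y0 b1 (ltW t1))).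
rewrite addrC lerD2r (_ : b / beta - 1 = - e); last by rewrite /e; ring.
rewrite powRM ?invr_ge0 ?(ltW L0) ?(ltW g20)// mulrA ler_wpM2r ?powR_ge0//.
rewrite powRN ler_pdivrMr ?powR_gt0// /y [leRHS]mulrAC ler_wpM2r ?invr_ge0 ?(ltW g20)//.
rewrite mulrDl; apply: lerD; last first.
  by rewrite ler_peMr// -(powRr0 L) ler_powR// ltW.
by rewrite -mulrA ler_wpM2l// mulrC; exact: ln_le_powR.
Qed.

End logarithmic.

End rates.

(** * Assembly of the cases *)

(** One constant and one threshold must serve all cases, hence be fixed before the condition [P] is
    known; if [P] fails, any constant does. Allowing every C <= K lets the minimum over the cases be
    used. *)
Lemma conditional_lower_rate (R : realType) (V : nat -> \bar R) (P : Prop) (r : nat -> R) :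
  (forall n, 0 <= r n) -> (P -> lower_rate V r) ->
  exists K, 0 < K /\ exists N : nat, forall C n, C <= K -> (N <= n)%N -> P ->
    ((C * r n)%:E <= V n)%E.
Proof.
move=> r0 Pr; have [p|np] := pselect P; last by exists 1; split=> //; exists 0%N.
have [K [K0 [N HN]]] := Pr p; exists K; split=> //; exists N => C n CK nN _.
by apply: le_trans (HN n nN); rewrite lee_fin ler_wpM2r.
Qed.

Theorem theorem3 (R : realType) (phi g : R -> R) (phis : R -> R[i])
  (s B Cg2 Cphi1 alpha beta gamma a b d Cg tau : R)
  (omega0 rhomax : R) (rho : R -> R)
  (hs : 0 <= s) (hB : 0 < B)
  (hg : is_pdf g)
  (hphi : is_fourier phi phis)
  (hPhi : forall f, Omega s B f -> parseval phi phis f)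
  (hgbd : exists M : R, forall x, g x <= M)
  (hCg2 : 0 < Cg2) (hCphi1 : 0 < Cphi1)
  (halpha : 0 <= alpha) (hbeta : 0 <= beta) (hgamma : 0 <= gamma)
  (ha : 0 <= a) (hb : 0 <= b) (hd : 0 <= d)
  (hgamma0 : gamma = 0 -> 0 < alpha /\ beta = 0)
  (hd0 : d = 0 -> b = 0)
  (hgs : forall w : R, normc (fourier g w) <=
     Cg2 * (w ^+ 2 + 1) `^ (- alpha / 2) * expR (- gamma * `|w| `^ beta))
  (hphis : forall w : R,
     Cphi1 * (w ^+ 2 + 1) `^ (- a / 2) * expR (- d * `|w| `^ b)
     <= normc (phis w))
  (hgsder : forall w : R, cderivable (fourier g) w)
  (hCg : 0 < Cg) (htau : 0 <= tau) (htau0 : gamma = 0 -> tau = 0)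
  (hgsratio : forall w : R, fourier g w != 0 /\
     normc (cderive (fourier g) w) / normc (fourier g w)
     <= Cg * (1 + `|w|) `^ tau)
  (homega0 : 0 < omega0)
  (hrho : forall w : R, omega0 < `|w| ->
     [/\ phis w = (normc (phis w))%:C%C * expi (rho w),
         derivable rho w 1, derivable (derive1 rho) w 1,
         {for w, continuous (derive1n 2 rho)} &
         forall j : nat, (j <= 2)%N -> `|derive1n j rho w| <= rhomax]) :
  exists C : R, 0 < C /\ exists N : nat, forall n : nat, (N <= n)%N ->
    let lower_bound (rate : R) :=
      ((C * rate)%:E <= minimax_risk phi g (Omega s B) n)%E in
    let Utau := Num.min (7 * beta - 2 * tau - 1) (5 * beta + 1) in
    let U3 := 2 * a + 2 * s * (1 - d / gamma) - 2 * d * alpha / gamma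
              + 8 * beta - (Utau + 1) * d / gamma - 1 in
    let U4 := 2 * a + 2 * s + 8 * b - 1 in
    (b > beta \/ (b = beta /\ 0 < gamma < d) ->
       lower_bound n%:R^-1)
    /\
    (b = beta -> d = gamma -> a >= alpha + 1 / 2 ->
       lower_bound n%:R^-1)
    /\
    (b = beta -> beta > 0 -> d = gamma -> gamma > 0 -> a < alpha + 1 / 2 ->
       lower_bound n%:R^-1)
    /\
    (d = 0 -> gamma = 0 -> a < alpha + 1 / 2 ->
       lower_bound
         (n%:R `^ (- ((2 * s + 2 * a - 1) / (2 * s + 2 * alpha)))))
    /\
    (b = beta -> beta > 0 -> gamma >= d -> d > 0 ->
       lower_bound
         ((ln n%:R) `^ (- (U3 / beta)) * n%:R `^ (- (d / gamma))))
    /\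
    (b < beta -> d > 0 -> gamma > 0 ->
       lower_bound
         ((ln n%:R) `^ (- (U4 / beta))
          * expR (- 2 * d * (ln n%:R / (2 * gamma)) `^ (b / beta))))
    /\
    (b = 0 -> d = 0 -> beta > 0 -> gamma > 0 ->
       lower_bound ((ln n%:R) `^ (- ((2 * s + 2 * a - 1) / beta)))).
Proof.
have hrho1 w : omega0 < `|w| -> [/\ phis w = (normc (phis w))%:C%C * expi (rho w),
    derivable rho w 1 & `|derive1 rho w| <= rhomax].
  by move=> /hrho[e dr _ _ /(_ 1%N isT)].
have [c [C [m0 [c0 C0 m01 bump]]]] := minimax_risk_bump hs hB hg hphi hPhi hCg2 hCphi1
  halpha hbeta hgamma ha hb hd hgs hphis hgsder hCg htau hgsratio homega0 hrho1.
pose V n := minimax_risk phi g (Omega s B) n.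
(* The rate 1/n holds for all parameters and settles the first three cases at once. *)
have [|_|K1 [K10 [N1 H1]]] := @conditional_lower_rate R V True (fun n => n%:R^-1).
- by move=> n; rewrite invr_ge0.
- exact: parametric_rate c0 C0 m01 bump.
have [||K2 [K20 [N2 H2]]] := @conditional_lower_rate R V (d = 0 /\ gamma = 0)
  (fun n => n%:R `^ (- ((2 * s + 2 * a - 1) / (2 * s + 2 * alpha)))).
- by move=> n; exact: powR_ge0.
- move=> [d_0 g_0]; have [alpha_gt0 _] := hgamma0 g_0.
  exact: (polynomial_rate hs hb c0 C0 m01 bump (hd0 d_0) d_0 g_0 (htau0 g_0)).
pose U := Num.min (7 * beta - 2 * tau - 1) (5 * beta + 1).
pose U3 := 2 * a + 2 * s * (1 - d / gamma) - 2 * d * alpha / gamma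
              + 8 * beta - (U + 1) * d / gamma - 1.
have [||K3 [K30 [N3 H3]]] := @conditional_lower_rate R V
  [/\ b = beta, 0 < beta, d <= gamma & 0 < gamma]
  (fun n => (ln n%:R) `^ (- (U3 / beta)) * n%:R `^ (- (d / gamma))).
- by move=> n; rewrite mulr_ge0 ?powR_ge0.
- move=> [b_beta beta0 d_gamma gamma_gt0].
  exact: (critical_rate hb hd htau c0 C0 m01 bump).
have [||K4 [K40 [N4 H4]]] := @conditional_lower_rate R V (b < beta /\ 0 < gamma)
  (fun n => (ln n%:R) `^ (- ((2 * a + 2 * s + 8 * b - 1) / beta)) *
    expR (- 2 * d * (ln n%:R / (2 * gamma)) `^ (b / beta))).
- by move=> n; rewrite mulr_ge0 ?powR_ge0 ?expR_ge0.
- move=> [b_beta gamma_gt0].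
  exact: (subcritical_rate hb hd c0 C0 m01 bump (le_lt_trans hb b_beta)).
exists (Num.min (Num.min K1 K2) (Num.min K3 K4)); split; first by rewrite !lt_min K10 K20 K30 K40.
exists (maxn (maxn N1 N2) (maxn N3 N4)) => n.
rewrite !geq_max => /andP[/andP[n1 n2] /andP[n3 n4]] lower_bound Utau U3' U4.
set K := Num.min _ _ in lower_bound *.
have [k1 k2 k3 k4] : [/\ K <= K1, K <= K2, K <= K3 & K <= K4].
  by rewrite !ge_min !lexx !orbT.
have rate1 : lower_bound n%:R^-1 by exact: H1.
split; first by [].
split; first by [].
split; first by [].
split; first by move=> d_0 g_0 _; exact: H2.
split.
  move=> b_beta beta0 d_gamma d0; apply: H3 => //; split=> //.
  exact: lt_le_trans d_gamma.
split; first by move=> b_beta _ g0; exact: H4.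
(* The last rate is the case b = d = 0 of the preceding one: the exponential factor becomes 1 and U4
   reduces to 2s + 2a - 1. *)
move=> b_0 d_0 beta0 g0.
have := H4 K n k4 n4; rewrite b_0 d_0 !mulr0 !mul0r expR0 mulr1 addr0.
by rewrite (addrC (2 * a)); apply.
Qed.
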